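(* Let $k$ be an algebraically closed field and $\Lambda$ an indecomposable finite dimensional $k$-algebra with Jacobson radical $\mathfrak{r}$. Let $H$ be a graded subalgebra of the Hochschild cohomology ring $\mathrm{HH}^*(\Lambda)$ such that $H$ is a commutative Noetherian ring with $H^0=\mathrm{HH}^0(\Lambda)=Z(\Lambda)$, and suppose that $\mathrm{Ext}^*_\Lambda(\Lambda/\mathfrak{r},\Lambda/\mathfrak{r})$ is a finitely generated $H$-module. Let $\mathfrak{a}$ be any homogeneous ideal in $H$. Then there exists a finitely generated left $\Lambda$-module $M$ such that $V_H(M)=V_H(\mathfrak{a})$.
   Context: $\mathrm{HH}^*(\Lambda)=\bigoplus_{i\ge 0}\mathrm{Ext}^i_{\Lambda^e}(\Lambda,\Lambda)$ with $\Lambda^e=\Lambda\otimes_k\Lambda^{\mathrm{op}}$. For finitely generated left $\Lambda$-modules $M,N$, $\mathrm{Ext}^*_\Lambda(M,N)=\bigoplus_{i\ge 0}\mathrm{Ext}^i_\Lambda(M,N)$ is a graded $\mathrm{HH}^*(\Lambda)$-module (hence an $H$-module) via the graded ring homomorphism $\mathrm{HH}^*(\Lambda)\to\mathrm{Ext}^*_\Lambda(M,M)$ induced by $-\otimes_\Lambda M$ followed by Yoneda product (equivalently, up to sign on homogeneous elements, via $-\otimes_\Lambda N$). The variety of $M$ is $V_H(M)=\{\mathfrak{m}\in\mathrm{MaxSpec}\,H\mid \mathrm{Ann}_H\mathrm{Ext}^*_\Lambda(M,\Lambda/\mathfrak{r})\subseteq\mathfrak{m}\}$. For a homogeneous ideal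 $\mathfrak{a}$ of $H$, $V_H(\mathfrak{a})$ is the set of maximal ideals of $H$ containing $\mathfrak{a}$. *)

(* Defs.v *)
From HB Require Import structures.
From mathcomp Require Import all_boot all_algebra all_field.
From mathcomp Require Import boolp classical_sets.

Set Implicit Arguments.
Unset Strict Implicit.
Unset Printing Implicit Defensive.

Import GRing.Theory.
Local Open Scope ring_scope.
Local Open Scope quotient_scope.

Section Modules.
Variable R : pzRingType.

Section MkLinear.
Variables (U V : lmodType R) (f : U -> V) (f_lin : linear f).
Definition linmap_fun := f.
HB.instance Definition _ := GRing.isLinear.Build R U V *:%R linmap_fun f_lin.
Definition linmap : {linear U -> V} := linmap_fun.
End MkLinear.

Definition fin_gen (V : lmodType R) : Prop :=
  exists (n : nat) (g : 'I_n -> V),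
    forall v, exists c : 'I_n -> R, v = \sum_i c i *: g i.

Definition projective (P : lmodType R) : Prop :=
  forall (X Y : lmodType R) (g : {linear X -> Y}) (f : {linear P -> Y}),
    (forall y, exists x, g x = y) ->
    exists h : {linear P -> X}, forall p, g (h p) = f p.

Section Pullback.
Variables (X Y P : lmodType R) (g : {linear X -> Y}) (f : {linear P -> Y}).

Definition pb_pred : {pred X * P} := fun u => g u.1 == f u.2.

Lemma pb_submod : submod_closed pb_pred.
Proof.
split=> [|a u v]; rewrite !unfold_in /= ?raddf0 //.
by move=> /eqP Hu /eqP Hv; rewrite !linearP Hu Hv.
Qed.
HB.instance Definition _ :=
  GRing.isSubmodClosed.Build R (X * P)%type pb_pred pb_submod.

Record pullback := Pullback {pb_val : X * P; _ : pb_val \in pb_pred}.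
HB.instance Definition _ := [isSub for pb_val].
HB.instance Definition _ := [Choice of pullback by <:].
HB.instance Definition _ := [SubChoice_isSubLmodule of pullback by <:].

Lemma projective_lift : projective P ->
  (forall p, exists x, g x = f p) ->
  exists h : {linear P -> X}, forall p, g (h p) = f p.
Proof.
move=> projP im.
pose q (w : pullback) : P := (val w).2.
have qlin : linear q by move=> a u v; rewrite /q linearP.
have [|h hh] := projP _ _ (linmap qlin) (idfun : {linear P -> P}).
  move=> p; have [x xp] := im p.
  have pin : (x, p) \in pb_pred by rewrite unfold_in /= xp.
  by exists (Pullback pin).
pose t (p : P) : X := (val (h p)).1.
have tlin : linear t by move=> a u v; rewrite /t !linearP.
exists (linmap tlin) => p.
have /eqP e : g (val (h p)).1 == f (val (h p)).2 := valP (h p).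
exact: etrans e (congr1 f (hh p)).
Qed.

End Pullback.

Record complex := Complex {
  cx :> nat -> lmodType R;
  cxd : forall n, {linear cx n.+1 -> cx n};
  cxdd : forall n x, cxd n (cxd n.+1 x) = 0
}.

(* Projective resolutions by finitely generated modules, which every finitely
   generated module over a finite dimensional algebra has.  Ext is computed
   below from an arbitrary one; any two are homotopy equivalent. *)
Record resolution (X : lmodType R) := Resolution {
  res_cx :> complex;
  res_aug : {linear res_cx 0 -> X};
  res_proj : forall n, projective (res_cx n);
  res_fg : forall n, fin_gen (res_cx n);
  res_aug_surj : forall y, exists x, res_aug x = y;
  res_aug_d : forall x, res_aug (cxd res_cx 0 x) = 0;
  res_exact0 : forall x, res_aug x = 0 -> exists y, cxd res_cx 0 y = x;
  res_exactS : forall n x, cxd res_cx n x = 0 -> exists y, cxd res_cx n.+1 y = x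
}.

Section Ext.
Variables (Q : complex) (N : lmodType R).

(* An element of the direct sum over n of the degree n cocycles of
   Hom_R(Q_n, N): a finitely supported family. *)
Record cocycle := Cocycle {
  cc : forall n, Q n -> N;
  cc_lin : forall n, linear (@cc n);
  cc_fin : exists b, forall n, (b <= n)%N -> forall x, @cc n x = 0;
  cc_d : forall n x, @cc n (cxd Q n x) = 0
}.

Arguments cc : clear implicits.
Arguments cc_lin : clear implicits.
HB.instance Definition _ := gen_eqMixin cocycle.
HB.instance Definition _ := gen_choiceMixin cocycle.
HB.instance Definition _ (f : cocycle) n :=
  GRing.isLinear.Build R (Q n) N *:%R (cc f n) (cc_lin f n).

Lemma cocycleP (f g : cocycle) : (forall n x, cc f n x = cc g n x) -> f = g.
Proof.
case: f g => [f f1 f2 f3] [g g1 g2 g3] /= fg.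
have E : f = g by apply: functional_extensionality_dep => n; apply: funext => x.
by subst g; congr Cocycle; apply: Prop_irrelevance.
Qed.

Definition cc0 : cocycle.
Proof.
exists (fun _ _ => 0) => //; first by move=> n a x y; rewrite scaler0 addr0.
by exists 0%N.
Defined.

Definition ccN (f : cocycle) : cocycle.
Proof.
exists (fun n x => - cc f n x).
- by move=> n a x y; rewrite linearP opprD scalerN.
- by have [b hb] := cc_fin f; exists b => n bn x; rewrite hb ?oppr0.
- by move=> n x; rewrite cc_d oppr0.
Defined.

Definition ccD (f g : cocycle) : cocycle.
Proof.
exists (fun n x => cc f n x + cc g n x).
- by move=> n a x y; rewrite !linearP scalerDr addrACA.
- have [b hb] := cc_fin f; have [c hc] := cc_fin g.
  by exists (maxn b c) => n; rewrite geq_max => /andP[bn cn] x; rewrite hb ?hc ?addr0.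
- by move=> n x; rewrite !cc_d addr0.
Defined.

Lemma ccA : associative ccD.
Proof. by move=> f g h; apply: cocycleP => n x /=; rewrite addrA. Qed.
Lemma ccC : commutative ccD.
Proof. by move=> f g; apply: cocycleP => n x /=; rewrite addrC. Qed.
Lemma cc0D : left_id cc0 ccD.
Proof. by move=> f; apply: cocycleP => n x /=; rewrite add0r. Qed.
Lemma ccND : left_inverse cc0 ccN ccD.
Proof. by move=> f; apply: cocycleP => n x /=; rewrite addNr. Qed.
HB.instance Definition _ := GRing.isZmodule.Build cocycle ccA ccC cc0D ccND.

Lemma cc_add (f g : cocycle) n x : cc (f + g) n x = cc f n x + cc g n x.
Proof. by []. Qed.
Lemma cc_opp (f : cocycle) n x : cc (- f) n x = - cc f n x.
Proof. by []. Qed.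
Lemma cc_zero n x : cc (0 : cocycle) n x = 0.
Proof. by []. Qed.

(* The family g may be truncated where f vanishes, so asking for finite support
   here would define the same coboundaries. *)
Definition is_coboundary (f : cocycle) : Prop :=
  (forall x, cc f 0 x = 0) /\
  exists g : forall n, {linear Q n -> N},
    forall n x, cc f n.+1 x = g n (cxd Q n x).

Definition coboundary : {pred cocycle} := fun f => `[< is_coboundary f >].

Lemma coboundaryE f : (f \in coboundary) = `[< is_coboundary f >].
Proof. by []. Qed.

Lemma coboundary_zmod : zmod_closed coboundary.
Proof.
split=> [|f g]; rewrite !coboundaryE.
  apply/asboolP; split=> //.
  by exists (fun n => \0%R) => n x.
move=> /asboolP[f0 [u hu]] /asboolP[g0 [v hv]]; apply/asboolP; split.
  by move=> x; rewrite cc_add cc_opp f0 g0 subr0.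
by exists (fun n => (u n \- v n)%R) => n x; rewrite cc_add cc_opp hu hv.
Qed.
HB.instance Definition _ := GRing.isZmodClosed.Build cocycle coboundary coboundary_zmod.

(* The total cohomology of Hom_R(Q, N); it is Ext_R^*(X, N) when Q is a
   projective resolution of X. *)
Definition Ext : Type := (Quotient.quot coboundary).
HB.instance Definition _ := GRing.Zmodule.on Ext.

Definition ext_class (f : cocycle) : Ext := \pi_(Quotient.quot coboundary) f.
Definition ext_repr (x : Ext) : cocycle := repr (x : (Quotient.quot coboundary)).

Lemma ext_reprK x : ext_class (ext_repr x) = x.
Proof. exact: (@reprK _ (Quotient.quot coboundary) x). Qed.

Lemma ext_class_eq f g : (ext_class f = ext_class g) <-> is_coboundary (f - g).
Proof.
split=> [/eqP|h]; last apply/eqP.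
  by rewrite /ext_class -Quotient.idealrBE coboundaryE => /asboolP.
by rewrite /ext_class -Quotient.idealrBE coboundaryE; apply/asboolP.
Qed.

Lemma ext_classD f g : ext_class (f + g) = ext_class f + ext_class g.
Proof. exact: (raddfD (\pi_(Quotient.quot coboundary))). Qed.

Lemma ext_class0 : ext_class 0 = 0.
Proof. exact: (raddf0 (\pi_(Quotient.quot coboundary))). Qed.

Definition cc_comp (i : nat) (f : cocycle) : cocycle.
Proof.
exists (fun n x => if n == i then cc f n x else 0).
- by move=> n a x y; case: eqP => _; rewrite ?linearP ?scaler0 ?addr0.
- by have [b hb] := cc_fin f; exists b => n bn x; rewrite hb ?if_same.
- by move=> n x; rewrite cc_d if_same.
Defined.

Definition ext_comp (i : nat) (x : Ext) : Ext := ext_class (cc_comp i (ext_repr x)).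

Lemma ext_compE i f : ext_comp i (ext_class f) = ext_class (cc_comp i f).
Proof.
apply/ext_class_eq; have /ext_class_eq [f0 [u hu]] := ext_reprK (ext_class f).
split=> [x|]; rewrite ?cc_add ?cc_opp /=.
  by case: eqP; rewrite ?subr0 //; have := f0 x; rewrite cc_add cc_opp.
exists (fun n => if n.+1 == i then u n else \0%R) => n x.
by case: eqP => _; rewrite ?subr0 // -hu cc_add cc_opp.
Qed.

Lemma ext_comp_sum x : exists b, x = \sum_(i < b) ext_comp i x.
Proof.
have [b hb] := cc_fin (ext_repr x); exists b; rewrite -{1}(ext_reprK x).
have cl_sum (F : 'I_b -> cocycle) :
    ext_class (\sum_(i < b) F i) = \sum_(i < b) ext_class (F i).
  exact: (raddf_sum (\pi_(Quotient.quot coboundary))).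
rewrite -cl_sum; congr ext_class; apply: cocycleP => n a.
have -> : cc (\sum_(i < b) cc_comp i (ext_repr x)) n a =
    \sum_(i < b) cc (cc_comp i (ext_repr x)) n a.
  by elim/big_rec2: _ => // i y z _ <-.
have [bn|nb] := leqP b n.
  by rewrite hb // big1 // => i _ /=; case: eqP => // _; rewrite hb.
rewrite (bigD1 (Ordinal nb)) //= eqxx big1 ?addr0 // => i ni.
by rewrite ifN //; apply: contra ni => /eqP e; apply/eqP/val_inj.
Qed.

End Ext.
Arguments cc {Q N} f n x : rename.
Arguments cc_lin {Q N} f n a x y : rename.

Section GradedMaps.
Variable Q : complex.

(* Finite sums of homogeneous chain maps Q_(m+n) -> Q_m: the map gm p m is the
   component of degree p - m.  Indexing by source and target avoids the casts
   between Q (m + n) and Q (n + m). *)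
Record gmap := Gmap {
  gm : forall p m, Q p -> Q m;
  gm_lin : forall p m, linear (@gm p m);
  gm_low : forall p m, (p < m)%N -> forall x, @gm p m x = 0;
  gm_fin : exists b, forall p m, (m + b <= p)%N -> forall x, @gm p m x = 0;
  gm_d : forall p m x, @gm p m (cxd Q p x) = cxd Q m (@gm p.+1 m.+1 x)
}.
Arguments gm : clear implicits.
Arguments gm_lin : clear implicits.
HB.instance Definition _ (phi : gmap) p m :=
  GRing.isLinear.Build R (Q p) (Q m) *:%R (gm phi p m) (gm_lin phi p m).

Definition gm1_fun p m (x : Q p) : Q m :=
  if p =P m is ReflectT e then ecast i (Q i) e x else 0.

Lemma gm1E p x : @gm1_fun p p x = x.
Proof. by rewrite /gm1_fun; case: (p =P p) => // e; rewrite (eq_irrelevance e erefl). Qed.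
Lemma gm1_neq p m x : p <> m -> @gm1_fun p m x = 0.
Proof. by rewrite /gm1_fun; case: (p =P m). Qed.

Definition gm1 : gmap.
Proof.
exists gm1_fun.
- move=> p m a x y; have [<-|/eqP n] := eqVneq p m; first by rewrite !gm1E.
  by rewrite !gm1_neq // scaler0 addr0.
- by move=> p m pm x; rewrite gm1_neq // => e; rewrite e ltnn in pm.
- exists 1%N => p m pm x; rewrite gm1_neq // => e.
  by rewrite e addn1 ltnn in pm.
- move=> p m x; have [<-|/eqP n] := eqVneq p m; first by rewrite !gm1E.
  by rewrite !gm1_neq ?raddf0 // => -[].
Defined.

Definition gmM (phi psi : gmap) : gmap.
Proof.
exists (fun p m x => \sum_(q < p.+1) gm phi q m (gm psi p q x)).
- move=> p m a x y; rewrite scaler_sumr -big_split /=.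
  by apply: eq_bigr => q _; rewrite !linearP.
- move=> p m pm x; apply: big1 => q _; apply: gm_low.
  by rewrite (leq_trans _ pm) ?ltn_ord.
- have [b hb] := gm_fin phi; have [c hc] := gm_fin psi.
  exists (b + c)%N => p m h x; apply: big1 => q _.
  have [bq|qb] := leqP (m + b) q; first exact: hb.
  by rewrite hc ?raddf0 // (leq_trans _ h) // addnA leq_add2r ltnW.
- move=> p m x; rewrite [in RHS]big_ord_recl.
  rewrite [X in X + _]gm_low // add0r raddf_sum.
  by apply: eq_bigr => q _; rewrite !gm_d.
Defined.

Definition gmD (phi psi : gmap) : gmap.
Proof.
exists (fun p m x => gm phi p m x + gm psi p m x).
- by move=> p m a x y; rewrite !linearP scalerDr addrACA.
- by move=> p m pm x; rewrite !gm_low // addr0.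
- have [b hb] := gm_fin phi; have [c hc] := gm_fin psi.
  exists (maxn b c) => p m h x; rewrite hb ?hc ?addr0 //.
    by rewrite (leq_trans _ h) // leq_add2l leq_maxr.
  by rewrite (leq_trans _ h) // leq_add2l leq_maxl.
- by move=> p m x; rewrite !gm_d raddfD.
Defined.

Section Act.
Variable N : lmodType R.

Definition cact (f : cocycle Q N) (phi : gmap) : cocycle Q N.
Proof.
exists (fun n x => \sum_(m < n.+1) cc f m (gm phi n m x)).
- move=> n a x y; rewrite scaler_sumr -big_split /=.
  by apply: eq_bigr => q _; rewrite !linearP.
- have [b hb] := cc_fin f; have [c hc] := gm_fin phi.
  exists (b + c)%N => n h x; apply: big1 => q _.
  have [bq|qb] := leqP b q; first exact: hb.
  by rewrite hc ?raddf0 // (leq_trans _ h) // leq_add2r ltnW.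
- by move=> n x; apply: big1 => q _; rewrite gm_d cc_d.
Defined.

Lemma cactE f phi n x :
  cc (cact f phi) n x = \sum_(m < n.+1) cc f m (gm phi n m x).
Proof. by []. Qed.

Lemma cactDl f g phi : cact (f + g) phi = cact f phi + cact g phi.
Proof.
apply: cocycleP => n x; rewrite cc_add !cactE -big_split /=.
by apply: eq_bigr.
Qed.

Lemma cactDr f phi psi : cact f (gmD phi psi) = cact f phi + cact f psi.
Proof.
apply: cocycleP => n x; rewrite cc_add !cactE -big_split /=.
by apply: eq_bigr => m _; rewrite raddfD.
Qed.

Lemma cact1 f : cact f gm1 = f.
Proof.
apply: cocycleP => n x; rewrite cactE (bigD1 ord_max) //= gm1E.
rewrite big1 ?addr0 // => i /eqP ni; rewrite gm1_neq ?raddf0 //.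
by move=> e; apply: ni; apply: val_inj.
Qed.

Lemma cactA f phi psi : cact (cact f phi) psi = cact f (gmM phi psi).
Proof.
apply: cocycleP => n x; rewrite !cactE /=.
under [RHS]eq_bigr => m _ do rewrite raddf_sum.
rewrite [RHS]exchange_big /=; apply: eq_bigr => q _.
rewrite (big_ord_widen n.+1 (fun m => cc f m (gm phi q m (gm psi n q x)))) //.
rewrite big_mkcond /=; apply: eq_bigr => m _; case: ifP => // /negbT.
by rewrite -leqNgt => h; rewrite gm_low ?raddf0.
Qed.

Lemma cact_coboundary f phi : is_coboundary f -> is_coboundary (cact f phi).
Proof.
case=> f0 [u hu]; split=> [x|].
  by rewrite cactE big_ord1.
have lin n : linear (fun x : Q n => \sum_(m < n.+1) u m (gm phi n m x)).
  move=> a x y; rewrite scaler_sumr -big_split /=.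
  by apply: eq_bigr => q _; rewrite !linearP.
exists (fun n => linmap (lin n)) => n x; rewrite cactE big_ord_recl.
rewrite f0 add0r; apply: eq_bigr => m _.
by rewrite gm_d hu.
Qed.

Lemma cact_homotopy (f : cocycle Q N) (phi psi : gmap) (s : forall p m, Q p -> Q m) :
    (forall p m, linear (@s p m)) ->
    (forall m x, gm phi 0 m x - gm psi 0 m x = cxd Q m (@s 0%N m.+1 x)) ->
    (forall p m x, gm phi p.+1 m x - gm psi p.+1 m x =
       cxd Q m (@s p.+1 m.+1 x) + @s p m (cxd Q p x)) ->
  is_coboundary (cact f phi - cact f psi).
Proof.
move=> s_lin s0 sS; split=> [x|].
  by rewrite cc_add cc_opp !cactE !big_ord1 -raddfB s0 /= cc_d.
have lin n : linear (fun x : Q n => \sum_(m < n.+2) cc f m (@s n m x)).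
  move=> a x y; rewrite scaler_sumr -big_split /=.
  by apply: eq_bigr => q _; rewrite s_lin linearP.
exists (fun n => linmap (lin n)) => n x.
rewrite cc_add cc_opp !cactE -sumrB; apply: eq_bigr => m _.
by rewrite -raddfB sS raddfD /= cc_d add0r.
Qed.

End Act.
End GradedMaps.
Arguments gm {Q} phi p m x : rename.
Arguments gm_lin {Q} phi p m a x y : rename.

Section Lifts.
Variables (X : lmodType R) (P : resolution X).

Definition is_lift (z : cocycle P X) (phi : gmap P) : Prop :=
  forall n x, res_aug P (gm phi n 0%N x) = cc z n x.

(* The zero map is lifted to zero, which keeps lifts of finitely supported
   cocycles finitely supported. *)
Definition lift_of (n : nat) (Y Z : lmodType R) (g : {linear Y -> Z})
    (f : {linear P n -> Z}) : {linear P n -> Y} :=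
  if pselect (forall p, f p = 0) is left _ then \0%R else
  if pselect (exists h : {linear P n -> Y}, forall p, g (h p) = f p) is left e
  then projT1 (cid e) else \0%R.

Lemma lift_ofE (n : nat) (Y Z : lmodType R) (g : {linear Y -> Z}) (f : {linear P n -> Z}) :
  (forall p, exists y, g y = f p) -> forall p, g (lift_of g f p) = f p.
Proof.
move=> im p; rewrite /lift_of; case: pselect => [f0|_].
  by rewrite f0 raddf0.
case: pselect => [e|ne]; first by rewrite (projT2 (cid e)).
by case: ne; apply: projective_lift => //; apply: res_proj.
Qed.

Lemma lift_of0 (n : nat) (Y Z : lmodType R) (g : {linear Y -> Z}) (f : {linear P n -> Z}) :
  (forall p, f p = 0) -> forall p, lift_of g f p = 0.
Proof. by move=> f0 p; rewrite /lift_of; case: pselect. Qed.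

Section Existence.
Variable z : cocycle P X.

Fixpoint lift_fun (m p : nat) {struct m} : {linear P p -> P m} :=
  match m with
  | 0 => lift_of (res_aug P) (cc z p : {linear _ -> _})
  | m'.+1 =>
    match p with
    | 0 => \0%R
    | p'.+1 => lift_of (cxd P m') (lift_fun m' p' \o cxd P p')%FUN
    end
  end.

Lemma lift_fun0 p x : res_aug P (lift_fun 0 p x) = cc z p x.
Proof. by rewrite /= lift_ofE // => y; apply: res_aug_surj. Qed.

Lemma lift_funS m p x :
  cxd P m (lift_fun m.+1 p.+1 x) = lift_fun m p (cxd P p x).
Proof.
elim: m p x => [|m IHm] p x.
  rewrite [lift_fun 1 _]/= lift_ofE // => y.
  by apply: res_exact0; rewrite [LHS]lift_fun0 cc_d.
rewrite [lift_fun m.+2 _]/= lift_ofE // => y; apply: res_exactS.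
case: p x y => [|p] x y; first by rewrite /= raddf0.
by rewrite [in LHS](IHm p) cxdd raddf0.
Qed.

Lemma lift_exists : exists phi, is_lift z phi.
Proof.
have low p m : (p < m)%N -> forall x, lift_fun m p x = 0.
  elim: m p => // m IHm [|p] pm x //.
  by apply: lift_of0 => y /=; apply: IHm.
have fin : exists b, forall p m, (m + b <= p)%N -> forall x, lift_fun m p x = 0.
  have [b hb] := cc_fin z; exists b => p m; elim: m p => [|m IHm] p h x.
    by apply: lift_of0 => y; apply: hb.
  by case: p h x => // p h x; apply: lift_of0 => y; apply: IHm.
have lin p m : linear (lift_fun m p) by move=> a x y; rewrite linearP.
have comm p m x : lift_fun m p (cxd P p x) = cxd P m (lift_fun m.+1 p.+1 x).
  by rewrite lift_funS.
exists (@Gmap P (fun p m => lift_fun m p) lin low fin comm) => n x.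
exact: lift_fun0.
Qed.

End Existence.

Lemma lift_homotopy z w phi psi : is_lift z phi -> is_lift w psi ->
    is_coboundary (z - w) ->
  exists s : forall p m, {linear P p -> P m},
    (forall m x, gm phi 0 m x - gm psi 0 m x = cxd P m (s 0%N m.+1 x)) /\
    (forall p m x, gm phi p.+1 m x - gm psi p.+1 m x =
       cxd P m (s p.+1 m.+1 x) + s p m (cxd P p x)).
Proof.
move=> lz lw [zw0 [g hg]].
pose chi p m : {linear P p -> P m} := (gm phi p m \- gm psi p m)%R.
have chiE p m x : chi p m x = gm phi p m x - gm psi p m x by [].
pose t := fix t m p {struct m} : {linear P p -> P m} :=
  match m with
  | 0 => lift_of (res_aug P) (g p)
  | m'.+1 =>
    match p with
    | 0 => lift_of (cxd P m') (chi 0%N m')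
    | p'.+1 => lift_of (cxd P m') (chi p'.+1 m' \- (t m' p' \o cxd P p')%FUN)%R
    end
  end.
have chid p m x : chi p m (cxd P p x) = cxd P m (chi p.+1 m.+1 x).
  by rewrite !chiE !gm_d raddfB.
have aug p x : res_aug P (chi p 0%N x) = cc (z - w) p x.
  by rewrite chiE raddfB /= lz lw.
have t0 p x : res_aug P (t 0%N p x) = g p x.
  by rewrite /= lift_ofE // => y; apply: res_aug_surj.
have tS0 m x : cxd P m (t m.+1 0%N x) = chi 0%N m x.
  rewrite /= lift_ofE // => y; case: m {x} y => [|m] y.
    by apply: res_exact0; rewrite aug zw0.
  by exists 0; rewrite raddf0 chiE !gm_low // subrr.
have tSS m p x : cxd P m (t m.+1 p.+1 x) = chi p.+1 m x - t m p (cxd P p x).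
  elim: m p x => [|m IHm] p x.
    rewrite [t 1%N _]/= lift_ofE // => y; apply: res_exact0.
    by rewrite raddfB /= t0 -hg -aug /= subrr.
  rewrite [t m.+2 _]/= lift_ofE // => y; apply: res_exactS.
  rewrite raddfB [X in _ - X](_ : _ = chi p m (cxd P p y)).
    by rewrite chid subrr.
  rewrite [LHS]/=; case: p x y => [|p] x y; first exact: tS0.
  by rewrite [LHS]IHm cxdd raddf0 subr0.
exists (fun p m => t m p); split=> [m x|p m x].
  by rewrite tS0.
by rewrite tSS subrK.
Qed.

Definition lift (z : cocycle P X) : gmap P := projT1 (cid (lift_exists z)).

Lemma liftP z : is_lift z (lift z).
Proof. exact: projT2 (cid (lift_exists z)). Qed.

(* Yoneda product: x composed with a chain map lifting y, without sign; by
   yoneda_class it depends neither on the lift nor on the representatives. *)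
Definition yoneda (x y : Ext P X) : Ext P X :=
  ext_class (cact (ext_repr x) (lift (ext_repr y))).

Lemma yoneda_class f z phi : is_lift z phi ->
  yoneda (ext_class f) (ext_class z) = ext_class (cact f phi).
Proof.
move=> lz; rewrite /yoneda.
set f' := ext_repr _; set z' := ext_repr _.
transitivity (ext_class (cact f (lift z'))); apply/ext_class_eq.
  have -> : cact f' (lift z') - cact f (lift z') = cact (f' - f) (lift z').
    by apply/eqP; rewrite subr_eq -cactDl subrK.
  by apply: cact_coboundary; apply/ext_class_eq; apply: ext_reprK.
have zz : is_coboundary (z' - z) by apply/ext_class_eq; apply: ext_reprK.
have [s [s0 sS]] := lift_homotopy (liftP z') lz zz.
apply: (@cact_homotopy _ _ f _ _ (fun p m => s p m)) => //.
by move=> p m a x y; rewrite linearP.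
Qed.

Definition ext_one : cocycle P X.
Proof.
exists (fun n x => res_aug P (gm (gm1 P) n 0%N x)).
- by move=> n a x y; rewrite !linearP.
- by exists 1%N => n n0 x; rewrite /= gm1_neq ?raddf0 // => e; rewrite e in n0.
- by move=> n x; rewrite gm_d res_aug_d.
Defined.

Lemma ext_one_lift : is_lift ext_one (gm1 P).
Proof. by []. Qed.

Lemma lift_gmD z w phi psi : is_lift z phi -> is_lift w psi ->
  is_lift (z + w) (gmD phi psi).
Proof. by move=> lz lw n x; rewrite /= raddfD /= lz lw. Qed.

Lemma lift_gmM z w phi psi : is_lift z phi -> is_lift w psi ->
  is_lift (cact z psi) (gmM phi psi).
Proof.
move=> lz lw n x /=; rewrite raddf_sum; apply: eq_bigr => m _.
by exact: lz.
Qed.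

Lemma ext_ind (Q : complex) (N : lmodType R) (T : Ext Q N -> Prop) :
  (forall f, T (ext_class f)) -> forall x, T x.
Proof. by move=> h x; rewrite -(ext_reprK x). Qed.

Lemma yonedaA : associative yoneda.
Proof.
elim/ext_ind=> x; elim/ext_ind=> y; elim/ext_ind=> z.
rewrite (yoneda_class y (liftP z)) (yoneda_class x (lift_gmM (liftP y) (liftP z))).
by rewrite -cactA !(yoneda_class _ (liftP _)).
Qed.

Lemma yoneda1x : left_id (ext_class ext_one) yoneda.
Proof.
elim/ext_ind=> x; rewrite (yoneda_class _ (liftP _)); congr ext_class.
apply: cocycleP => n a; rewrite cactE big_ord_recl big1 ?addr0 /=.
  by rewrite gm1E liftP.
by move=> i _; rewrite gm1_neq // raddf0.
Qed.

Lemma yonedax1 : right_id (ext_class ext_one) yoneda.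
Proof. by elim/ext_ind=> x; rewrite (yoneda_class _ ext_one_lift) cact1. Qed.

Lemma yonedaDl : left_distributive yoneda +%R.
Proof.
elim/ext_ind=> x; elim/ext_ind=> y; elim/ext_ind=> z.
by rewrite -ext_classD !(yoneda_class _ (liftP _)) -ext_classD cactDl.
Qed.

Lemma yonedaDr : right_distributive yoneda +%R.
Proof.
elim/ext_ind=> x; elim/ext_ind=> y; elim/ext_ind=> z.
rewrite -ext_classD (yoneda_class _ (lift_gmD (liftP y) (liftP z))).
by rewrite !(yoneda_class _ (liftP _)) -ext_classD cactDr.
Qed.

Definition YonedaExt : Type := Ext P X.
HB.instance Definition _ := GRing.Zmodule.on YonedaExt.
HB.instance Definition _ := GRing.Zmodule_isPzRing.Build YonedaExt
  yonedaA yoneda1x yonedax1 yonedaDl yonedaDr.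

End Lifts.

End Modules.
Arguments cc {R Q N} f n x : rename.
Arguments cc_lin {R Q N} f n a x y : rename.
Arguments gm {R Q} phi p m x : rename.
Arguments gm_lin {R Q} phi p m a x y : rename.

Section Tensor.
Variables (A : Type) (U V : zmodType) (ra : U -> A -> U) (la : A -> V -> V).

Record balanced (W : zmodType) (b : U -> V -> W) : Prop := Balanced {
  balDl : forall u u' v, b (u + u') v = b u v + b u' v;
  balDr : forall u v v', b u (v + v') = b u v + b u v';
  balA : forall u a v, b (ra u a) v = b u (la a v)
}.

Definition tsum (W : zmodType) (b : U -> V -> W) (s : seq (U * V)) : W :=
  \sum_(p <- s) b p.1 p.2.

(* Finite formal sums of pairs are identified when no balanced biadditive map
   separates them; the quotient is the tensor product over A. *)
Definition tequiv : rel (seq (U * V)) := fun s t =>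
  `[< forall (W : zmodType) (b : U -> V -> W), balanced b -> tsum b s = tsum b t >].

Lemma tequiv_class : equiv_class_of tequiv.
Proof.
split=> [s|s t|t s r]; first by apply/asboolP.
  by apply/asboolP/asboolP => h W b bb; rewrite h.
by move=> /asboolP st /asboolP tr; apply/asboolP => W b bb; rewrite st ?tr.
Qed.
Canonical tequiv_equiv := EquivRelPack tequiv_class.
Canonical tequiv_encModRel := defaultEncModRel tequiv.

Definition tensor : Type := {eq_quot tequiv}.
HB.instance Definition _ := Choice.on tensor.

Definition tclass (s : seq (U * V)) : tensor := \pi_{eq_quot tequiv} s.
Definition trepr (x : tensor) : seq (U * V) := repr (x : {eq_quot tequiv}).

Lemma treprK x : tclass (trepr x) = x.
Proof. exact: (@reprK _ {eq_quot tequiv} x). Qed.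

Lemma tclass_eq s t : tclass s = tclass t <->
  (forall (W : zmodType) (b : U -> V -> W), balanced b -> tsum b s = tsum b t).
Proof.
by split=> [/eqP|h]; [rewrite /tclass piE => /asboolP|apply/eqP; rewrite /tclass piE; apply/asboolP].
Qed.

Lemma tsum_repr (W : zmodType) (b : U -> V -> W) s :
  balanced b -> tsum b (trepr (tclass s)) = tsum b s.
Proof. by move: W b; apply/tclass_eq; rewrite treprK. Qed.

Lemma tsum_cat (W : zmodType) (b : U -> V -> W) s t :
  tsum b (s ++ t) = tsum b s + tsum b t.
Proof. exact: big_cat. Qed.

Definition toppr (s : seq (U * V)) := [seq (- p.1, p.2) | p <- s].

Lemma bal0l (W : zmodType) (b : U -> V -> W) v : balanced b -> b 0 v = 0.
Proof. by move=> bb; apply: (addrI (b 0 v)); rewrite -balDl // !addr0. Qed.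
Lemma bal0r (W : zmodType) (b : U -> V -> W) u : balanced b -> b u 0 = 0.
Proof. by move=> bb; apply: (addrI (b u 0)); rewrite -balDr // !addr0. Qed.
Lemma balNl (W : zmodType) (b : U -> V -> W) u v : balanced b -> b (- u) v = - b u v.
Proof. by move=> bb; apply/eqP; rewrite -addr_eq0 -balDl // addNr bal0l. Qed.

Lemma tsum_opp (W : zmodType) (b : U -> V -> W) s :
  balanced b -> tsum b (toppr s) = - tsum b s.
Proof.
by move=> bb; rewrite /tsum big_map -sumrN; apply: eq_bigr => p _; apply: balNl.
Qed.

Definition tzero := tclass [::].
Definition tadd x y := tclass (trepr x ++ trepr y).
Definition topp x := tclass (toppr (trepr x)).

Lemma taddA : associative tadd.
Proof.
move=> x y z; apply/tclass_eq => W b bb.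
by rewrite !(tsum_cat, tsum_repr) // addrA.
Qed.
Lemma taddC : commutative tadd.
Proof. by move=> x y; apply/tclass_eq => W b bb; rewrite !tsum_cat addrC. Qed.
Lemma tadd0 : left_id tzero tadd.
Proof.
move=> x; rewrite -[RHS]treprK; apply/tclass_eq => W b bb.
by rewrite tsum_cat tsum_repr // /tsum big_nil add0r.
Qed.
Lemma taddN : left_inverse tzero topp tadd.
Proof.
move=> x; apply/tclass_eq => W b bb.
by rewrite tsum_cat tsum_repr // tsum_opp // addNr /tsum big_nil.
Qed.
HB.instance Definition _ := GRing.isZmodule.Build tensor taddA taddC tadd0 taddN.

Definition tpure (u : U) (v : V) : tensor := tclass [:: (u, v)].

Lemma tpure_balanced : balanced tpure.
Proof.
split=> [u u' v|u v v'|u a v]; apply/tclass_eq => W b bb;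
  rewrite ?tsum_cat ?tsum_repr // /tsum ?big_seq1 /=.
- exact: balDl.
- exact: balDr.
- exact: balA.
Qed.

Definition tlift (W : zmodType) (b : U -> V -> W) (x : tensor) : W := tsum b (trepr x).

Lemma tlift_pure (W : zmodType) (b : U -> V -> W) u v :
  balanced b -> tlift b (tpure u v) = b u v.
Proof. by move=> bb; rewrite /tlift tsum_repr // /tsum big_seq1. Qed.

Lemma tliftD (W : zmodType) (b : U -> V -> W) x y :
  balanced b -> tlift b (x + y) = tlift b x + tlift b y.
Proof. by move=> bb; rewrite /tlift tsum_repr // tsum_cat. Qed.

Lemma tensor_ind (T : tensor -> Prop) :
    T 0 -> (forall u v, T (tpure u v)) -> (forall x y, T x -> T y -> T (x + y)) ->
  forall x, T x.
Proof.
move=> T0 Tp TD x; rewrite -(treprK x); elim: (trepr x) => [|[u v] s IHs] //.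
suff -> : tclass ((u, v) :: s) = tpure u v + tclass s by apply: TD.
apply/tclass_eq => W b bb.
by rewrite tsum_cat !tsum_repr // /tsum big_cons big_seq1.
Qed.

Lemma tlift0 (W : zmodType) (b : U -> V -> W) : balanced b -> tlift b 0 = 0.
Proof. by move=> bb; rewrite /tlift tsum_repr // /tsum big_nil. Qed.

Lemma tensor_ext (W : zmodType) (f g : tensor -> W) :
    {morph f : x y / x + y} -> {morph g : x y / x + y} ->
    (forall u v, f (tpure u v) = g (tpure u v)) -> f =1 g.
Proof.
move=> fD gD fg; have z h : {morph h : x y / x + y} -> h (0 : tensor) = 0 :> W.
  by move=> hD; apply: (addrI (h 0)); rewrite -hD !addr0.
elim/tensor_ind => // [|x y fx fy]; first by rewrite !z.
by rewrite fD gD fx fy.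
Qed.

End Tensor.

Section Enveloping.
Variables (k : fieldType) (L : falgType k).

(* The enveloping algebra, the tensor product of L and its opposite over k:
   (a (x) b) (c (x) d) = ac (x) db. *)
Definition env : Type := @tensor k L L (fun a c => c *: a) (fun c b => c *: b).
HB.instance Definition _ := GRing.Zmodule.on env.

Definition etens (a b : L) : env := tpure _ _ a b.

Let bal (W : zmodType) (b : L -> L -> W) :=
  balanced (fun a (c : k) => c *: a) (fun c b => c *: b) b.

Lemma etensDl a a' b : etens (a + a') b = etens a b + etens a' b.
Proof. exact: balDl (tpure_balanced _ _) a a' b. Qed.
Lemma etensDr a b b' : etens a (b + b') = etens a b + etens a b'.
Proof. exact: balDr (tpure_balanced _ _) a b b'. Qed.
Lemma etensZ (c : k) a b : etens (c *: a) b = etens a (c *: b).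
Proof. exact: balA (tpure_balanced _ _) a c b. Qed.

Definition emul_r (a b : L) (y : env) : env :=
  tlift (fun c d => etens (a * c) (d * b)) y.
Definition emul (x y : env) : env := tlift (fun a b => emul_r a b y) x.

Lemma emul_r_bal a b : bal (fun c d => etens (a * c) (d * b)).
Proof.
split=> [c c' d|c d d'|c z d]; first by rewrite mulrDr etensDl.
  by rewrite mulrDl etensDr.
by rewrite -scalerAr etensZ -scalerAl.
Qed.

Lemma emul_rD a b : {morph emul_r a b : x y / x + y}.
Proof. by move=> x y; rewrite /emul_r tliftD //; apply: emul_r_bal. Qed.
Lemma emul_r_pure a b c d : emul_r a b (etens c d) = etens (a * c) (d * b).
Proof. by rewrite /emul_r tlift_pure //; apply: emul_r_bal. Qed.

Lemma emul_bal y : bal (fun a b => emul_r a b y).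
Proof.
split=> [a a' b|a b b'|a z b]; elim/tensor_ind: y => [|c d|x y IHx IHy];
  try by rewrite !emul_rD IHx IHy // addrACA.
- by rewrite /emul_r !tlift0 ?addr0 //; apply: emul_r_bal.
- by rewrite !emul_r_pure mulrDl etensDl.
- by rewrite /emul_r !tlift0 ?addr0 //; apply: emul_r_bal.
- by rewrite !emul_r_pure mulrDr etensDr.
- by rewrite /emul_r !tlift0 //; apply: emul_r_bal.
- by rewrite !emul_r_pure -scalerAl etensZ -scalerAr.
Qed.

Lemma emulE a b c d : emul (etens a b) (etens c d) = etens (a * c) (d * b).
Proof. by rewrite /emul tlift_pure ?emul_r_pure //; apply: emul_bal. Qed.
Lemma emulDl : left_distributive emul +%R.
Proof. by move=> x y z; rewrite /emul tliftD //; apply: emul_bal. Qed.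
Lemma emulDr : right_distributive emul +%R.
Proof.
move=> x y z; move: x; apply: tensor_ext => [x x'|x x'|a b].
- exact: emulDl.
- by rewrite !emulDl addrACA.
- by rewrite /emul !tlift_pure ?emul_rD //; apply: emul_bal.
Qed.

Lemma emulA : associative emul.
Proof.
move=> x y z; move: x; apply: tensor_ext => [x x'|x x'|a b]; rewrite ?emulDl //.
move: y; apply: tensor_ext => [y y'|y y'|c d]; rewrite ?(emulDl, emulDr) //.
move: z; apply: tensor_ext => [z z'|z z'|e f]; rewrite ?emulDr //.
by rewrite !emulE !mulrA.
Qed.
Lemma emul1 : left_id (etens 1 1) emul.
Proof.
apply: tensor_ext => [x x'|x x'|c d] //; first by rewrite emulDr.
by rewrite emulE mul1r mulr1.
Qed.
Lemma emulx1 : right_id (etens 1 1) emul.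
Proof.
apply: tensor_ext => [x x'|x x'|c d] //; first by rewrite emulDl.
by rewrite emulE mul1r mulr1.
Qed.
HB.instance Definition _ :=
  GRing.Zmodule_isPzRing.Build env emulA emul1 emulx1 emulDl emulDr.

Lemma etensM a b c d : etens a b * etens c d = etens (a * c) (d * b).
Proof. exact: emulE. Qed.
Lemma env1E : 1 = etens 1 1.
Proof. by []. Qed.

(* L as a left module over env L: (a (x) b) m = a m b. *)
Definition regbim : Type := L.
HB.instance Definition _ := GRing.Zmodule.on regbim.

Definition bimact (x : env) (m : regbim) : regbim :=
  tlift (fun a b : L => a * (m : L) * b : regbim) x.

Lemma bimact_bal (m : L) : bal (fun a b : L => a * m * b : regbim).
Proof.
split=> [a a' b|a b b'|a z b]; first by rewrite !mulrDl.
  by rewrite mulrDr.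
by rewrite -!scalerAl -scalerAr.
Qed.

Lemma bimactE a b (m : regbim) : bimact (etens a b) m = a * (m : L) * b.
Proof. by rewrite /bimact tlift_pure //; apply: bimact_bal. Qed.
Lemma bimactDl m : {morph bimact^~ m : x y / x + y}.
Proof. by move=> x y; rewrite /bimact tliftD //; apply: bimact_bal. Qed.
Lemma bimactA x y m : bimact x (bimact y m) = bimact (x * y) m.
Proof.
move: x; apply: tensor_ext => [x x'|x x'|a b]; rewrite ?mulrDl ?bimactDl //.
move: y; apply: tensor_ext => [y y'|y y'|c d].
- by rewrite bimactDl !bimactE mulrDr mulrDl.
- by rewrite mulrDr bimactDl.
by rewrite etensM !bimactE !mulrA.
Qed.
Lemma bimact1 : left_id 1 bimact.
Proof. by move=> m; rewrite [LHS](bimactE 1 1) mul1r mulr1. Qed.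
Lemma bimactDr : right_distributive bimact +%R.
Proof.
move=> x m m'; move: x; apply: tensor_ext => [x x'|x x'|a b].
- exact: bimactDl.
- by rewrite !bimactDl addrACA.
- by rewrite !bimactE mulrDr mulrDl.
Qed.
HB.instance Definition _ := GRing.Zmodule_isLmodule.Build env regbim
  bimactA bimact1 bimactDr bimactDl.

End Enveloping.

Section TensorOver.
Variables (k : fieldType) (L : falgType k).
Implicit Types (X Y : lmodType (env L)) (M N : lmodType L).

(* The two L-actions underlying a left module over env L. *)
Definition ract X (x : X) (a : L) : X := etens 1 a *: x.
Definition lact X (a : L) (x : X) : X := etens a 1 *: x.

Lemma lract X a b (x : X) : lact a (ract x b) = ract (lact a x) b.
Proof. by rewrite /lact /ract !scalerA !etensM !mulr1 !mul1r. Qed.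

Definition tens X M : Type := tensor (@ract X) (fun a (m : M) => a *: m).
HB.instance Definition _ X M := GRing.Zmodule.on (tens X M).

Definition pure X M (x : X) (m : M) : tens X M := tpure _ _ x m.

Lemma pureDl X M (x y : X) (m : M) : pure (x + y) m = pure x m + pure y m.
Proof. exact: balDl (tpure_balanced _ _) x y m. Qed.
Lemma pureDr X M (x : X) (m n : M) : pure x (m + n) = pure x m + pure x n.
Proof. exact: balDr (tpure_balanced _ _) x m n. Qed.
Lemma pure0l X M (m : M) : pure (0 : X) m = 0.
Proof. exact: bal0l (tpure_balanced _ _). Qed.
Lemma pureBl X M (x y : X) (m : M) : pure (x - y) m = pure x m - pure y m.
Proof. by rewrite pureDl; congr (_ + _); apply: balNl (tpure_balanced _ _). Qed.
Lemma pure_suml X M (n : nat) (x : 'I_n -> X) (m : M) :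
  pure (\sum_i x i) m = \sum_i pure (x i) m.
Proof.
elim: n x => [|n IHn] x; first by rewrite !big_ord0 pure0l.
by rewrite !big_ord_recl pureDl IHn.
Qed.
Lemma pureA X M (x : X) a (m : M) : pure (ract x a) m = pure x (a *: m).
Proof. exact: balA (tpure_balanced _ _) x a m. Qed.

Section Scale.
Variables (X : lmodType (env L)) (M : lmodType L).

Definition tscale (a : L) (x : tens X M) : tens X M :=
  tlift (fun p m => pure (lact a p) m) x.

Lemma tscale_bal a : balanced (@ract X) (fun a (m : M) => a *: m)
  (fun p m => pure (lact a p) m).
Proof.
split=> [p q m|p m n|p b m]; first by rewrite /lact scalerDr pureDl.
  by rewrite pureDr.
by rewrite lract pureA.
Qed.

Lemma tscaleE a x m : tscale a (pure x m) = pure (lact a x) m.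
Proof. by rewrite /tscale tlift_pure //; apply: tscale_bal. Qed.
Lemma tscaleDr : right_distributive tscale +%R.
Proof. by move=> a x y; rewrite /tscale tliftD //; apply: tscale_bal. Qed.
Lemma tscaleDl x : {morph tscale^~ x : a b / a + b}.
Proof.
move=> a b; move: x; apply: tensor_ext => [x y|x y|x m]; rewrite ?tscaleDr //.
  by rewrite addrACA.
by rewrite !tscaleE -pureDl /lact -scalerDl -etensDl.
Qed.
Lemma tscaleA a b x : tscale a (tscale b x) = tscale (a * b) x.
Proof.
move: x; apply: tensor_ext => [x y|x y|x m]; rewrite ?tscaleDr //.
by rewrite !tscaleE /lact scalerA etensM mulr1.
Qed.
Lemma tscale1 : left_id 1 tscale.
Proof.
apply: tensor_ext => [x y|x y|x m]; rewrite ?tscaleDr //.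
by rewrite tscaleE /lact scale1r.
Qed.
HB.instance Definition _ := GRing.Zmodule_isLmodule.Build L (tens X M)
  tscaleA tscale1 tscaleDr tscaleDl.

End Scale.

Section Map.
Variables (X Y : lmodType (env L)) (M : lmodType L) (f : {linear X -> Y}).

Definition tmap_fun (x : tens X M) : tens Y M := tlift (fun p m => pure (f p) m) x.

Lemma tmap_bal : balanced (@ract X) (fun a (m : M) => a *: m)
  (fun p m => pure (f p) m).
Proof.
split=> [p q m|p m n|p b m]; first by rewrite linearD pureDl.
  by rewrite pureDr.
by rewrite linearZ -pureA.
Qed.

Lemma tmap_linear : linear tmap_fun.
Proof.
move=> a x y; rewrite /tmap_fun tliftD; last exact: tmap_bal.
congr (_ + _); move: x; apply: tensor_ext => [x x'|x x'|x m].
- by rewrite scalerDr tliftD //; apply: tmap_bal.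
- by rewrite tliftD ?scalerDr //; apply: tmap_bal.
rewrite [a *: _]tscaleE [in RHS]tlift_pure; last exact: tmap_bal.
by rewrite tlift_pure ?[a *: _]tscaleE /lact ?linearZ //; apply: tmap_bal.
Qed.

Definition tmap : {linear tens X M -> tens Y M} := linmap tmap_linear.

Lemma tmapE x m : tmap (pure x m) = pure (f x) m.
Proof. by rewrite /= /linmap_fun /tmap_fun tlift_pure //; apply: tmap_bal. Qed.

End Map.

Lemma tens_ext X M (W : zmodType) (f g : {additive tens X M -> W}) :
  (forall x m, f (pure x m) = g (pure x m)) -> f =1 g.
Proof. by apply: tensor_ext => x y; rewrite raddfD. Qed.

Definition tcx (Q : complex (env L)) M : complex L.
Proof.
exists (fun n => tens (Q n) M) (fun n => tmap M (cxd Q n)) => n.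
apply: (tens_ext (f := tmap M _ \o tmap M _) (g := \0)) => x m /=.
by rewrite !tmapE cxdd pure0l.
Defined.

Section GMap.
Variables (Q : complex (env L)) (M : lmodType L) (phi : gmap Q).

Definition tgm : gmap (tcx Q M).
Proof.
exists (fun p m (x : tcx Q M p) => tmap M (gm phi p m) x : tcx Q M m).
- by move=> p m a x y; rewrite linearP.
- move=> p m pm.
  apply: (tens_ext (f := tmap M _) (g := \0)) => x y /=.
  by rewrite !tmapE /= gm_low // pure0l.
- have [b hb] := gm_fin phi; exists b => p m h.
  apply: (tens_ext (f := tmap M _) (g := \0)) => x y /=.
  by rewrite !tmapE /= hb // pure0l.
- move=> p m.
  apply: (tens_ext (f := tmap M _ \o tmap M _) (g := tmap M _ \o tmap M _)) => x y /=.
  by rewrite !tmapE /= gm_d.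
Defined.

End GMap.
End TensorOver.

Section QuotientModule.
Variables (R : pzRingType) (V : lmodType R) (W : {pred V}).
Hypothesis W_sub : submod_closed W.

Definition qker : {pred V} := W.
HB.instance Definition _ := GRing.isSubmodClosed.Build R V qker W_sub.

Definition quotmod : Type := Quotient.quot qker.
HB.instance Definition _ := GRing.Zmodule.on quotmod.

Definition qclass (v : V) : quotmod := \pi_(Quotient.quot qker) v.
Definition qrepr (x : quotmod) : V := repr (x : Quotient.quot qker).

Lemma qreprK x : qclass (qrepr x) = x.
Proof. exact: (@reprK _ (Quotient.quot qker) x). Qed.
Lemma qclass_eq u v : (qclass u == qclass v) = (u - v \in qker).
Proof. by rewrite /qclass -Quotient.idealrBE. Qed.
Lemma qclassD u v : qclass (u + v) = qclass u + qclass v.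
Proof. exact: (raddfD (\pi_(Quotient.quot qker))). Qed.

Definition qscale (a : R) (x : quotmod) : quotmod := qclass (a *: qrepr x).
Lemma qscaleE a v : qscale a (qclass v) = qclass (a *: v).
Proof.
apply/eqP; rewrite qclass_eq -scalerBr rpredZ //.
by rewrite -qclass_eq qreprK.
Qed.
Lemma qscaleA a b x : qscale a (qscale b x) = qscale (a * b) x.
Proof. by rewrite -(qreprK x) !qscaleE scalerA. Qed.
Lemma qscale1 : left_id 1 qscale.
Proof. by move=> x; rewrite -(qreprK x) qscaleE scale1r. Qed.
Lemma qscaleDr : right_distributive qscale +%R.
Proof.
move=> a x y; rewrite -(qreprK x) -(qreprK y).
by rewrite -qclassD !qscaleE -qclassD scalerDr.
Qed.
Lemma qscaleDl x : {morph qscale^~ x : a b / a + b}.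
Proof. by move=> a b; rewrite -(qreprK x) !qscaleE -qclassD scalerDl. Qed.
HB.instance Definition _ := GRing.Zmodule_isLmodule.Build R quotmod
  qscaleA qscale1 qscaleDr qscaleDl.
End QuotientModule.

Section Ideals.
Variable R : pzRingType.

(* For a commutative ring these are the ideals and the maximal ideals. *)
Definition left_ideal (I : set R) : Prop :=
  [/\ I 0, forall x y, I x -> I y -> I (x + y) & forall a x, I x -> I (a * x)].

Definition maximal_left_ideal (I : set R) : Prop :=
  [/\ left_ideal I, ~ I 1 &
      forall J : set R, left_ideal J -> (I `<=` J)%classic -> ~ J 1 -> J = I].

Definition noetherian : Prop :=
  forall I : set R, left_ideal I ->
    exists (n : nat) (g : 'I_n -> R),
      I = [set x | exists c : 'I_n -> R, x = \sum_i c i * g i]%classic.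

Definition jacobson : {pred R^o} :=
  fun x => `[< forall I, maximal_left_ideal I -> I x >].

Lemma jacobson_submod : submod_closed jacobson.
Proof.
split=> [|a x y]; first by apply/asboolP => I [[]].
move=> /asboolP hx /asboolP hy; apply/asboolP => I maxI.
case: (maxI) => -[_ ID IM] _ _.
by apply: ID; [apply: IM; apply: hx | apply: hy].
Qed.

(* R / rad R as a left R-module. *)
Definition mod_jacobson : lmodType R := quotmod jacobson_submod.

End Ideals.

(* Structures of type algType are nonzero rings. *)
Definition indecomposable (k : fieldType) (L : falgType k) : Prop :=
  forall (A B : algType k) (f : {lrmorphism L -> (A * B)%type}), ~ bijective f.

Section Hochschild.
Variables (k : fieldType) (L : falgType k) (P : resolution (regbim L)).

(* HH^*(L) = Ext_(env L)^*(L, L). *)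
Definition HH : Type := YonedaExt P.
HB.instance Definition _ := GRing.PzRing.on HH.

Lemma hh_one_neq0 : (1 : HH) != 0.
Proof.
apply/eqP => e; have [x hx] := res_aug_surj P (1 : L).
have /ext_class_eq [h _] : ext_class (ext_one P) = ext_class 0 by rewrite ext_class0.
have := h x; rewrite cc_add cc_opp /= gm1E hx subr0.
by apply/eqP/oner_neq0.
Qed.
HB.instance Definition _ := GRing.PzSemiRing_isNonZero.Build HH hh_one_neq0.

Lemma regbimZ (c : k) (x : env L) (m : regbim L) :
  c *: (x *: m : L) = x *: (c *: (m : L) : regbim L).
Proof.
move: x; apply: tensor_ext => [x y|x y|a b].
- by rewrite -scalerDr; congr (c *: _); exact: (scalerDl m (x : env L) (y : env L)).
- exact: (scalerDl (c *: (m : L) : regbim L) (x : env L) (y : env L)).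
by rewrite ![etens a b *: _]bimactE -scalerAr scalerAl.
Qed.

Definition cscale (c : k) (z : cocycle P (regbim L)) : cocycle P (regbim L).
Proof.
exists (fun n x => c *: (cc z n x : L) : regbim L).
- by move=> n a x y; rewrite linearP scalerDr regbimZ.
- by have [b hb] := cc_fin z; exists b => n bn x; rewrite hb ?scaler0.
- by move=> n x; rewrite cc_d scaler0.
Defined.

Definition hh_scale (c : k) (x : HH) : HH := ext_class (cscale c (ext_repr x)).

Lemma cscaleDr c z w : cscale c (z + w) = cscale c z + cscale c w.
Proof.
by apply: cocycleP => n x; exact: (scalerDr c (cc z n x : L) (cc w n x : L)).
Qed.

Lemma cscale_coboundary c z : is_coboundary z -> is_coboundary (cscale c z).
Proof.
case=> h0 [u hu]; split=> [x|]; first by rewrite /= h0 scaler0.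
have lin n : linear (fun x : P n => c *: (u n x : L) : regbim L).
  by move=> a x y; rewrite linearP scalerDr regbimZ.
by exists (fun n => linmap (lin n)) => n x; rewrite /= hu.
Qed.

Lemma hh_scaleE c z : hh_scale c (ext_class z) = ext_class (cscale c z).
Proof.
apply/ext_class_eq; set w := ext_repr _.
have -> : cscale c w - cscale c z = cscale c (w - z).
  by apply/eqP; rewrite subr_eq -cscaleDr subrK.
by apply: cscale_coboundary; apply/ext_class_eq; apply: ext_reprK.
Qed.

Lemma hh_scaleA a b x : hh_scale a (hh_scale b x) = hh_scale (a * b) x.
Proof.
elim/ext_ind: x => z; rewrite !hh_scaleE; congr ext_class.
by apply: cocycleP => n x /=; rewrite scalerA.
Qed.
Lemma hh_scale1 : left_id 1 hh_scale.
Proof.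
elim/ext_ind=> z; rewrite hh_scaleE; congr ext_class.
by apply: cocycleP => n x /=; rewrite scale1r.
Qed.
Lemma hh_scaleDr : right_distributive hh_scale +%R.
Proof.
move=> a; elim/ext_ind=> z; elim/ext_ind=> w.
by rewrite -[ext_class z + _]ext_classD !hh_scaleE cscaleDr; apply: ext_classD.
Qed.
Lemma hh_scaleDl x : {morph hh_scale^~ x : a b / a + b}.
Proof.
move=> a b; elim/ext_ind: x => z; rewrite !hh_scaleE -[RHS]ext_classD.
congr ext_class; apply: cocycleP => n x.
exact: (scalerDl (cc z n x : L) a b).
Qed.
HB.instance Definition _ := GRing.Zmodule_isLmodule.Build k HH
  hh_scaleA hh_scale1 hh_scaleDr hh_scaleDl.

Lemma hh_scaleAl (c : k) (x y : HH) : c *: (x * y) = (c *: x) * y.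
Proof.
elim/ext_ind: x => z; elim/ext_ind: y => w.
rewrite [_ * _](yoneda_class z (liftP w)) ![c *: _]hh_scaleE.
rewrite [RHS](yoneda_class (cscale c z) (liftP w)); congr ext_class.
apply: cocycleP => n x /=.
have h := scaler_sumr c (index_enum 'I_n.+1) xpredT
  (fun m => cc z m (gm (lift w) n m x) : L).
exact: h.
Qed.
HB.instance Definition _ := GRing.Lmodule_isLalgebra.Build k HH hh_scaleAl.

Lemma etens_central (c : k) (x : env L) : etens (c *: 1) 1 * x = x * etens (c *: 1) 1.
Proof.
move: x; apply: tensor_ext => [x y|x y|a b]; rewrite ?(mulrDr, mulrDl) //.
by rewrite !etensM -scalerAl -scalerAr mul1r !mulr1 mul1r.
Qed.

Definition gmZ (c : k) (phi : gmap P) : gmap P.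
Proof.
exists (fun p m x => etens (c *: 1) 1 *: gm phi p m x).
- by move=> p m a x y; rewrite linearP scalerDr !scalerA etens_central.
- by move=> p m pm x; rewrite gm_low // scaler0.
- have [b hb] := gm_fin phi; exists b => p m h x.
  by rewrite hb // scaler0.
- by move=> p m x; rewrite gm_d linearZ.
Defined.

Lemma lift_gmZ c z phi : is_lift z phi -> is_lift (cscale c z) (gmZ c phi).
Proof.
move=> lz n x; rewrite /= linearZ /= lz [LHS]bimactE.
by rewrite mulr1 -scalerAl mul1r.
Qed.

Lemma cactZr c f (phi : gmap P) : cact f (gmZ c phi) = cscale c (cact f phi).
Proof.
apply: cocycleP => n x /=.
have h := scaler_sumr c (index_enum 'I_n.+1) xpredT
  (fun m => cc f m (gm phi n m x) : L).
rewrite [RHS]h; apply: eq_bigr => m _; rewrite linearZ /= [LHS]bimactE.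
by rewrite mulr1 -scalerAl mul1r.
Qed.

Lemma hh_scaleAr (c : k) (x y : HH) : c *: (x * y) = x * (c *: y).
Proof.
elim/ext_ind: x => z; elim/ext_ind: y => w.
rewrite [_ * (ext_class w : HH)](yoneda_class z (liftP w)) ![c *: _]hh_scaleE.
rewrite [RHS](yoneda_class z (lift_gmZ c (liftP w))); congr ext_class.
by rewrite cactZr.
Qed.
HB.instance Definition _ := GRing.Lalgebra_isAlgebra.Build k HH hh_scaleAr.

Definition hh_comp (n : nat) (x : HH) : HH := ext_comp n x.

Section Action.
Variables M N : lmodType L.

(* P is split exact as a complex of right L-modules augmented to L, so P (x)_L M
   is a projective resolution of M and this is Ext_L^*(M, N). *)
Definition ExtM : Type := Ext (tcx P M) N.
HB.instance Definition _ := GRing.Zmodule.on ExtM.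

(* Apply - (x)_L M to a chain map representing x, then take the Yoneda product
   with e. *)
Definition ext_act (e : ExtM) (x : HH) : ExtM :=
  ext_class (cact (ext_repr e) (tgm M (lift (ext_repr x)))).

Lemma ext_act_class f z phi : is_lift z phi ->
  ext_act (ext_class f) (ext_class z) = ext_class (cact f (tgm M phi)).
Proof.
move=> lz; rewrite /ext_act.
set f' := ext_repr _; set z' := ext_repr _.
transitivity (ext_class (cact f (tgm M (lift z')))); apply/ext_class_eq.
  set psi := tgm M _.
  have -> : cact f' psi - cact f psi = cact (f' - f) psi.
    by apply/eqP; rewrite subr_eq -cactDl subrK.
  by apply: cact_coboundary; apply/ext_class_eq; apply: ext_reprK.
have zz : is_coboundary (z' - z) by apply/ext_class_eq; apply: ext_reprK.
have [s [s0 sS]] := lift_homotopy (liftP z') lz zz.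
apply: (@cact_homotopy _ _ _ f _ _ (fun p m => tmap M (s p m))).
- by move=> p m a x y; rewrite linearP.
- move=> m; apply: tensor_ext => [x y|x y|x y].
  + by rewrite !raddfD addrACA.
  + by rewrite !raddfD.
  by rewrite /= !tmapE /= -s0 pureBl.
- move=> p m; apply: tensor_ext => [x y|x y|x y].
  + by rewrite !raddfD addrACA.
  + by rewrite !raddfD addrACA.
  by rewrite /= !tmapE /= -pureDl -sS pureBl.
Qed.

Lemma ext_actDl x : {morph ext_act^~ x : e f / e + f}.
Proof.
elim/ext_ind: x => z; elim/ext_ind=> e; elim/ext_ind=> f.
by rewrite -[ext_class e + _]ext_classD !(ext_act_class _ (liftP _)) cactDl;
   apply: ext_classD.
Qed.

Lemma ext_actDr e : {morph ext_act e : x y / x + y}.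
Proof.
elim/ext_ind: e => f; elim/ext_ind=> x; elim/ext_ind=> y.
rewrite -[ext_class x + _]ext_classD (ext_act_class _ (lift_gmD (liftP x) (liftP y))).
rewrite !(ext_act_class _ (liftP _)) -[RHS]ext_classD -cactDr; congr ext_class.
apply: cocycleP => n; apply: tensor_ext => [a b|a b|a b]; rewrite ?raddfD //.
rewrite !cactE; apply: eq_bigr => m _; congr (cc _ _ _).
by rewrite /= !tmapE /= pureDl.
Qed.

Lemma ext_actA e x y : ext_act (ext_act e x) y = ext_act e (x * y).
Proof.
elim/ext_ind: e => f; elim/ext_ind: x => z; elim/ext_ind: y => w.
rewrite [_ * _](yoneda_class z (liftP w)).
rewrite (ext_act_class _ (lift_gmM (liftP z) (liftP w))).
rewrite !(ext_act_class _ (liftP _)) cactA; congr ext_class.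
apply: cocycleP => n; apply: tensor_ext => [a b|a b|a b]; rewrite ?raddfD //.
rewrite !cactE; apply: eq_bigr => m _; congr (cc _ _ _).
rewrite /= tmapE /= pure_suml; apply: eq_bigr => q _.
by rewrite !tmapE.
Qed.

Lemma ext_act1 e : ext_act e 1 = e.
Proof.
elim/ext_ind: e => f; rewrite (ext_act_class f (@ext_one_lift _ _ P)); congr ext_class.
rewrite -[RHS]cact1; apply: cocycleP => n.
apply: tensor_ext => [a b|a b|a b]; rewrite ?raddfD //.
rewrite !cactE; apply: eq_bigr => m _; congr (cc _ _ _).
rewrite /= tmapE /=; have [<-|/eqP nm] := eqVneq n m; first by rewrite !gm1E.
by rewrite !gm1_neq // pure0l.
Qed.

End Action.
End Hochschild.

Section Varieties.
Variables (k : fieldType) (L : falgType k) (P : resolution (regbim L)).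
Variables (H : comAlgType k) (iota : {lrmorphism H -> HH P}).

(* A graded subalgebra of HH^*(L) is given as an algebra H with an embedding iota
   whose image contains the homogeneous components of its elements. *)
Definition graded_subalgebra : Prop :=
  injective iota /\ forall (n : nat) (x : H), exists y, iota y = hh_comp n (iota x).

(* hh_comp 0 z = z says that z lies in HH^0(L), which is the center of L. *)
Definition contains_HH0 : Prop :=
  forall z : HH P, hh_comp 0 z = z -> exists y, iota y = z.

Definition homogeneous_ideal (a : set H) : Prop :=
  left_ideal a /\
  forall n x y, a x -> iota y = hh_comp n (iota x) -> a y.

(* Ext_L^*(M, N) viewed as a module over H through f; H being commutative, the
   right action ext_act is also a left action. *)
Definition ext_along (f : {lrmorphism H -> HH P}) (M N : lmodType L) : Type :=
  ExtM P M N.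

Section ExtModule.
Variables M N : lmodType L.
Local Notation E := (ext_along iota M N).
HB.instance Definition _ := GRing.Zmodule.on E.

Definition ext_scale (h : H) (e : E) : E := ext_act e (iota h).

Lemma ext_scaleA a b e : ext_scale a (ext_scale b e) = ext_scale (a * b) e.
Proof. by rewrite /ext_scale ext_actA mulrC rmorphM. Qed.
Lemma ext_scale1 : left_id 1 ext_scale.
Proof. by move=> e; rewrite /ext_scale rmorph1 ext_act1. Qed.
Lemma ext_scaleDr : right_distributive ext_scale +%R.
Proof. by move=> a e f; apply: ext_actDl. Qed.
Lemma ext_scaleDl e : {morph ext_scale^~ e : a b / a + b}.
Proof. by move=> a b; rewrite /ext_scale rmorphD; apply: ext_actDr. Qed.
HB.instance Definition _ := GRing.Zmodule_isLmodule.Build H E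
  ext_scaleA ext_scale1 ext_scaleDr ext_scaleDl.

Definition Ann : set H := [set h | forall e : E, h *: e = 0].
End ExtModule.

Definition variety (M : lmodType L) : set (set H) :=
  [set m | maximal_left_ideal m /\ (Ann M (mod_jacobson L) `<=` m)%classic].

Definition variety_ideal (a : set H) : set (set H) :=
  [set m | maximal_left_ideal m /\ (a `<=` m)%classic].

End Varieties.

(* Main.v *)
(* Write D = L/rad L, E(M) = Ext(M, D), and H^+ for the elements of H without
   component of degree 0.  If eta in H is homogeneous of degree n > 0, dimension
   shifting moves its class in Ext^n(M, M) to Ext^1(Z, M), where Z is an (n-1)-st
   syzygy of M; let 0 -> M -> M' -> Z -> 0 be the corresponding extension.  Once
   an element of H^+ is inverted, E(Z) becomes a shift of E(M) and the long exact
   sequence becomes a triangle E(M) -> E(M) -> E(M') -> E(M) whose first map is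
   the action of eta.  Hence eta^2 kills E(M'), and an element killing E(M') maps
   E(M) into eta E(M); as E(M) is finitely generated, Nakayama's lemma shows that
   V(M') is the intersection of V(M) and V(eta), at least outside the maximal
   ideals containing H^+.  Those contain eta, and also the annihilator of E(M) for
   every M <> 0, because H^0 is the center of the indecomposable algebra L, which
   is local.
   The descent starts from D.  If x kills E(D), it kills Ext(T, S) for all simple
   S and T.  As k is algebraically closed, L is filtered by ideals whose successive
   quotients are the bimodules Hom_k(T, S), and Ext_(env L)(L, Hom_k(T, S)) is
   Ext(T, S); so a power of x kills Ext_(env L)(L, L), which contains 1, and x is
   nilpotent. *)
Require Import Defs.
From HB Require Import structures.
From mathcomp Require Import all_boot all_algebra all_field.
From mathcomp Require Import boolp classical_sets.

Set Implicit Arguments.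
Unset Strict Implicit.
Unset Printing Implicit Defensive.

Import GRing.Theory.
Local Open Scope ring_scope.

(** * Dual bases *)

(** Two things hold only after inverting an element of H^+: dimension shifting, whose error terms
    are Ext groups out of projectives and are killed by H^+, and the finite generation of E(M') that
    is carried along. No localization is formed. Instead some y in H^+ outside the given maximal
    ideal serves as denominator: maps that exist only after inversion are kept as additive
    relations, finite generation means generation up to a fixed power of y, and the powers are
    cancelled because maximal ideals are prime. All Ext groups come from P (x) M for the one
    resolution P, so maps of modules commute strictly with the action of HH and only connecting maps
    need a homotopy. Connecting maps anticommute with differentials, so the first map of the
    triangle is eta up to a sign in each degree; this sign is an involution and does not change
    images. In a proper homogeneous ideal the components of degree 0 are nilpotent, H^0 being local;
    hence only generators of positive degree have to be realized. The unit ideal is realized by the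
    zero module. *)

Definition dual_basis (R : pzRingType) (V : lmodType R) (I : finType)
    (g : I -> V) (t : I -> {linear V -> R^o}) : Prop :=
  forall v, v = \sum_i (t i v : R) *: g i.

Section DualBasis.
Variables (R : pzRingType) (V : lmodType R).

Lemma projective_dual_basis : projective V -> fin_gen V ->
  exists (n : nat) (g : 'I_n -> V) (t : 'I_n -> {linear V -> R^o}), dual_basis g t.
Proof.
move=> projV [n [g gen]].
have comb_lin : linear (fun c : 'rV[R]_n => \sum_i c 0 i *: g i).
  move=> a u v; rewrite scaler_sumr -big_split /=.
  by apply: eq_bigr => i _; rewrite !mxE scalerDl scalerA.
have [|h hE] := projV _ _ (linmap comb_lin) (idfun : {linear V -> V}).
  move=> v; have [c cE] := gen v; exists (\row_i c i).
  by rewrite cE; apply: eq_bigr => i _; rewrite mxE.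
have t_lin i : linear (fun v : V => h v 0 i : R^o).
  by move=> a u v; rewrite linearP !mxE.
exists n, g, (fun i => linmap (t_lin i)) => v.
by rewrite -[LHS](hE v).
Qed.

Lemma dual_basis_projective (I : finType) (g : I -> V) t :
  @dual_basis R V I g t -> projective V.
Proof.
move=> gt X Y p f p_surj.
pose x i := projT1 (cid (p_surj (f (g i)))).
have xE i : p (x i) = f (g i) := projT2 (cid (p_surj (f (g i)))).
have h_lin : linear (fun v => \sum_i (t i v : R) *: x i).
  move=> a u v; rewrite scaler_sumr -big_split /=.
  by apply: eq_bigr => i _; rewrite linearP scalerDl scalerA.
exists (linmap h_lin) => v; rewrite {2}(gt v) /= /linmap_fun !linear_sum.
by apply: eq_bigr => i _; rewrite !linearZ /= xE.
Qed.

Lemma fin_gen_fintype (I : finType) (g : I -> V) :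
  (forall v, exists c : I -> R, v = \sum_i c i *: g i) -> fin_gen V.
Proof.
move=> gen; exists #|I|, (fun i => g (enum_val i)) => v.
have [c ->] := gen v; exists (fun i => c (enum_val i)).
by rewrite (reindex_onto enum_val enum_rank) => [|i _]; rewrite ?enum_rankK //;
  apply: eq_bigl => i; rewrite enum_valK eqxx.
Qed.

Lemma fin_gen_image (W : lmodType R) (p : {linear V -> W}) :
  (forall w, exists v, p v = w) -> fin_gen V -> fin_gen W.
Proof.
move=> p_surj [n [g gen]]; exists n, (fun i => p (g i)) => w.
have [v <-] := p_surj w; have [c ->] := gen v; exists c.
by rewrite linear_sum; apply: eq_bigr => i _; rewrite linearZ.
Qed.

Lemma fin_gen_extension (W X : lmodType R) (i : {linear W -> V}) (q : {linear V -> X}) :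
    (forall v, q v = 0 -> exists w, i w = v) -> (forall x, exists v, q v = x) ->
  fin_gen W -> fin_gen X -> fin_gen V.
Proof.
move=> ker surj [n [g gen]] [m [h hgen]].
pose h' j := projT1 (cid (surj (h j))).
have h'E j : q (h' j) = h j := projT2 (cid (surj (h j))).
apply: (@fin_gen_fintype ('I_n + 'I_m)%type
         (fun s => match s with inl j => i (g j) | inr j => h' j end)) => v.
have [c cE] := hgen (q v).
have [|w wE] := ker (v - \sum_j c j *: h' j).
  rewrite linearB linear_sum /= {1}cE; apply/eqP; rewrite subr_eq0; apply/eqP.
  by apply: eq_bigr => j _; rewrite linearZ /= h'E.
have [b bE] := gen w.
exists (fun s => match s with inl j => b j | inr j => c j end).
rewrite big_sumType /= -[LHS](subrK (\sum_j c j *: h' j)) -wE {1}bE linear_sum.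
by congr (_ + _); apply: eq_bigr => j _; rewrite linearZ.
Qed.

End DualBasis.

(** A generator with nonzero coefficient in a relation is discarded. Once no relation is left, the
    chosen coordinates are unique, hence linear. *)
Lemma field_dual_basis (K : fieldType) (V : lmodType K) : fin_gen V ->
  exists (n : nat) (g : 'I_n -> V) (t : 'I_n -> {linear V -> K^o}), dual_basis g t /\
    forall c : 'I_n -> K, \sum_i c i *: g i = 0 -> forall i, c i = 0.
Proof.
case=> n; elim: n => [|n IHn] [g gen].
  exists 0%N, g, (fun _ => \0%R); split=> [v|c _ []//].
  by have [c] := gen v; rewrite !big_ord0.
have [[c [c0 [i ci]]]|free] :=
    pselect (exists c : 'I_n.+1 -> K, \sum_i c i *: g i = 0 /\ exists i, c i != 0).
  apply: IHn; exists (fun j => g (lift i j)) => v.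
  have gi : g i = \sum_(j < n) (- c (lift i j) / c i) *: g (lift i j).
    apply: (can_inj (scalerK ci)); rewrite scaler_sumr; apply/eqP.
    move: c0; rewrite (bigD1_ord i) //= => /eqP; rewrite addr_eq0 => /eqP ->.
    rewrite -sumrN; apply/eqP/eq_bigr => j _; rewrite scalerA mulrC -mulrA mulVf //.
    by rewrite mulr1 scaleNr.
  have [b ->] := gen v.
  exists (fun j => b (lift i j) + b i * (- c (lift i j) / c i)).
  rewrite (bigD1_ord i) //= {1}gi scaler_sumr -big_split /=.
  by apply: eq_bigr => j _; rewrite scalerDl scalerA addrC.
pose t i v := projT1 (cid (gen v)) i.
have tE v : v = \sum_i t i v *: g i := projT2 (cid (gen v)).
have uniq (b c : 'I_n.+1 -> K) : \sum_i b i *: g i = \sum_i c i *: g i -> b =1 c.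
  move=> /eqP; rewrite -subr_eq0 -sumrB => /eqP e i; apply/eqP/negPn/negP => ne.
  apply: free; exists (fun i => b i - c i); split; last by exists i; rewrite subr_eq0.
  by rewrite -[RHS]e; apply: eq_bigr => j _; rewrite scalerBl.
have t_lin i : linear (fun v => t i v : K^o).
  move=> a u v; apply: (uniq (t^~ (a *: u + v)) (fun i => a * t i u + t i v)).
  rewrite -tE {1}(tE u) {1}(tE v) scaler_sumr -big_split /=.
  by apply: eq_bigr => j _; rewrite scalerDl scalerA.
exists n.+1, g, (fun i => linmap (t_lin i)); split=> [v|c c0 i]; first exact: tE.
apply: (uniq c (fun=> 0)); rewrite c0 big1 // => j _.
by rewrite scale0r.
Qed.

(** * Restriction of scalars to the ground field *)

Section Restriction.
Variables (k : fieldType) (L : falgType k).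

Definition kmod (X : lmodType L) : Type := X.
HB.instance Definition _ X := GRing.Zmodule.on (kmod X).

Section Scale.
Variable X : lmodType L.
Definition kscale (c : k) (x : kmod X) : kmod X := c%:A *: (x : X).
Lemma kscaleA a b x : kscale a (kscale b x) = kscale (a * b) x.
Proof. by rewrite /kscale scalerA -scalerAl mul1r scalerA. Qed.
Lemma kscale1 : left_id 1 kscale.
Proof. by move=> x; rewrite /kscale !scale1r. Qed.
Lemma kscaleDr : right_distributive kscale +%R.
Proof. by move=> a x y; rewrite /kscale scalerDr. Qed.
Lemma kscaleDl x : {morph kscale^~ x : a b / a + b}.
Proof. by move=> a b; rewrite /kscale !scalerDl. Qed.
HB.instance Definition _ := GRing.Zmodule_isLmodule.Build k (kmod X)
  kscaleA kscale1 kscaleDr kscaleDl.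
End Scale.

Lemma kscaleE X (c : k) (x : kmod X) : c *: x = c%:A *: (x : X) :> X.
Proof. by []. Qed.

Lemma kmod_fin_gen (X : lmodType L) : fin_gen X -> fin_gen (kmod X).
Proof.
move=> [n [g gen]].
pose e := vbasis {:L}.
apply: (@fin_gen_fintype _ _ ('I_n * 'I_(\dim {:L}))%type
         (fun p => e`_p.2 *: g p.1 : kmod X)) => x.
have [c cE] := gen x.
exists (fun p => coord e p.2 (c p.1)).
rewrite -(pair_bigA _ (fun i j => coord e j (c i) *: (e`_j *: g i : kmod X))) /=.
rewrite {1}cE; apply: eq_bigr => i _.
rewrite {1}(coord_vbasis (memvf (c i))) scaler_suml; apply: eq_bigr => j _.
by rewrite kscaleE scalerA -scalerAl mul1r.
Qed.

End Restriction.

(** * Tensoring with a projective resolution *)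

Lemma add_morph0 (U V : zmodType) (f : U -> V) : {morph f : x y / x + y} -> f 0 = 0.
Proof. by move=> fD; apply: (addrI (f 0)); rewrite -fD !addr0. Qed.

Lemma add_morphN (U V : zmodType) (f : U -> V) :
  {morph f : x y / x + y} -> {morph f : x / - x}.
Proof. by move=> fD x; apply/eqP; rewrite -addr_eq0 -fD addNr (add_morph0 fD). Qed.

Lemma add_morph_sum (U V : zmodType) (f : U -> V) : {morph f : x y / x + y} ->
  forall (I : Type) (r : seq I) (F : I -> U), f (\sum_(i <- r) F i) = \sum_(i <- r) f (F i).
Proof.
move=> fD I r F; apply: (big_morph f fD); exact: add_morph0.
Qed.

(** * Bimodules as right modules *)

Section RightDualBasis.
Variables (k : fieldType) (L : falgType k).

Lemma ractDl (X : lmodType (env L)) a : {morph (fun x : X => ract x a) : x y / x + y}.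
Proof. by move=> x y; rewrite /ract scalerDr. Qed.

Lemma ractA (X : lmodType (env L)) (x : X) a b : ract (ract x a) b = ract x (a * b).
Proof. by rewrite /ract scalerA etensM mul1r. Qed.

Lemma etens_act (X : lmodType (env L)) (x : X) a b : etens a b *: x = lact a (ract x b).
Proof. by rewrite /lact /ract scalerA etensM !mulr1. Qed.

Lemma lact_linear (X Y : lmodType (env L)) (f : {linear X -> Y}) a x :
  f (lact a x) = lact a (f x).
Proof. exact: linearZ. Qed.

Lemma ract_linear (X Y : lmodType (env L)) (f : {linear X -> Y}) a x :
  f (ract x a) = ract (f x) a.
Proof. exact: linearZ. Qed.

Definition rlin (X : lmodType (env L)) (f : X -> L) : Prop :=
  {morph f : x y / x + y} /\ forall x a, f (ract x a) = f x * a.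

(** For a k-basis e of L, the enveloping algebra is free on the elements e_i (x) 1 for the right
    action of L; the coordinates of a (x) b are the multiples of b by the coordinates of a. *)
Lemma env_right_coord : exists (n : nat) (e : 'I_n -> L) (B : 'I_n -> env L -> L),
  [/\ forall i, {morph B i : x y / x + y},
      forall i w a, B i (etens 1 a * w) = B i w * a &
      forall w, w = \sum_i etens (e i) (B i w)].
Proof.
pose e := vbasis {:L}.
pose b i (a c : L) := coord e i a *: c.
have bal i : balanced (fun a (c : k) => c *: a) (fun c b => c *: b) (b i).
  split=> [a a' c|a c c'|a z c]; rewrite /b ?linearD ?scalerDl ?scalerDr //.
  by rewrite linearZ /= scalerA mulrC -scalerA scalerA mulrC.
exists (\dim {:L}), (fun i => e`_i), (fun i => tlift (b i)); split.
- by move=> i x y; rewrite tliftD.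
- move=> i w a; move: w; apply: tensor_ext => [x y|x y|c d].
  + by rewrite mulrDr tliftD.
  + by rewrite tliftD // mulrDl.
  by rewrite [tpure _ _ c d]/(etens c d) etensM mul1r !tlift_pure // /b -scalerAl.
- apply: tensor_ext => [x y|x y|c d] //.
    by rewrite -big_split /=; apply: eq_bigr => i _; rewrite tliftD // etensDr.
  transitivity (\sum_i etens (coord e i c *: e`_i) d).
    rewrite -[LHS]/(etens c d) {1}(coord_vbasis (memvf c)).
    by rewrite (add_morph_sum (f := fun c => etens c d)) // => x y; apply: etensDl.
  by apply: eq_bigr => i _; rewrite tlift_pure // etensZ.
Qed.

(* Forgetting the left action keeps a finitely generated projective bimodule
   projective. *)
Lemma right_dual_basis (X : lmodType (env L)) : projective X -> fin_gen X ->
  exists (I : finType) (u : I -> X) (b : I -> X -> L),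
    (forall i, rlin (b i)) /\ forall x, x = \sum_i ract (u i) (b i x).
Proof.
move=> projX /(projective_dual_basis projX)[n [g [t gt]]].
have [m [e [B [BD BM BE]]]] := env_right_coord.
exists ('I_n * 'I_m)%type, (fun p => lact (e p.2) (g p.1)), (fun p x => B p.2 (t p.1 x)).
split=> [[i j]|x] /=.
  by split=> [x y|x a]; rewrite ?linearD ?BD // linearZ /= BM.
rewrite -(pair_bigA _ (fun i j => ract (lact (e j) (g i)) (B j (t i x)))) /=.
rewrite [LHS]gt; apply: eq_bigr => i _; rewrite [in LHS](BE (t i x)) scaler_suml.
by apply: eq_bigr => j _; rewrite etens_act lract.
Qed.

End RightDualBasis.

Section TensorFunctor.
Variables (k : fieldType) (L : falgType k).
Implicit Types (U V : lmodType (env L)) (X Y Z : lmodType L).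

Lemma pure_tscale U X a (u : U) (x : X) : a *: pure u x = pure (lact a u) x.
Proof. exact: tscaleE. Qed.

Lemma pure_sumr U X (I : Type) (r : seq I) (u : U) (F : I -> X) :
  pure u (\sum_(i <- r) F i) = \sum_(i <- r) pure u (F i).
Proof. by apply: (add_morph_sum (f := pure u)) => x y; apply: pureDr. Qed.

Lemma pure_sum_left U X (I : Type) (r : seq I) (F : I -> U) (x : X) :
  pure (\sum_(i <- r) F i) x = \sum_(i <- r) pure (F i) x.
Proof. by apply: (add_morph_sum (f := fun u => pure u x)) => u v; apply: pureDl. Qed.

Lemma pure0r U X (u : U) : pure u (0 : X) = 0.
Proof. exact: bal0r (tpure_balanced _ _). Qed.

Section MapRight.
Variables (U : lmodType (env L)) (X Y : lmodType L) (f : {linear X -> Y}).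

Definition tmapr_fun (w : tens U X) : tens U Y := tlift (fun u x => pure u (f x)) w.

Lemma tmapr_bal : balanced (@ract _ L U) (fun a (x : X) => a *: x)
  (fun u x => pure u (f x)).
Proof.
split=> [u v x|u x y|u a x]; first by rewrite pureDl.
  by rewrite linearD pureDr.
by rewrite linearZ pureA.
Qed.

Lemma tmapr_linear : linear tmapr_fun.
Proof.
move=> a x y; rewrite /tmapr_fun tliftD; last exact: tmapr_bal.
congr (_ + _); move: x; apply: tensor_ext => [x x'|x x'|x m].
- by rewrite scalerDr tliftD //; apply: tmapr_bal.
- by rewrite tliftD ?scalerDr //; apply: tmapr_bal.
rewrite [a *: _]tscaleE [in RHS]tlift_pure; last exact: tmapr_bal.
by rewrite tlift_pure ?[a *: _]tscaleE //; apply: tmapr_bal.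
Qed.

Definition tmapr : {linear tens U X -> tens U Y} := linmap tmapr_linear.

Lemma tmaprE u x : tmapr (pure u x) = pure u (f x).
Proof. by rewrite /= /linmap_fun /tmapr_fun tlift_pure //; apply: tmapr_bal. Qed.

End MapRight.

Lemma tmapr_tmap U V X Y (f : {linear X -> Y}) (g : {linear U -> V}) w :
  tmapr V f (tmap X g w) = tmap Y g (tmapr U f w).
Proof.
move: w; apply: tensor_ext => [w v|w v|u x]; rewrite ?raddfD //.
by rewrite tmapE !tmaprE tmapE.
Qed.

Lemma tmapr_inverse U X Y (f : {linear X -> Y}) (g : {linear Y -> X}) :
  (forall y, f (g y) = y) -> forall w, tmapr U f (tmapr U g w) = w.
Proof.
move=> fg; apply: tensor_ext => [w v|w v|u x]; rewrite ?raddfD //.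
by rewrite !tmaprE fg.
Qed.

Section Coordinates.
Variables (U : lmodType (env L)) (I : finType) (u : I -> U) (b : I -> U -> L).
Hypotheses (b_rlin : forall i, rlin (b i))
  (ub : forall p, p = \sum_i ract (u i) (b i p)).

Definition tcoord X i (w : tens U X) : X := tlift (fun p (x : X) => b i p *: x) w.

Lemma tcoord_bal X i : balanced (@ract _ L U) (fun a (x : X) => a *: x)
  (fun p x => b i p *: x).
Proof.
have [bD bM] := b_rlin i.
split=> [p q x|p x y|p a x]; first by rewrite bD scalerDl.
  by rewrite scalerDr.
by rewrite bM scalerA.
Qed.

Lemma tcoordD X i : {morph @tcoord X i : x y / x + y}.
Proof. by move=> x y; rewrite /tcoord tliftD //; apply: tcoord_bal. Qed.

Lemma tcoordE X i p (x : X) : tcoord i (pure p x) = b i p *: x.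
Proof. by rewrite /tcoord tlift_pure //; apply: tcoord_bal. Qed.

Lemma tcoord_sum X (w : tens U X) : w = \sum_i pure (u i) (tcoord i w).
Proof.
move: w; apply: tensor_ext => [x y|x y|p x] //.
  by rewrite -big_split /=; apply: eq_bigr => i _; rewrite tcoordD pureDr.
rewrite -[tpure _ _ p x]/(pure p x) [in LHS](ub p) pure_sum_left.
by apply: eq_bigr => i _; rewrite tcoordE pureA.
Qed.

Lemma tcoord_tmapr X Y (f : {linear X -> Y}) i w :
  tcoord i (tmapr U f w) = f (tcoord i w).
Proof.
move: w; apply: tensor_ext => [x y|x y|p x]; rewrite ?raddfD ?tcoordD ?raddfD //.
by rewrite tmaprE !tcoordE linearZ.
Qed.

End Coordinates.

Section Exact.
Variables (U : lmodType (env L)).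
Hypotheses (projU : projective U) (fgU : fin_gen U).
Variables (X Y Z : lmodType L) (i : {linear X -> Y}) (q : {linear Y -> Z}).

Lemma tmapr_inj : injective i -> injective (tmapr U i).
Proof.
move=> inj; have [I [u [b [bl ub]]]] := right_dual_basis projU fgU.
move=> v w e; rewrite (tcoord_sum bl ub v) (tcoord_sum bl ub w).
apply: eq_bigr => j _; congr pure; apply: inj.
by rewrite -!(tcoord_tmapr bl) e.
Qed.

Lemma tmapr_surj : (forall z, exists y, q y = z) -> forall w, exists v, tmapr U q v = w.
Proof.
move=> surj; apply: tensor_ind => [|u z|w w' [v <-] [v' <-]].
- by exists 0; rewrite raddf0.
- by have [y <-] := surj z; exists (pure u y); rewrite tmaprE.
by exists (v + v'); rewrite raddfD.
Qed.

Lemma tmapr_exact : (forall y, q y = 0 -> exists x, i x = y) ->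
  forall w, tmapr U q w = 0 -> exists v, tmapr U i v = w.
Proof.
move=> ex w w0; have [I [u [b [bl ub]]]] := right_dual_basis projU fgU.
have c0 j : q (tcoord b j w) = 0.
  by rewrite -(tcoord_tmapr bl) w0; apply: add_morph0; apply: tcoordD.
exists (\sum_j pure (u j) (projT1 (cid (ex _ (c0 j))))).
rewrite linear_sum [RHS](tcoord_sum bl ub); apply: eq_bigr => j _.
by rewrite /= tmaprE (projT2 (cid (ex _ (c0 j)))).
Qed.

End Exact.

Section Projective.
Variables (U : lmodType (env L)) (X : lmodType L).
Hypotheses (projU : projective U) (fgU : fin_gen U) (fgX : fin_gen X).

Lemma env_left_coord : exists (n : nat) (x : 'I_n -> X) (G : 'I_n -> X -> env L -> L),
  [/\ forall m y, {morph G m y : v w / v + w},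
      forall m w, {morph (G m)^~ w : y z / y + z},
      forall m y a w, G m y (etens 1 a * w) = G m (a *: y) w,
      forall m y a w, G m y (etens a 1 * w) = a * G m y w &
      forall (g : U) y w, pure (w *: g) y = \sum_m G m y w *: pure g (x m)].
Proof.
have [n [x [c [xc _]]]] := field_dual_basis (kmod_fin_gen fgX).
pose f m y (a b : L) : L := (c m (b *: y : X) : k) *: a.
have bal m y : balanced (fun a (z : k) => z *: a) (fun z b => z *: b) (f m y).
  split=> [a a' b|a b b'|a z b]; rewrite /f.
  - by rewrite scalerDr.
  - by rewrite scalerDl linearD /= scalerDl.
  rewrite -[in RHS](mul1r b) scalerAl -scalerA.
  by rewrite [c m (z%:A *: _)](linearZ_LR (c m) z (b *: y : kmod X)) /= scalerA mulrC.
exists n, x, (fun m y => tlift (f m y)); split.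
- by move=> m y v w; rewrite tliftD.
- move=> m w y z; move: w; apply: tensor_ext => [v w|v w|a b].
  + by rewrite tliftD.
  + by rewrite !tliftD // addrACA.
  by rewrite !tlift_pure // /f scalerDr linearD scalerDl.
- move=> m y a; apply: tensor_ext => [v w|v w|c' b].
  + by rewrite mulrDr tliftD.
  + by rewrite tliftD.
  by rewrite [tpure _ _ c' b]/(etens c' b) etensM !tlift_pure // /f mul1r scalerA.
- move=> m y a; apply: tensor_ext => [v w|v w|c' b].
  + by rewrite mulrDr tliftD.
  + by rewrite tliftD // mulrDr.
  by rewrite [tpure _ _ c' b]/(etens c' b) etensM !tlift_pure // /f mulr1 scalerAr.
move=> g y; apply: tensor_ext => [v w|v w|a b].
- by rewrite scalerDl pureDl.
- by rewrite -big_split /=; apply: eq_bigr => m _; rewrite tliftD // scalerDl.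
rewrite [tpure _ _ a b]/(etens a b) etens_act -pure_tscale pureA.
rewrite {1}(xc (b *: y : kmod X)) pure_sumr scaler_sumr; apply: eq_bigr => m _.
rewrite tlift_pure // /f kscaleE -pureA !pure_tscale; congr pure.
rewrite /lact /ract -etensZ scalerA etensM !mulr1.
by rewrite -scalerAr mulr1.
Qed.

Lemma tens_dual_basis : exists (I : finType) (g : I -> tens U X)
  (t : I -> {linear tens U X -> L^o}), dual_basis g t.
Proof.
have [n [g [t gt]]] := projective_dual_basis projU fgU.
have [m [x [G [GDr GDl GMr GMl GE]]]] := env_left_coord.
pose f (p : 'I_n * 'I_m) (u : U) (y : X) := G p.2 y (t p.1 u).
have bal p : balanced (@ract _ L U) (fun a (y : X) => a *: y) (f p).
  split=> [u v y|u y z|u a y]; rewrite /f ?linearD ?GDr ?GDl //.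
  by rewrite linearZ /= GMr.
have lin p : linear (tlift (f p) : tens U X -> L^o).
  move=> a v w; rewrite tliftD //; congr (_ + _); move: v.
  apply: tensor_ext => [v v'|v v'|u y].
  - by rewrite scalerDr tliftD.
  - by rewrite tliftD ?scalerDr.
  rewrite [tpure _ _ u y]/(pure u y) pure_tscale !tlift_pure // /f.
  by rewrite linearZ /= GMl.
exists ('I_n * 'I_m)%type, (fun p => pure (g p.1) (x p.2)), (fun p => linmap (lin p)).
move=> w; rewrite /= /linmap_fun; move: w; apply: tensor_ext => [v w|v w|u y] //.
  by rewrite -big_split /=; apply: eq_bigr => p _; rewrite tliftD // scalerDl.
under eq_bigr => p _ do rewrite tlift_pure //.
rewrite /f -(pair_bigA _ (fun i j => G j y (t i u) *: pure (g i) (x j))) /=.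
rewrite -[tpure _ _ u y]/(pure u y) [in LHS](gt u) pure_sum_left.
by apply: eq_bigr => i _; rewrite GE.
Qed.

Lemma tens_projective : projective (tens U X).
Proof. by have [I [g [t gt]]] := tens_dual_basis; apply: dual_basis_projective gt. Qed.

Lemma tens_fin_gen : fin_gen (tens U X).
Proof.
have [I [g [t gt]]] := tens_dual_basis; apply: (fin_gen_fintype (g := g)) => w.
by exists (fun i => t i w : L); apply: gt.
Qed.

End Projective.
End TensorFunctor.

(** * The resolution of X obtained from the bimodule resolution of L *)

Section Resolution.
Variables (k : fieldType) (L : falgType k) (P : resolution (regbim L)).
Implicit Types (X Y Z : lmodType L).

Definition rmor (U V : lmodType (env L)) (f : U -> V) : Prop :=
  {morph f : x y / x + y} /\ forall x a, f (ract x a) = ract (f x) a.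

(** The maps g and h respect only the right action, so projectivity over env L does not give the
    lift; the right dual basis of P n does. *)
Lemma rmor_lift n (V W : lmodType (env L)) (d : {linear V -> W}) (g : P n -> W) :
    rmor g -> (forall u, exists v, d v = g u) ->
  exists h : P n -> V, rmor h /\ forall u, d (h u) = g u.
Proof.
move=> [gD gM] im.
have [I [u [b [bl ub]]]] := right_dual_basis (@res_proj _ _ P n) (@res_fg _ _ P n).
pose v i := projT1 (cid (im (u i))).
have vE i : d (v i) = g (u i) := projT2 (cid (im (u i))).
exists (fun p => \sum_i ract (v i) (b i p)); split.
  split=> [x y|x a].
    rewrite -big_split /=; apply: eq_bigr => i _; have [bD _] := bl i.
    by rewrite bD /ract etensDr scalerDl.
  rewrite (add_morph_sum (@ractDl _ _ _ a)); apply: eq_bigr => i _.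
  by have [_ bM] := bl i; rewrite bM ractA.
move=> p; rewrite linear_sum [in RHS](ub p) (add_morph_sum gD).
by apply: eq_bigr => i _; rewrite /= ract_linear vE gM.
Qed.

Section TensorRight.
Variables (U V : lmodType (env L)) (f : U -> V) (X : lmodType L).
Hypothesis f_rmor : rmor f.

Definition rtmap (w : tens U X) : tens V X := tlift (fun u x => pure (f u) x) w.

Lemma rtmap_bal : balanced (@ract _ L U) (fun a (x : X) => a *: x)
  (fun u x => pure (f u) x).
Proof.
have [fD fM] := f_rmor.
split=> [u v x|u x y|u a x]; first by rewrite fD pureDl.
  by rewrite pureDr.
by rewrite fM pureA.
Qed.

Lemma rtmapD : {morph rtmap : x y / x + y}.
Proof. by move=> x y; rewrite /rtmap tliftD //; apply: rtmap_bal. Qed.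

Lemma rtmapE u x : rtmap (pure u x) = pure (f u) x.
Proof. by rewrite /rtmap tlift_pure //; apply: rtmap_bal. Qed.

End TensorRight.

Lemma res_unit : exists u : P 0, res_aug P u = 1.
Proof. exact: res_aug_surj. Qed.

Lemma ractDr (U : lmodType (env L)) (u : U) : {morph ract u : a b / a + b}.
Proof. by move=> a b; rewrite /ract etensDr scalerDl. Qed.

(* The bimodules P n are projective on the right, so the resolution of L is split
   exact as a complex of right modules and stays exact after tensoring with X. *)
Lemma contraction0 (u : P 0) : res_aug P u = 1 -> exists s : P 0 -> P 1,
  rmor s /\ forall x, cxd P 0 (s x) = x - ract u (res_aug P x).
Proof.
move=> u1; apply: rmor_lift => [|x].
  split=> [x y|x a]; first by rewrite linearD ractDr opprD addrACA.
  rewrite ract_linear [ract (res_aug P x) a]bimactE mul1r -ractA.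
  by rewrite (ractDl a) (add_morphN (ractDl a)).
apply: res_exact0; rewrite linearB ract_linear u1.
by rewrite [ract _ _]bimactE !mul1r subrr.
Qed.

(** If d s d = d, then 1 - s d maps into cycles, so it lifts to a map t with d t = 1 - s d, and d t
    d = d follows. *)
Lemma contractionS n : exists s : P n -> P n.+1,
  rmor s /\ forall x, cxd P n (s (cxd P n x)) = cxd P n x.
Proof.
elim: n => [|n [s [sr sE]]].
  have [u u1] := res_unit; have [s [sr sE]] := contraction0 u1.
  exists s; split=> // x; rewrite sE res_aug_d.
  by rewrite (add_morph0 (ractDr u)) subr0.
have [] := @rmor_lift _ _ _ (cxd P n.+1) (fun x => x - s (cxd P n x)).
- have [sD sM] := sr; split=> [x y|x a]; first by rewrite linearD sD opprD addrACA.
  by rewrite ract_linear sM (ractDl a) (add_morphN (ractDl a)).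
- by move=> x; apply: res_exactS; rewrite linearB /= sE subrr.
move=> t [tr tE]; exists t; split=> // x.
by rewrite tE cxdd (add_morph0 (proj1 sr)) subr0.
Qed.

(** The relation d t + s d = 1 in a single degree already gives exactness there, so the maps for
    different n need not fit together. *)
Lemma contraction n : exists s : P n -> P n.+1, exists t : P n.+1 -> P n.+2,
  [/\ rmor s, rmor t & forall x, cxd P n.+1 (t x) = x - s (cxd P n x)].
Proof.
have [s [sr sE]] := contractionS n; exists s.
have [] := @rmor_lift _ _ _ (cxd P n.+1) (fun x => x - s (cxd P n x)).
- have [sD sM] := sr; split=> [x y|x a]; first by rewrite linearD sD opprD addrACA.
  by rewrite ract_linear sM (ractDl a) (add_morphN (ractDl a)).
- by move=> x; apply: res_exactS; rewrite linearB /= sE subrr.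
by move=> t [tr tE]; exists t.
Qed.

Section Augmentation.
Variable X : lmodType L.

Definition taug_fun (w : tens (P 0) X) : X :=
  tlift (fun p x => (res_aug P p : L) *: x) w.

Lemma taug_bal : balanced (@ract _ L (P 0)) (fun a (x : X) => a *: x)
  (fun p x => (res_aug P p : L) *: x).
Proof.
split=> [p q x|p x y|p a x]; first by rewrite linearD scalerDl.
  by rewrite scalerDr.
by rewrite ract_linear scalerA [ract _ _]bimactE mul1r.
Qed.

Lemma taug_linear : linear taug_fun.
Proof.
move=> a v w; rewrite /taug_fun tliftD; last exact: taug_bal.
congr (_ + _); move: v; apply: tensor_ext => [x x'|x x'|p x].
- by rewrite scalerDr tliftD //; apply: taug_bal.
- by rewrite tliftD ?scalerDr //; apply: taug_bal.
rewrite [a *: _]tscaleE !tlift_pure; try exact: taug_bal.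
by rewrite lact_linear [lact _ _]bimactE mulr1 scalerA.
Qed.

Definition taug : {linear tens (P 0) X -> X} := linmap taug_linear.

Lemma taugE p x : taug (pure p x) = (res_aug P p : L) *: x.
Proof. by rewrite /= /linmap_fun /taug_fun tlift_pure //; apply: taug_bal. Qed.

Lemma taug_d w : taug (cxd (tcx P X) 0 w) = 0.
Proof.
move: w; apply: (tens_ext (f := taug \o tmap X (cxd P 0)) (g := \0)) => p x /=.
by rewrite tmapE taugE res_aug_d scale0r.
Qed.

Lemma taug_surj x : exists w, taug w = x.
Proof.
have [u u1] := res_unit; exists (pure u x).
by rewrite taugE u1 scale1r.
Qed.

Lemma tcx_exact0 (w : tcx P X 0) : taug w = 0 -> exists v, cxd (tcx P X) 0 v = w.
Proof.
move=> w0; have [u u1] := res_unit; have [s [sr sE]] := contraction0 u1.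
exists (rtmap s w).
transitivity (w - pure u (taug w)); last by rewrite w0 pure0r subr0.
have pD : {morph pure u : x y / x + y} by move=> x y; apply: pureDr.
clear w0; move: w; apply: tensor_ext => [v w|v w|p x].
- by rewrite rtmapD // !raddfD.
- by rewrite raddfD pD opprD addrACA.
rewrite rtmapE // /= tmapE sE pureBl; congr (_ - _).
by rewrite taugE pureA.
Qed.

Lemma tcx_exactS n (w : tcx P X n.+1) :
  cxd (tcx P X) n w = 0 -> exists v, cxd (tcx P X) n.+1 v = w.
Proof.
move=> w0; have [s [t [sr tr tE]]] := contraction n; exists (rtmap t w).
transitivity (w - rtmap s (cxd (tcx P X) n w)).
  clear w0; move: w; apply: tensor_ext => [v w|v w|p x].
  - by rewrite rtmapD // !raddfD.
  - by rewrite raddfD rtmapD // opprD addrACA.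
  by rewrite rtmapE // /= !tmapE rtmapE // tE pureBl.
by rewrite w0 (add_morph0 (rtmapD sr)) subr0.
Qed.

End Augmentation.

Lemma tcx_projective X : fin_gen X -> forall n, projective (tcx P X n).
Proof. by move=> fgX n; apply: tens_projective; [apply: res_proj|apply: res_fg|]. Qed.

Lemma tcx_fin_gen X : fin_gen X -> forall n, fin_gen (tcx P X n).
Proof. by move=> fgX n; apply: tens_fin_gen; [apply: res_proj|apply: res_fg|]. Qed.

Definition tcx_res X (fgX : fin_gen X) : resolution X :=
  @Resolution _ X (tcx P X) (taug X) (tcx_projective fgX)
    (tcx_fin_gen fgX) (@taug_surj X) (@taug_d X) (@tcx_exact0 X)
    (@tcx_exactS X).

Definition tcxm X Y (f : {linear X -> Y}) n : {linear tcx P X n -> tcx P Y n} :=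
  tmapr (P n) f.

Lemma tcxm_d X Y (f : {linear X -> Y}) n w :
  tcxm f n (cxd (tcx P X) n w) = cxd (tcx P Y) n (tcxm f n.+1 w).
Proof. exact: tmapr_tmap. Qed.

Lemma tcxm_tgm X Y (f : {linear X -> Y}) (phi : gmap P) p m w :
  tcxm f m (gm (tgm X phi) p m w) = gm (tgm Y phi) p m (tcxm f p w).
Proof. exact: (tmapr_tmap f (gm phi p m)). Qed.

Lemma taug_tcxm X Y (f : {linear X -> Y}) w : taug Y (tcxm f 0 w) = f (taug X w).
Proof.
move: w; apply: tensor_ext => [v w|v w|p x]; rewrite ?raddfD //.
by rewrite /tcxm tmaprE !taugE linearZ.
Qed.

End Resolution.

(** * Long exact sequences *)

(* Instances of raddfD and its relatives whose right-hand sides need no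
   simplification, which would unfold the differentials. *)
Section LinearMaps.
Variables (R : pzRingType) (U V : lmodType R) (f : {linear U -> V}).
Lemma limD x y : f (x + y) = f x + f y. Proof. exact: linearD. Qed.
Lemma limB x y : f (x - y) = f x - f y. Proof. exact: linearB. Qed.
Lemma limN x : f (- x) = - f x. Proof. exact: linearN. Qed.
Lemma lim0 : f 0 = 0. Proof. exact: linear0. Qed.
Lemma limZ a x : f (a *: x) = a *: f x. Proof. exact: linearZ. Qed.
Lemma limP a x y : f (a *: x + y) = a *: f x + f y. Proof. exact: linearP. Qed.
Lemma lim_sum (I : Type) (r : seq I) (F : I -> U) :
  f (\sum_(i <- r) F i) = \sum_(i <- r) f (F i).
Proof. exact: linear_sum. Qed.
End LinearMaps.

Section LinearCocycles.
Variables (R : pzRingType) (Q : complex R) (N : lmodType R) (f : cocycle Q N) (n : nat).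
Lemma ccoD x y : cc f n (x + y) = cc f n x + cc f n y. Proof. exact: linearD. Qed.
Lemma ccoB x y : cc f n (x - y) = cc f n x - cc f n y. Proof. exact: linearB. Qed.
Lemma ccoN x : cc f n (- x) = - cc f n x. Proof. exact: linearN. Qed.
Lemma cco0 : cc f n 0 = 0. Proof. exact: linear0. Qed.
End LinearCocycles.

Section ExtMaps.
Variables (R : pzRingType) (N : lmodType R).

Lemma ext_class_eq0 (Q : complex R) (f : cocycle Q N) :
  ext_class f = 0 <-> is_coboundary f.
Proof. by rewrite -(ext_class0 Q N) ext_class_eq subr0. Qed.

(** With finite support, the bounding family can enter the construction of further cocycles. *)
Lemma coboundary_fin (Q : complex R) (f : cocycle Q N) : is_coboundary f ->
  (forall x, cc f 0 x = 0) /\ exists g : forall n, {linear Q n -> N},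
    (exists b, forall n, (b <= n)%N -> forall x, g n x = 0) /\
    forall n x, cc f n.+1 x = g n (cxd Q n x).
Proof.
case=> f0 [g gE]; split=> //; have [b hb] := cc_fin f.
exists (fun n => if (n < b)%N then g n else \0%R); split.
  by exists b => n bn x; rewrite ltnNge bn.
move=> n x; case: ltnP => // bn; rewrite hb //.
exact: leqW.
Qed.

Definition ext_compat (Q Q' : complex R) (t : cocycle Q N -> cocycle Q' N) : Prop :=
  {morph t : f g / f + g} /\ forall f, is_coboundary f -> is_coboundary (t f).

Definition ext_map (Q Q' : complex R) (t : cocycle Q N -> cocycle Q' N)
  (x : Ext Q N) : Ext Q' N := ext_class (t (ext_repr x)).

Section Compat.
Variables (Q Q' : complex R) (t : cocycle Q N -> cocycle Q' N).
Hypothesis tc : ext_compat t.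

Lemma ext_mapE f : ext_map t (ext_class f) = ext_class (t f).
Proof.
have [tD tB] := tc; apply/ext_class_eq.
rewrite -(add_morphN tD) -tD; apply: tB; apply/ext_class_eq; exact: ext_reprK.
Qed.

Lemma ext_mapD : {morph ext_map t : x y / x + y}.
Proof.
elim/ext_ind=> f; elim/ext_ind=> g.
by rewrite -[_ + _]ext_classD !ext_mapE (proj1 tc); apply: ext_classD.
Qed.

End Compat.

Section Pull.
Variables (Q Q' : complex R) (c : forall n, {linear Q' n -> Q n}).
Hypothesis cd : forall n x, c n (cxd Q' n x) = cxd Q n (c n.+1 x).

Definition cpull (f : cocycle Q N) : cocycle Q' N.
Proof.
exists (fun n x => cc f n (c n x)).
- by move=> n a x y; rewrite !linearP.
- by have [b hb] := cc_fin f; exists b => n bn x; rewrite hb.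
- by move=> n x; rewrite cd cc_d.
Defined.

Lemma cpull_compat : ext_compat cpull.
Proof.
split=> [f g|f [f0 [g gE]]]; first exact: cocycleP.
split=> [x|]; first exact: f0.
by exists (fun n => g n \o c n)%FUN => n x; rewrite /= gE cd.
Qed.

End Pull.

Section Delta.
Variables (Q Q' : complex R) (c : forall n, {linear Q' n.+1 -> Q n}).
Hypothesis cd : forall n x, c n (cxd Q' n.+1 x) = - cxd Q n (c n.+1 x).

Definition cdelta_fun (f : cocycle Q N) n : Q' n -> N :=
  match n with 0 => fun _ => 0 | n'.+1 => fun x => cc f n' (c n' x) end.

Definition cdelta (f : cocycle Q N) : cocycle Q' N.
Proof.
exists (cdelta_fun f).
- by case=> [|n] a x y /=; rewrite ?scaler0 ?addr0 ?linearP.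
- have [b hb] := cc_fin f; exists b.+1 => -[|n] bn x //=.
  by rewrite hb.
- by case=> [|n] x //=; rewrite cd linearN /= cc_d oppr0.
Defined.

Lemma cdelta_compat : ext_compat cdelta.
Proof.
split=> [f g|f [f0 [g gE]]].
  by apply: cocycleP => -[|n] x /=; rewrite ?addr0.
split=> [x //|].
pose h n : {linear Q' n -> N} :=
  match n with 0 => \0%R | n'.+1 => (\- (g n' \o c n'))%R end.
exists h => -[|n] x /=; first exact: f0.
by rewrite gE cd linearN opprK.
Qed.

End Delta.
End ExtMaps.
Arguments cpull {R N Q Q' c} cd f.
Arguments cdelta {R N Q Q' c} cd f.

Lemma cpullE (R : pzRingType) (N : lmodType R) (Q Q' : complex R)
    (c : forall n, {linear Q' n -> Q n}) cd (f : cocycle Q N) n x :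
  cc (cpull (c := c) cd f) n x = cc f n (c n x).
Proof. by []. Qed.

Lemma cdelta0 (R : pzRingType) (N : lmodType R) (Q Q' : complex R)
    (c : forall n, {linear Q' n.+1 -> Q n}) cd (f : cocycle Q N) x :
  cc (cdelta (c := c) cd f) 0 x = 0.
Proof. by []. Qed.

Lemma cdeltaS (R : pzRingType) (N : lmodType R) (Q Q' : complex R)
    (c : forall n, {linear Q' n.+1 -> Q n}) cd (f : cocycle Q N) n x :
  cc (cdelta (c := c) cd f) n.+1 x = cc f n (c n x).
Proof. by []. Qed.

Section ShortExact.
Variables (k : fieldType) (L : falgType k) (P : resolution (regbim L)).
Local Notation T := (tcx P).
Local Notation tcxmd := (@tcxm_d _ _ P _ _).

Section ModuleMaps.
Variables (X Y N : lmodType L) (f : {linear X -> Y}).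

Definition mstar : ExtM P Y N -> ExtM P X N := ext_map (cpull (tcxmd f)).

Lemma mstarE e : mstar (ext_class e) = ext_class (cpull (tcxmd f) e).
Proof. exact/ext_mapE/cpull_compat. Qed.

Lemma mstarD : {morph mstar : x y / x + y}.
Proof. exact/ext_mapD/cpull_compat. Qed.

Lemma mstar_act e (x : HH P) : mstar (ext_act e x) = ext_act (mstar e) x.
Proof.
elim/ext_ind: e => e; elim/ext_ind: x => z.
rewrite mstarE !(ext_act_class _ (liftP z)) mstarE; congr ext_class.
apply: cocycleP => n w; rewrite !(cactE, cpullE).
by apply: eq_bigr => m _; rewrite cpullE tcxm_tgm.
Qed.

End ModuleMaps.

(* The splittings s and r of the complexes P (x) X -> P (x) Y -> P (x) Z do not
   commute with the differentials; k is the resulting connecting map. *)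
Record ses (X Y Z : lmodType L) := Ses {
  ses_i : {linear X -> Y};
  ses_q : {linear Y -> Z};
  ses_s : forall n, {linear T Z n -> T Y n};
  ses_r : forall n, {linear T Y n -> T X n};
  ses_k : forall n, {linear T Z n.+1 -> T X n};
  ses_inj : injective ses_i;
  ses_qi : forall x, ses_q (ses_i x) = 0;
  ses_ker : forall y, ses_q y = 0 -> exists x, ses_i x = y;
  ses_surj : forall z, exists y, ses_q y = z;
  ses_qs : forall n w, tcxm P ses_q n (ses_s n w) = w;
  ses_ri : forall n w, ses_r n (tcxm P ses_i n w) = w;
  ses_isplit : forall n w, w = tcxm P ses_i n (ses_r n w) + ses_s n (tcxm P ses_q n w);
  ses_ik : forall n w, tcxm P ses_i n (ses_k n w) =
    cxd (T Y) n (ses_s n.+1 w) - ses_s n (cxd (T Z) n w)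
}.

Lemma tcxm_inj (X Y : lmodType L) (i : {linear X -> Y}) n :
  injective i -> injective (tcxm P i n).
Proof. by apply: tmapr_inj; [apply: res_proj|apply: res_fg]. Qed.

Lemma tcxm_qi (X Y Z : lmodType L) (i : {linear X -> Y}) (q : {linear Y -> Z}) n w :
  (forall x, q (i x) = 0) -> tcxm P q n (tcxm P i n w) = 0.
Proof.
move=> qi; move: w.
apply: (tens_ext (f := tmapr _ q \o tmapr _ i) (g := \0)) => u x /=.
by rewrite !tmaprE qi pure0r.
Qed.

(** Finite generation of Z makes the modules P n (x) Z projective, hence the splittings s. The
    values of r and k are preimages under an injective map, so they are unique and depend linearly
    on the argument. *)
Lemma ses_exists (X Y Z : lmodType L) (i : {linear X -> Y}) (q : {linear Y -> Z}) :
    injective i -> (forall x, q (i x) = 0) ->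
    (forall y, q y = 0 -> exists x, i x = y) -> (forall z, exists y, q y = z) ->
    fin_gen Z ->
  exists S : ses X Y Z, ses_i S = i /\ ses_q S = q.
Proof.
move=> inj qi ker surj fgZ.
have s_ex n : exists s : {linear T Z n -> T Y n}, forall w, tcxm P q n (s w) = w.
  exact: (tcx_projective fgZ (idfun : {linear T Z n -> T Z n}) (tmapr_surj surj)).
pose s n := projT1 (cid (s_ex n)).
have sE n w : tcxm P q n (s n w) = w := projT2 (cid (s_ex n)) w.
have im n (w : T Y n) : tcxm P q n w = 0 -> exists v, tcxm P i n v = w.
  exact: (tmapr_exact (@res_proj _ _ P n) (@res_fg _ _ P n) ker).
have inji n := @tcxm_inj _ _ i n inj.
have r_im n (w : T Y n) : exists v, tcxm P i n v = w - s n (tcxm P q n w).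
  by apply: im; rewrite linearB /= sE subrr.
pose r n w := projT1 (cid (r_im n w)).
have rE n w : tcxm P i n (r n w) = w - s n (tcxm P q n w) := projT2 (cid (r_im n w)).
have r_lin n : linear (r n).
  by move=> a v w; apply: inji; rewrite linearP !rE !linearP /= scalerDr addrACA.
have k_im n (w : T Z n.+1) : exists v,
    tcxm P i n v = cxd (T Y) n (s n.+1 w) - s n (cxd (T Z) n w).
  by apply: im; rewrite linearB /= sE tcxm_d sE subrr.
pose kp n w := projT1 (cid (k_im n w)).
have kE n w : tcxm P i n (kp n w) = cxd (T Y) n (s n.+1 w) - s n (cxd (T Z) n w)
  := projT2 (cid (k_im n w)).
have k_lin n : linear (kp n).
  by move=> a v w; apply: inji; rewrite linearP !kE !linearP /= scalerDr addrACA.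
have ri n w : r n (tcxm P i n w) = w.
  by apply: inji; rewrite rE tcxm_qi // linear0 subr0.
have sp n w : w = tcxm P i n (r n w) + s n (tcxm P q n w) by rewrite rE subrK.
by exists (@Ses X Y Z i q s (fun n => linmap (r_lin n)) (fun n => linmap (k_lin n))
  inj qi ker surj sE ri sp kE).
Qed.

Section LongExact.
Variables (X Y Z : lmodType L) (S : ses X Y Z) (N : lmodType L).
Local Notation i := (ses_i S).
Local Notation q := (ses_q S).
Local Notation s := (ses_s S).
Local Notation r := (ses_r S).
Local Notation kp := (ses_k S).
Local Notation istar := (mstar (N := N) (ses_i S)).
Local Notation qstar := (mstar (N := N) (ses_q S)).

Lemma ses_ii n : injective (tcxm P i n).
Proof. exact/tcxm_inj/ses_inj. Qed.

Lemma ses_kd n w : kp n (cxd (T Z) n.+1 w) = - cxd (T X) n (kp n.+1 w).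
Proof.
apply: ses_ii; rewrite limN tcxm_d !ses_ik limB !cxdd lim0.
by rewrite subr0 sub0r opprK.
Qed.

Lemma ses_rd n w : r n (cxd (T Y) n w) =
  cxd (T X) n (r n.+1 w) + kp n (tcxm P q n.+1 w).
Proof.
apply: ses_ii; rewrite limD tcxm_d ses_ik addrA -limD -ses_isplit -tcxm_d.
by apply/eqP; rewrite eq_sym subr_eq; apply/eqP/ses_isplit.
Qed.

Definition delta : ExtM P X N -> ExtM P Z N := ext_map (cdelta ses_kd).

Lemma deltaE f : delta (ext_class f) = ext_class (cdelta ses_kd f).
Proof. exact/ext_mapE/cdelta_compat. Qed.

Lemma deltaD : {morph delta : x y / x + y}.
Proof. exact/ext_mapD/cdelta_compat. Qed.

(** Subtracting the coboundary of [u \o r] makes e vanish on P (x) X; the result factors through P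
    (x) Z, the factor being read off on the splitting s. *)
Lemma istar_ker e : istar e = 0 -> exists c, e = qstar c.
Proof.
elim/ext_ind: e => e; rewrite mstarE => /ext_class_eq0/coboundary_fin[e0 [u [[b hb] uE]]].
pose v n : {linear T Y n -> N} := (u n \o r n)%FUN.
pose e'_fun n : {linear T Y n -> N} := match n with
  0 => cc e 0 | n'.+1 => ((cc e n'.+1 : {linear _ -> _}) \- (v n' \o cxd (T Y) n'))%R end.
have e'S n w : e'_fun n.+1 w = cc e n.+1 w - v n (cxd (T Y) n w) by [].
have e'_lin n : linear (e'_fun n) by exact: linearP.
have e'_fin : exists b, forall n, (b <= n)%N -> forall x, e'_fun n x = 0.
  have [c hc] := cc_fin e; exists (maxn b c).+1 => -[|n] //.
  rewrite ltnS geq_max => /andP[bn cn] x.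
  by rewrite e'S [v _ _]hb // hc ?subr0 // leqW.
have e'_d n x : e'_fun n (cxd (T Y) n x) = 0.
  by case: n x => [|n] x; [exact: cc_d | rewrite e'S cc_d cxdd lim0 subr0].
pose e' := Cocycle e'_lin e'_fin e'_d.
have e'i n w : cc e' n (tcxm P i n w) = 0.
  case: n w => [|n] w; first exact: e0.
  rewrite [LHS]e'S -tcxm_d; apply/eqP; rewrite subr_eq0; apply/eqP.
  by rewrite -[LHS]/(cc (cpull (tcxmd i) e) n.+1 w) uE /v /= ses_ri.
have e's n w : cc e' n w = cc e' n (s n (tcxm P q n w)).
  by rewrite {1}(ses_isplit S w) ccoD e'i add0r.
have c_lin n : linear (fun w => cc e' n (s n w)).
  by move=> a x y; rewrite !linearP.
have c_fin : exists b, forall n, (b <= n)%N -> forall x, cc e' n (s n x) = 0.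
  by have [c hc] := cc_fin e'; exists c => n cn x; rewrite hc.
have c_d n x : cc e' n (s n (cxd (T Z) n x)) = 0.
  by rewrite -[x](ses_qs S) -tcxm_d -e's cc_d.
exists (ext_class (Cocycle c_lin c_fin c_d)); rewrite mstarE.
apply/ext_class_eq; split=> [x|].
  rewrite cc_add cc_opp cpullE -[X in _ - X]/(cc e' 0 (s 0 (tcxm P q 0 x))) -e's.
  by rewrite subrr.
exists v => n x.
rewrite cc_add cc_opp cpullE -[X in _ - X]/(cc e' n.+1 (s n.+1 (tcxm P q n.+1 x))) -e's.
by rewrite [cc e' _ _]e'S opprB addrC subrK.
Qed.

(** If g bounds the image of f, then [f \o r - g \o q] is a cocycle by [ses_rd], and it restricts to
    f. *)
Lemma delta_ker f : delta f = 0 -> exists e, f = istar e.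
Proof.
elim/ext_ind: f => f; rewrite deltaE => /ext_class_eq0/coboundary_fin[_ [g [[b hb] gE]]].
have e_lin n : linear (fun w => cc f n (r n w) - g n (tcxm P q n w)).
  exact: (linearP (((cc f n : {linear _ -> _}) \o r n) \- (g n \o tcxm P q n))%R).
have e_fin : exists b, forall n, (b <= n)%N ->
    forall w, cc f n (r n w) - g n (tcxm P q n w) = 0.
  have [c hc] := cc_fin f; exists (maxn b c) => n; rewrite geq_max => /andP[bn cn] w.
  by rewrite hb // hc // subr0.
have e_d n w : cc f n (r n (cxd (T Y) n w)) - g n (tcxm P q n (cxd (T Y) n w)) = 0.
  by rewrite ses_rd ccoD cc_d add0r tcxm_d -gE subrr.
exists (ext_class (Cocycle e_lin e_fin e_d)); rewrite mstarE; congr ext_class.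
apply: cocycleP => n w; rewrite cpullE.
rewrite -[RHS]/(cc f n (r n (tcxm P i n w)) - g n (tcxm P q n (tcxm P i n w))).
by rewrite ses_ri tcxm_qi ?lim0 ?addr0 ?subr0 //; apply: ses_qi.
Qed.

(** If v bounds the pullback of c, its restriction to P (x) X is a cocycle f, and [v \o s] bounds
    the difference of c and the image of f. *)
Lemma qstar_ker c : qstar c = 0 -> exists f, c = delta f.
Proof.
elim/ext_ind: c => c; rewrite mstarE => /ext_class_eq0/coboundary_fin[c0 [v [[b hb] vE]]].
have f_lin n : linear (fun w => v n (tcxm P i n w)).
  by move=> a x y; rewrite !linearP.
have f_fin : exists b, forall n, (b <= n)%N -> forall w, v n (tcxm P i n w) = 0.
  by exists b => n bn w; rewrite hb.
have f_d n w : v n (tcxm P i n (cxd (T X) n w)) = 0.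
  rewrite tcxm_d -vE cpullE tcxm_qi ?cco0 //; exact: ses_qi.
exists (ext_class (Cocycle f_lin f_fin f_d)); rewrite deltaE; apply/ext_class_eq.
split=> [w|].
  by rewrite cc_add cc_opp cdelta0 subr0 -[w](ses_qs S); apply: c0.
exists (fun n => v n \o s n)%FUN => n w; rewrite cc_add cc_opp cdeltaS.
have := vE n (s n.+1 w); rewrite cpullE ses_qs => ->.
rewrite -[cc _ n _]/(v n (tcxm P i n (kp n w))) ses_ik limB opprB addrCA subrr addr0.
by [].
Qed.

Lemma qstar_delta f : qstar (delta f) = 0.
Proof.
elim/ext_ind: f => f; rewrite deltaE mstarE; apply/ext_class_eq0; split=> [x //|].
exists (fun n => (cc f n : {linear _ -> _}) \o r n)%FUN => n w.
by rewrite cpullE cdeltaS [RHS]/= ses_rd ccoD cc_d add0r.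
Qed.

Lemma delta_istar e : delta (istar e) = 0.
Proof.
elim/ext_ind: e => e; rewrite mstarE deltaE; apply/ext_class_eq0; split=> [x //|].
exists (fun n => \- ((cc e n : {linear _ -> _}) \o s n))%R => n w.
by rewrite cdeltaS cpullE ses_ik ccoB cc_d sub0r.
Qed.

(* The maps r (s phi - phi s) are a homotopy between kp phi and phi kp. *)
Lemma delta_act f (x : HH P) : delta (ext_act f x) = ext_act (delta f) x.
Proof.
elim/ext_ind: f => f; elim/ext_ind: x => z.
rewrite deltaE !(ext_act_class _ (liftP z)) deltaE.
set phi := Defs.lift z; apply/ext_class_eq.
pose h n m (w : T Z n) : T X m :=
  r m (s m (gm (tgm Z phi) n m w) - gm (tgm Y phi) n m (s n w)).
have hE n m w : tcxm P i m (h n m w) =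
    s m (gm (tgm Z phi) n m w) - gm (tgm Y phi) n m (s n w).
  rewrite [RHS](ses_isplit S) (limB (tcxm P q m)) ses_qs tcxm_tgm ses_qs subrr.
  by rewrite lim0 addr0.
have h_lin n : linear (fun w => \sum_(m < n.+1) cc f m (h n m w)).
  move=> a v w; rewrite scaler_sumr -big_split /=; apply: eq_bigr => m _.
  have -> : h n m (a *: v + w) = a *: h n m v + h n m w.
    apply: ses_ii; rewrite limP !hE (limP (s n)) !gm_lin (limP (s m)).
    by rewrite scalerBr opprD addrACA.
  by rewrite linearP.
split=> [w|].
  by rewrite cc_add cc_opp [cc (cdelta _ _) _ _]/= cactE big_ord1 /= subrr.
exists (fun n => linmap (h_lin n)) => n w; rewrite cc_add cc_opp cdeltaS.
rewrite !cactE [X in _ - X]big_ord_recl cdelta0 add0r -sumrB.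
apply: eq_bigr => m _; rewrite cdeltaS -ccoB.
suff -> : gm (tgm X phi) n m (kp n w) - kp m (gm (tgm Z phi) n.+1 m.+1 w) =
    h n m (cxd (T Z) n w) - cxd (T X) m (h n.+1 m.+1 w).
  by rewrite ccoB cc_d subr0.
apply: ses_ii; rewrite !limB tcxm_tgm tcxm_d !hE !ses_ik !limB -!gm_d.
have alg (V : zmodType) (a b c e : V) : a - b + (- c - - e) = e - b + (- c - - a).
  by rewrite !opprK (addrC a) (addrC e) -!addrA (addrCA a) (addrCA e) (addrC a).
exact: alg.
Qed.

End LongExact.
End ShortExact.

(** * Families of maps between resolutions *)

Section Positive.
Variables (k : fieldType) (L : falgType k) (P : resolution (regbim L)).
Local Notation T := (tcx P).

(** For projective Y the augmentation splits. Inductively 1 - t d maps into cycles, which are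
    boundaries, and lifts because the terms of P (x) Y are projective. *)
Lemma tcx_contraction (Y : lmodType L) (projY : projective Y) (fgY : fin_gen Y) n :
  exists t : {linear T Y n -> T Y n.+1},
    forall w, cxd (T Y) n (t (cxd (T Y) n w)) = cxd (T Y) n w.
Proof.
elim: n => [|n [t tE]].
  have [s sE] := projY _ _ (taug P Y) (idfun : {linear Y -> Y}) (@taug_surj _ _ P Y).
  have [w|t tE] := projective_lift (g := cxd (T Y) 0)
    (f := (idfun \- (s \o taug P Y))%R : {linear T Y 0 -> T Y 0})
    (@tcx_projective _ _ P Y fgY 0).
    by apply: tcx_exact0; rewrite [X in taug _ _ X]/(w - s (taug P Y w)) limB sE subrr.
  exists t => w; rewrite tE.
  by rewrite -[LHS]/(cxd (T Y) 0 w - s (taug P Y (cxd (T Y) 0 w))) taug_d lim0 subr0.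
have [w|t' tE'] := projective_lift (g := cxd (T Y) n.+1)
  (f := (idfun \- (t \o cxd (T Y) n))%R : {linear T Y n.+1 -> T Y n.+1})
  (@tcx_projective _ _ P Y fgY n.+1).
  by apply: tcx_exactS; rewrite [X in cxd _ _ X]/(w - t (cxd (T Y) n w)) limB tE subrr.
exists t' => w; rewrite tE'.
by rewrite -[LHS]/(cxd (T Y) n.+1 w - t (cxd (T Y) n (cxd (T Y) n.+1 w))) cxdd lim0 subr0.
Qed.

(** The values of 1 - t d are boundaries, which f kills; so f is [f \o t] composed with d in
    positive degrees. *)
Lemma projective_coboundary (Y N : lmodType L) (f : cocycle (T Y) N) :
  projective Y -> fin_gen Y -> (forall w, cc f 0 w = 0) -> is_coboundary f.
Proof.
move=> projY fgY f0; split=> //.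
have t_ex n := tcx_contraction projY fgY n.
exists (fun n => (cc f n.+1 : {linear _ -> _}) \o projT1 (cid (t_ex n)))%FUN => n w.
rewrite [RHS]/=; case: (cid (t_ex n)) => t tE /=.
have [|v vE] := @tcx_exactS _ _ P Y n (w - t (cxd (T Y) n w)).
  by rewrite limB tE subrr.
by apply/eqP; rewrite -subr_eq0 -ccoB -vE cc_d.
Qed.

Definition positive (x : HH P) : Prop := hh_comp 0 x = 0.

Lemma positive_repr x : positive x -> forall p, cc (ext_repr x) 0 p = 0.
Proof.
move=> /ext_class_eq0[h _] p; exact: h.
Qed.

Lemma taug_lift z (phi : gmap P) (X : lmodType L) n p (x : X) : is_lift z phi ->
  taug P X (gm (tgm X phi) n 0 (pure p x)) = (cc z n p : L) *: x.
Proof. by move=> lz; rewrite -lz [gm _ _ _ _]tmapE taugE. Qed.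

(** As x has no component of degree 0, its chain map sends degree 0 into the kernel of the
    augmentation, that is into boundaries, where e vanishes. The product therefore vanishes in
    degree 0 and is a coboundary. *)
Lemma positive_act (Y N : lmodType L) (e : ExtM P Y N) x :
  projective Y -> fin_gen Y -> positive x -> ext_act e x = 0.
Proof.
move=> projY fgY xpos; elim/ext_ind: e => e; have z0 := positive_repr xpos.
rewrite -(ext_reprK x) (ext_act_class _ (liftP _)); apply/ext_class_eq0.
apply: projective_coboundary => // w; rewrite cactE big_ord1.
have [v <-] : exists v, cxd (T Y) 0 v = gm (tgm Y (Defs.lift (ext_repr x))) 0 0 w.
  apply: tcx_exact0; move: w; apply: (tens_ext (g := \0)
    (f := taug P Y \o (gm (tgm Y (Defs.lift (ext_repr x))) 0 0 : {linear _ -> _}))) => p y.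
  by rewrite [LHS](taug_lift _ _ (liftP _)) z0 scale0r.
exact: cc_d.
Qed.

End Positive.

Section Quotient.
Variables (R : pzRingType) (V : lmodType R) (W : {pred V}) (W_sub : submod_closed W).

Lemma qclass_linear : linear (qclass W_sub).
Proof. by move=> a u v; rewrite qclassD -qscaleE. Qed.

Definition qmap : {linear V -> quotmod W_sub} := linmap qclass_linear.

Lemma qmap_surj x : exists v, qmap v = x.
Proof. by exists (qrepr x); apply: qreprK. Qed.

Lemma qmap_eq0 v : (qmap v = 0) <-> (v \in W).
Proof.
have q0 : qmap 0 = 0 by exact: linear0.
rewrite -q0; split=> [/eqP|h]; last apply/eqP.
  by rewrite [_ == _]qclass_eq subr0.
by rewrite [_ == _]qclass_eq subr0.
Qed.

Lemma quot_lift (X : lmodType R) (f : {linear V -> X}) :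
  (forall v, v \in W -> f v = 0) ->
  exists g : {linear quotmod W_sub -> X}, forall v, g (qmap v) = f v.
Proof.
move=> f0.
have E v : f (qrepr (qmap v)) = f v.
  apply/eqP; rewrite -subr_eq0 -limB; apply/eqP/f0/qmap_eq0.
  by rewrite limB [qmap (qrepr _)](qreprK (qmap v)) subrr.
have lin : linear (fun x : quotmod W_sub => f (qrepr x)).
  move=> a x y; have [u <-] := qmap_surj x; have [v <-] := qmap_surj y.
  by rewrite -limP !E limP.
by exists (linmap lin).
Qed.

End Quotient.

Section Families.
Variables (k : fieldType) (L : falgType k) (P : resolution (regbim L)).
Local Notation T := (tcx P).

Definition sg (V : zmodType) (b : bool) (v : V) : V := if b then - v else v.

Lemma sgK (V : zmodType) b (v : V) : sg b (sg b v) = v.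
Proof. by case: b => //=; rewrite opprK. Qed.
Lemma sg_add (V : zmodType) b c (v : V) : sg b (sg c v) = sg (b (+) c) v.
Proof. by case: b; case: c => //=; rewrite opprK. Qed.
Lemma sg0 (V : zmodType) b : sg b (0 : V) = 0.
Proof. by case: b; rewrite /= ?oppr0. Qed.
Lemma sgD (V : zmodType) b : {morph @sg V b : x y / x + y}.
Proof. by case: b => x y //=; rewrite opprD. Qed.
Lemma sgZ (R : pzRingType) (V : lmodType R) b a (v : V) : sg b (a *: v) = a *: sg b v.
Proof. by case: b; rewrite /= ?scalerN. Qed.
Lemma sg_lin (R : pzRingType) (U V : lmodType R) (f : {linear U -> V}) b u :
  f (sg b u) = sg b (f u).
Proof. by case: b; rewrite /= ?limN. Qed.

Lemma cc_sg (R : pzRingType) (Q : complex R) (N : lmodType R) (f : cocycle Q N) n b x :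
  cc f n (sg b x) = sg b (cc f n x).
Proof. by case: b; rewrite /= ?ccoN. Qed.

(* Indexed as in gmap.  The sign comes from the connecting maps, which
   anticommute with the differentials. *)
Record fam (X Y : lmodType L) := Fam {
  fm : forall p m, {linear T X p -> T Y m};
  fm_sg : bool;
  fm_low : forall p m, (p < m)%N -> forall x, fm p m x = 0;
  fm_fin : exists b, forall p m, (m + b <= p)%N -> forall x, fm p m x = 0;
  fm_d : forall p m x, fm p m (cxd (T X) p x) = sg fm_sg (cxd (T Y) m (fm p.+1 m.+1 x))
}.

Section Pull.
Variables (X Y N : lmodType L) (G : fam X Y).

Definition fpull (f : cocycle (T Y) N) : cocycle (T X) N.
Proof.
exists (fun n x => \sum_(m < n.+1) cc f m (fm G n m x)).
- move=> n a x y; rewrite scaler_sumr -big_split /=.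
  by apply: eq_bigr => q _; rewrite !linearP.
- have [b hb] := cc_fin f; have [c hc] := fm_fin G.
  exists (b + c)%N => n h x; apply: big1 => q _.
  have [bq|qb] := leqP b q; first exact: hb.
  by rewrite hc ?cco0 // (leq_trans _ h) // leq_add2r ltnW.
- by move=> n x; apply: big1 => q _; rewrite fm_d cc_sg cc_d sg0.
Defined.

Lemma fpullE f n x : cc (fpull f) n x = \sum_(m < n.+1) cc f m (fm G n m x).
Proof. by []. Qed.

(** Plays for a family the role of the cocycle that a chain map lifts. *)
Definition faug : cocycle (T X) Y.
Proof.
exists (fun n x => taug P Y (fm G n 0 x)).
- by move=> n a x y; rewrite !linearP.
- by have [b hb] := fm_fin G; exists b => n bn x; rewrite hb ?lim0.
- by move=> n x; rewrite fm_d sg_lin taug_d sg0.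
Defined.

Lemma faugE n x : cc faug n x = taug P Y (fm G n 0 x).
Proof. by []. Qed.

End Pull.

Definition fid (X : lmodType L) : fam X X.
Proof.
exists (fun p m => (gm (gm1 (T X)) p m : {linear _ -> _})) false.
- exact: gm_low.
- exact: gm_fin.
- exact: gm_d.
Defined.

Section Step.
Variables (X Y Z W : lmodType L) (S : ses P X Y Z) (G : fam X W).

(** Composition with the connecting maps of S, which lower the degree by one, hence zero in degree
    0. They anticommute with the differentials, so [fstep] flips the sign of G. *)
Definition fstep_fun p m : {linear T Z p -> T W m} :=
  match p with 0 => \0%R | p'.+1 => (fm G p' m \o ses_k S p')%FUN end.

Definition fstep : fam Z W.
Proof.
exists fstep_fun (~~ fm_sg G).
- by case=> [|p] m pm x //; rewrite [LHS]fm_low // ltnW.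
- have [b hb] := fm_fin G; exists b.+1 => -[|p] m; rewrite addnS // ltnS => pm x.
  by rewrite [LHS]hb.
- case=> [|p] m x.
    by rewrite [fstep_fun 1 m.+1 x]fm_low // lim0 sg0.
  rewrite [LHS]/= ses_kd limN fm_d [fstep_fun _ _ _]/=.
  by rewrite -[- _]/(sg true _) sg_add addTb.
Defined.

Lemma fpull_step N (f : cocycle (T W) N) : fpull fstep f = cdelta (ses_kd S) (fpull G f).
Proof.
apply: cocycleP => -[|n] x; first by rewrite fpullE big_ord1 cdelta0 cco0.
rewrite fpullE cdeltaS fpullE big_ord_recr /= fm_low // cco0 addr0.
by apply: eq_bigr.
Qed.

Lemma faug_step : faug fstep = cdelta (ses_kd S) (faug G).
Proof. by apply: cocycleP => -[|n] x //; rewrite faugE cdelta0 lim0. Qed.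

End Step.

Lemma fpull_id X N (f : cocycle (T X) N) : fpull (fid X) f = f.
Proof. by rewrite -[RHS]cact1; apply: cocycleP. Qed.

(** Multiplication by (-1)^n in degree n when b is set. The same signs, placed on a family according
    to its target degree, turn anticommutation with the differentials into commutation. *)
Definition tw (Q : complex L) N (b : bool) (f : cocycle Q N) : cocycle Q N.
Proof.
exists (fun n x => sg (b && odd n) (cc f n x)).
- by move=> n a x y; rewrite -sgZ -sgD linearP.
- by have [c hc] := cc_fin f; exists c => n cn x; rewrite hc ?sg0.
- by move=> n x; rewrite cc_d sg0.
Defined.

Section Comparison.
Variables (X : lmodType L) (fgX : fin_gen X) (G : fam X X) (phi : gmap P).

Definition gaug : cocycle (T X) X.
Proof.
exists (fun n x => taug P X (gm (tgm X phi) n 0 x)).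
- by move=> n a x y; rewrite !linearP.
- by have [b hb] := gm_fin (tgm X phi); exists b => n bn x; rewrite hb ?lim0.
- by move=> n x; rewrite gm_d taug_d.
Defined.

(** After the sign correction G becomes a chain map K. Then K and the chain map of phi lift
    cohomologous cocycles along the resolution P (x) X, so they are homotopic. *)
Lemma fam_compare N (f : cocycle (T X) N) : is_coboundary (faug G - gaug) ->
  ext_class (fpull G (tw (fm_sg G) f)) = ext_class (cact f (tgm X phi)) :> ExtM P X N.
Proof.
move=> h; set b := fm_sg G.
pose K_fun p m x := sg (b && odd m) (fm G p m x).
have K_lin p m : linear (@K_fun p m) by move=> a x y; rewrite /K_fun limP sgD sgZ.
have K_low p m : (p < m)%N -> forall x, @K_fun p m x = 0.
  by move=> pm x; rewrite /K_fun fm_low ?sg0.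
have K_fin : exists b, forall p m, (m + b <= p)%N -> forall x, @K_fun p m x = 0.
  by have [c hc] := fm_fin G; exists c => p m pm x; rewrite /K_fun hc ?sg0.
have K_d p m x : K_fun p m (cxd (T X) p x) = cxd (T X) m (K_fun p.+1 m.+1 x).
  rewrite /K_fun fm_d sg_lin sg_add /b; congr (sg _ _).
  by rewrite oddS; case: (fm_sg G); case: (odd m).
pose K := Gmap K_lin K_low K_fin K_d.
(* The correction is trivial in target degree 0, so K lifts [faug G] itself. *)
have lK : @is_lift _ _ (tcx_res P fgX) (faug G) K.
  by move=> n x; rewrite [gm K n 0 x]/(sg (b && false) _) andbF.
have lphi : @is_lift _ _ (tcx_res P fgX) gaug (tgm X phi) by [].
have [s [s0 sS]] := lift_homotopy lK lphi h.
rewrite -[fpull _ _](_ : cact f K = _); last first.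
  apply: cocycleP => n x; rewrite cactE fpullE; apply: eq_bigr => m _.
  by rewrite [gm K n m x]/(sg _ _) cc_sg.
apply/ext_class_eq; apply: (cact_homotopy f (s := fun p m => s p m)) => //.
by move=> p m a x y; rewrite linearP.
Qed.

End Comparison.
End Families.

(** * Shifting a class to an extension *)

Section Submodule.
Variables (R : pzRingType) (V : lmodType R) (W : {pred V}) (W_sub : submod_closed W).

Definition sub_pred : {pred V} := let _ := W_sub in W.
HB.instance Definition _ := GRing.isSubmodClosed.Build R V sub_pred W_sub.

Record submod := Submod { sub_val : V; _ : sub_val \in sub_pred }.
HB.instance Definition _ := [isSub for sub_val].
HB.instance Definition _ := [Choice of submod by <:].
HB.instance Definition _ := [SubChoice_isSubLmodule of submod by <:].

Lemma sub_val_linear : linear sub_val.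
Proof. by move=> a u v; rewrite -[sub_val]/val linearP. Qed.

Definition sub_inj : {linear submod -> V} := linmap sub_val_linear.

Lemma sub_inj_inj : injective sub_inj.
Proof. exact: val_inj. Qed.

Lemma sub_injP (x : submod) : sub_inj x \in W.
Proof. by case: x. Qed.

Lemma sub_inj_surj v : v \in W -> exists x, sub_inj x = v.
Proof. by move=> Wv; exists (@Submod v Wv). Qed.

Lemma sub_lift (U : lmodType R) (f : {linear U -> V}) : (forall u, f u \in W) ->
  exists g : {linear U -> submod}, forall u, sub_inj (g u) = f u.
Proof.
move=> fW; pose g u := @Submod (f u) (fW u).
have lin : linear g by move=> a x y; apply: sub_inj_inj; rewrite limP [LHS]limP.
by exists (linmap lin).
Qed.

End Submodule.

Lemma ker_submod (R : pzRingType) (V X : lmodType R) (f : {linear V -> X}) :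
  submod_closed [pred v | f v == 0].
Proof.
split=> [|a u v]; rewrite !inE ?lim0 // => /eqP u0 /eqP v0.
by rewrite limP u0 v0 scaler0 addr0.
Qed.

Lemma ext_class_comp (R : pzRingType) (Q : complex R) (N : lmodType R) n
    (f g : cocycle Q N) : ext_class f = ext_class g ->
  ext_class (cc_comp n f) = ext_class (cc_comp n g).
Proof. by rewrite -!ext_compE => ->. Qed.

Section Triangles.
Variables (k : fieldType) (L : falgType k) (P : resolution (regbim L)).
Local Notation T := (tcx P).

(* A family G from X to Y of positive degree, shifted down by dimension shifting
   to an extension M of some syzygy of X by Y.  Inverting a positive element of
   HH, the relation rho becomes the map E(X) -> E(M) completing
   E(Y) -> E(X) -> E(M) -> E(Y) to an exact triangle. *)
Record triangle (X Y M N : lmodType L) (i : {linear Y -> M}) (G : fam P X Y)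
    (rho : ExtM P X N -> ExtM P M N -> Prop) : Prop := Triangle {
  tri_sub : forall f e f' e', rho f e -> rho f' e' -> rho (f - f') (e - e');
  tri_act : forall f e x, rho f e -> rho (ext_act f x) (ext_act e x);
  tri_ker : forall e, mstar i e = 0 -> exists f, rho f e;
  tri_def : forall x, positive x ->
    exists n, forall f, exists e, rho (ext_act f (x ^+ n)) e;
  tri_fun : forall x, positive x ->
    exists n, forall e, rho 0 e -> ext_act e (x ^+ n) = 0;
  tri_im : forall f, rho f 0 -> exists g, f = ext_class (fpull G g);
  tri_pull : forall g, rho (ext_class (fpull G g)) 0;
  tri_istar : forall e, ext_class (fpull G (cpull (@tcxm_d _ _ P _ _ i) e)) = 0 :> ExtM P X N
}.

Lemma ext_act0 (M N : lmodType L) (x : HH P) : ext_act (0 : ExtM P M N) x = 0.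
Proof. exact: (add_morph0 (@ext_actDl _ _ P M N x)). Qed.

Lemma deltaB (X Y Z N : lmodType L) (S : ses P X Y Z) :
  {morph @delta _ _ P X Y Z S N : x y / x - y}.
Proof. by move=> x y; rewrite deltaD (add_morphN (@deltaD _ _ _ _ _ _ S N)). Qed.

Lemma mstarB (X Y N : lmodType L) (f : {linear X -> Y}) :
  {morph mstar (P := P) (N := N) f : x y / x - y}.
Proof. by move=> x y; rewrite mstarD (add_morphN (@mstarD _ _ P _ _ N f)). Qed.

Lemma mstar0 (X Y N : lmodType L) (f : {linear X -> Y}) : mstar (P := P) (N := N) f 0 = 0.
Proof. exact: (add_morph0 (@mstarD _ _ P _ _ N f)). Qed.

Lemma delta_class (X Y Z W N : lmodType L) (S : ses P X Y Z) (G : fam P X W)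
    (g : cocycle (T W) N) :
  delta S (ext_class (fpull G g)) = ext_class (fpull (fstep S G) g).
Proof. by rewrite deltaE fpull_step. Qed.

(** In degree 1 nothing has to be inverted: [rho] is the graph of the map induced by the projection
    of M onto X, both exponents are 0, and the pullback along the family is [delta], so the axioms
    are the long exact sequence. *)
Lemma ses_triangle (X Y M N : lmodType L) (S : ses P Y M X) :
  triangle (N := N) (ses_i S) (fstep S (fid P Y)) (fun f e => mstar (ses_q S) f = e).
Proof.
split.
- by move=> f e f' e' <- <-; rewrite mstarB.
- by move=> f e x <-; rewrite mstar_act.
- by move=> e /istar_ker[c ->]; exists c.
- by move=> x _; exists 0%N => f; exists (mstar (ses_q S) f); rewrite expr0 ext_act1.
- by move=> x _; exists 0%N => e <-; rewrite mstar0 ext_act0.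
- move=> f /qstar_ker[c ->]; elim/ext_ind: c => g; exists g.
  by rewrite -delta_class fpull_id.
- by move=> g; rewrite -delta_class qstar_delta.
by move=> e; rewrite -delta_class fpull_id -mstarE delta_istar.
Qed.

(** The kernel of [delta S] is an image of Ext(Q, N) and its cokernel embeds in Ext(Q, N), which
    positive elements kill. So [delta S] can be inverted at the price of one more factor x, whence
    the exponents [n.+1]; the new relation is the old one preceded by that inverse. *)
Lemma step_triangle (X Q Z Y M N : lmodType L) (S : ses P X Q Z) (i : {linear Y -> M})
    (G : fam P X Y) (rho : ExtM P X N -> ExtM P M N -> Prop) :
    projective Q -> fin_gen Q -> triangle i G rho ->
  triangle i (fstep S G) (fun f e => exists c, delta S c = f /\ rho c e).
Proof.
move=> projQ fgQ [r_sub r_act r_ker r_def r_fun r_im r_pull r_istar]; split.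
- move=> f e f' e' [c [<- ce]] [c' [<- ce']]; exists (c - c').
  by rewrite deltaB; split=> //; apply: r_sub.
- move=> f e x [c [<- ce]]; exists (ext_act c x).
  by rewrite delta_act; split=> //; apply: r_act.
- by move=> e /r_ker[c ce]; exists (delta S c), c.
- move=> x xpos; have [n hn] := r_def x xpos; exists n.+1 => f.
  have /qstar_ker[c cE] : mstar (ses_q S) (ext_act f x) = 0.
    by rewrite mstar_act positive_act.
  have [e he] := hn c; exists e, (ext_act c (x ^+ n)).
  by split=> //; rewrite delta_act -cE ext_actA exprS.
- move=> x xpos; have [n hn] := r_fun x xpos; exists n.+1 => e [c [/delta_ker[c' ->] he]].
  rewrite exprS -ext_actA; apply: hn.
  rewrite -(mstar0 N (ses_i S)) -(positive_act c' projQ fgQ xpos) mstar_act.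
  exact: r_act.
- move=> f [c [<- /r_im[g ->]]]; exists g; exact: delta_class.
- by move=> g; exists (ext_class (fpull G g)); rewrite delta_class.
by move=> e; rewrite -delta_class r_istar (add_morph0 (@deltaD _ _ _ _ _ _ S N)).
Qed.

Section Syzygy.
Variable X : lmodType L.

Definition syz : lmodType L := submod (ker_submod (taug P X)).
Definition syz_inj : {linear syz -> T X 0} := sub_inj (ker_submod (taug P X)).

Lemma syz_fin_gen : fin_gen X -> fin_gen syz.
Proof.
move=> fgX.
have [w|f fE] := @sub_lift _ _ _ (ker_submod (taug P X)) _ (cxd (T X) 0).
  by rewrite inE taug_d.
apply: (fin_gen_image (p := f)) (tcx_fin_gen P fgX 1) => w.
have /eqP w0 := sub_injP w; have [v vE] := tcx_exact0 w0; exists v.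
by apply: sub_inj_inj; rewrite fE.
Qed.

Lemma syz_ses : fin_gen X -> exists S : ses P syz (T X 0) X, True.
Proof.
move=> fgX; have [| | | |//|S _] := @ses_exists _ _ P _ _ _ syz_inj (taug P X).
- exact: sub_inj_inj.
- by move=> x; apply/eqP; apply: (sub_injP x).
- by move=> y y0; apply: sub_inj_surj; rewrite inE y0.
- exact: taug_surj.
by exists S.
Qed.

End Syzygy.

(** Dimension shifting: a class of positive degree becomes zero on the projective Q, so it comes
    from X through [delta]. Keeping one component of the preimage makes it homogeneous. *)
Lemma ses_shift (X Q Z Y : lmodType L) (S : ses P X Q Z) n (z : cocycle (T Z) Y) :
    projective Q -> fin_gen Q -> (forall p, p != n.+1 -> forall w, cc z p w = 0) ->
  exists z' : cocycle (T X) Y, (forall p, p != n -> forall w, cc z' p w = 0) /\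
    ext_class (cdelta (ses_kd S) z') = ext_class z.
Proof.
move=> projQ fgQ z0.
have /qstar_ker[c] : mstar (ses_q S) (ext_class z) = 0.
  rewrite mstarE; apply/ext_class_eq0; apply: projective_coboundary => // w.
  by rewrite cpullE z0.
elim/ext_ind: c => f; rewrite deltaE => /(ext_class_comp n.+1) e.
exists (cc_comp n f); split=> [p pn w|]; first by rewrite /= (negbTE pn).
have -> : z = cc_comp n.+1 z.
  by apply: cocycleP => p w /=; case: eqP => // /eqP pn; rewrite z0.
rewrite e; congr ext_class; apply: cocycleP => -[|p] w //.
Qed.

Section Pushout.
Variables (X Y : lmodType L) (z : cocycle (T X) Y).

(** The relations of the pushout of z and the differential on P 1 (x) X, with a plus sign: the
    differential of u is identified with minus z u, which makes the class of the extension z and not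
    its negative. *)
Definition po_pred : {pred (Y * T X 0)%type} :=
  fun v => `[< exists u, v = (cc z 1 u, cxd (T X) 0 u) >].

Lemma po_submod : submod_closed po_pred.
Proof.
split=> [|a u v]; rewrite /in_mem /=.
  by apply/asboolP; exists 0; rewrite cco0 lim0.
move=> /asboolP[u' ->] /asboolP[v' ->]; apply/asboolP; exists (a *: u' + v').
by rewrite limP cc_lin.
Qed.

Definition pushout : lmodType L := quotmod po_submod.

(** Two maps from P 0 (x) X to the pushout lift the augmentation, one through the splitting [ses_s]
    and one through [j]. They differ by a map e into Y, and - e bounds the difference between the
    connecting class and z. *)
Lemma pushout_ses : fin_gen X -> exists S : ses P Y pushout X,
  is_coboundary (faug (fstep S (fid P Y)) - cc_comp 1 z).
Proof.
move=> fgX.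
have i_lin : linear (fun y : Y => (y, 0) : (Y * T X 0)%type).
  by move=> a x y; rewrite /= -[RHS]/(a *: x + y, a *: 0 + 0) scaler0 addr0.
have j_lin : linear (fun w : T X 0 => (0, w) : (Y * T X 0)%type).
  by move=> a x y; rewrite /= -[RHS]/(a *: 0 + 0, a *: x + y) scaler0 addr0.
have s_lin : linear (fun v : (Y * T X 0)%type => taug P X v.2).
  by move=> a x y; rewrite [_.2]/= limP.
pose i : {linear Y -> pushout} := (qmap po_submod \o linmap i_lin)%FUN.
pose j : {linear T X 0 -> pushout} := (qmap po_submod \o linmap j_lin)%FUN.
have [v /asboolP[u ->]|q qE] := @quot_lift _ _ _ po_submod _ (linmap s_lin).
  exact: taug_d.
have pairD y w : linmap i_lin y + linmap j_lin w = (y, w).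
  by transitivity (y + 0, 0 + w) => //; rewrite addr0 add0r.
have qi y : q (i y) = 0 by rewrite [LHS]qE; apply: lim0.
have qj w : q (j w) = taug P X w by rewrite [LHS]qE.
have ji u : j (cxd (T X) 0 u) = - i (cc z 1 u).
  apply/eqP; rewrite -addr_eq0 addrC -[i _ + _](limD (qmap po_submod)).
  apply/eqP/qmap_eq0/asboolP; exists u.
  exact: pairD.
(* An element of Y among the relations is z u with u a cycle; then u is a boundary and z u = 0. *)
have i_inj : injective i.
  move=> x y e; have : i (x - y) = 0 by rewrite limB e subrr.
  move=> /qmap_eq0/asboolP[u [xy /esym u0]]; have [v vE] := tcx_exactS u0.
  by apply/eqP; rewrite -subr_eq0 xy -vE cc_d.
have ij v : exists y w, v = i y + j w.
  have [[y w] <-] := qmap_surj v; exists y, w.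
  rewrite -(limD (qmap po_submod)); congr (qmap _ _).
  exact/esym/pairD.
have ker v : q v = 0 -> exists y, i y = v.
  have [y [w ->]] := ij v; rewrite limD qi qj add0r => /tcx_exact0[u <-].
  by exists (y - cc z 1 u); rewrite ji -limB.
have surj x : exists v, q v = x.
  by have [w <-] := @taug_surj _ _ P X x; exists (j w).
have [S [Si Sq]] := ses_exists P i_inj qi ker surj fgX; exists S.
have e_im w : exists y, i y = taug P pushout (ses_s S 0 w) - j w.
  by apply: ker; rewrite limB qj -taug_tcxm -Sq ses_qs subrr.
pose e w := projT1 (cid (e_im w)).
have eE w : i (e w) = taug P pushout (ses_s S 0 w) - j w := projT2 (cid (e_im w)).
have e_lin : linear (fun w => - e w).
  move=> a x y; suff -> : e (a *: x + y) = a *: e x + e y by rewrite opprD scalerN.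
  apply: i_inj; rewrite limP !eE (limP (ses_s S 0)) (limP (taug P pushout)) (limP j).
  rewrite scalerBr opprD.
  by rewrite addrACA.
split=> [w|].
  by rewrite cc_add cc_opp faugE [cc (cc_comp _ _) _ _]/= subr0; apply: lim0.
exists (fun n => match n with 0 => linmap e_lin | _.+1 => \0%R end) => n w.
rewrite cc_add cc_opp faugE; case: n w => [|n] w; last first.
  transitivity (taug P Y (gm1_fun (Q := T Y) 0 (ses_k S n.+1 w)) - 0); first by [].
  by rewrite gm1_neq // lim0 subr0.
rewrite [cc (cc_comp _ _) _ _]/= -[fm _ 1 0 w]/(gm1_fun (Q := T Y) 0 (ses_k S 0 w)).
rewrite gm1E; apply: i_inj; rewrite -[RHS]/(i (- e _)) limB limN eE.
rewrite -Si -taug_tcxm ses_ik limB taug_d sub0r opprB Si.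
by rewrite [j _]ji addrC.
Qed.

Lemma pushout_fin_gen : fin_gen X -> fin_gen Y -> fin_gen pushout.
Proof.
move=> fgX fgY; have [S _] := pushout_ses fgX.
exact: (fin_gen_extension (@ses_ker _ _ _ _ _ _ S) (@ses_surj _ _ _ _ _ _ S)).
Qed.

End Pushout.

(** The induction replaces X by its syzygy while Y stays fixed, so it is stated for all X. The
    module M is found before N is given. *)
Lemma triangle_exists n (X Y : lmodType L) (z : cocycle (T X) Y) :
    fin_gen X -> fin_gen Y -> (forall p, p != n.+1 -> forall w, cc z p w = 0) ->
  exists (M : lmodType L) (i : {linear Y -> M}) (G : fam P X Y),
    [/\ fin_gen M, injective i, ext_class (faug G) = ext_class z &
        forall N, exists rho : ExtM P X N -> ExtM P M N -> Prop, triangle i G rho].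
Proof.
move=> fgX fgY; elim: n X z fgX => [|n IHn] X z fgX z0.
  have [S SE] := pushout_ses z fgX.
  exists (pushout z), (ses_i S), (fstep S (fid P Y)); split.
  - exact: pushout_fin_gen.
  - exact: ses_inj.
  - rewrite [RHS](_ : _ = ext_class (cc_comp 1 z)); first exact/ext_class_eq.
    congr ext_class; apply: cocycleP => p w /=; case: eqP => // /eqP pn.
    by rewrite z0.
  by move=> N; exists (fun f e => mstar (ses_q S) f = e); apply: ses_triangle.
have [S _] := syz_ses fgX.
have projQ := @tcx_projective _ _ P X fgX 0; have fgQ := @tcx_fin_gen _ _ P X fgX 0.
have [z' [z'0 z'E]] := ses_shift S projQ fgQ z0.
have [M [i [G [fgM i_inj GE tri]]]] := IHn _ z' (syz_fin_gen fgX) z'0.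
exists M, i, (fstep S G); split=> //.
  by rewrite faug_step -deltaE -z'E -deltaE GE.
move=> N; have [rho tri_rho] := tri N.
by exists (fun f e => exists c, delta S c = f /\ rho c e); apply: step_triangle.
Qed.

End Triangles.

(** * Maximal ideals *)

Section MaximalIdeals.
Variables (R : comPzRingType) (m : set R).
Hypothesis m_max : maximal_left_ideal m.

Lemma max_ideal_sum (I : Type) (r : seq I) (F : I -> R) :
  (forall i, m (F i)) -> m (\sum_(i <- r) F i).
Proof.
have [[m0 mD _] _ _] := m_max.
by move=> mF; elim/big_ind: _.
Qed.

Lemma max_ideal_mul x y : m x -> m (x * y).
Proof. by have [[_ _ mM] _ _] := m_max => mx; rewrite mulrC; apply: mM. Qed.

Lemma max_ideal_prime x y : m (x * y) -> m x \/ m y.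
Proof.
have [[m0 mD mM] m1 mmax] := m_max => mxy.
have [mx|nmx] := pselect (m x); [by left | right].
pose J : set R := [set z | exists a b, m b /\ z = a * x + b]%classic.
have J1 : J 1.
  apply: contrapT => nJ1; apply: nmx; rewrite -(mmax J) => //.
  - by exists 1, 0; rewrite mul1r addr0.
  - split.
    + by exists 0, 0; rewrite mul0r addr0.
    + move=> _ _ [a [b [mb ->]]] [a' [b' [mb' ->]]]; exists (a + a'), (b + b').
      by split; [apply: mD | rewrite mulrDl addrACA].
    + move=> c _ [a [b [mb ->]]]; exists (c * a), (c * b).
      by split; [apply: mM | rewrite mulrDr mulrA].
  - by move=> z mz; exists 0, z; rewrite mul0r add0r.
have [a [b [mb e]]] := J1.
rewrite -[y]mul1r e mulrDl -mulrA; apply: mD; first exact: mM.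
exact: max_ideal_mul.
Qed.

Lemma max_ideal_exp x n : m (x ^+ n) -> m x.
Proof.
elim: n => [|n IHn]; last by rewrite exprS => /max_ideal_prime[].
by rewrite expr0; have [] := m_max.
Qed.

(** Nakayama's lemma over the localization at m with denominators cleared: s and a stand for units.
    The last generator is eliminated with the factor s - c, which stays outside m because the
    coefficient c lies in m. *)
Lemma nakayama (E : lmodType R) (r : nat) (g : 'I_r -> E) (s : R) : ~ m s ->
    (forall i, exists c : 'I_r -> R, (forall j, m (c j)) /\ s *: g i = \sum_j c j *: g j) ->
  exists a, ~ m a /\ forall i, a *: g i = 0.
Proof.
have [[m0 mD mM] m1 _] := m_max.
elim: r g s => [|r IHr] g s ns gen; first by exists 1; split=> // -[].
have [c [mc cE]] := gen ord_max.
pose g' (j : 'I_r) := g (widen_ord (leqnSn r) j).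
pose u := s - c ord_max.
have nu : ~ m u by move=> mu; apply: ns; rewrite -[s](subrK (c ord_max)); apply: mD.
have uE : u *: g ord_max = \sum_j c (widen_ord (leqnSn r) j) *: g' j.
  by rewrite scalerBl cE big_ord_recr addrK.
have [|i|a [na ag]] := IHr g' (u * s).
- by case/max_ideal_prime.
- have [b [mb bE]] := gen (widen_ord (leqnSn r) i).
  exists (fun j => u * b (widen_ord (leqnSn r) j)
                   + b ord_max * c (widen_ord (leqnSn r) j)); split.
    by move=> j; apply: mD; apply: mM.
  rewrite -scalerA bE big_ord_recr scalerDr scalerA [u * _]mulrC -scalerA uE.
  rewrite !scaler_sumr -big_split /=; apply: eq_bigr => j _.
  by rewrite scalerDl !scalerA.
exists (a * u); split; first by case/max_ideal_prime.
move=> i; have [->|e] := eqVneq i ord_max.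
  by rewrite -scalerA uE scaler_sumr big1 // => j _; rewrite scalerA mulrC -scalerA ag scaler0.
have ir : (i < r)%N.
  rewrite ltn_neqAle -ltnS ltn_ord andbT; apply: contra e => /eqP e.
  exact/eqP/val_inj.
have -> : i = widen_ord (leqnSn r) (Ordinal ir) by apply: val_inj.
by rewrite mulrC -scalerA ag scaler0.
Qed.

End MaximalIdeals.

(** The last coordinates form an ideal. Subtracting a combination of lifts of its generators leaves
    a vector with last coordinate 0, to which induction applies. *)
Lemma noetherian_submodule (R : pzRingType) (r : nat) (U : ('I_r -> R) -> Prop) :
    noetherian R -> U (fun=> 0) ->
    (forall c d, U c -> U d -> U (fun i => c i + d i)) ->
    (forall a c, U c -> U (fun i => a * c i)) ->
  exists (s : nat) (u : 'I_s -> 'I_r -> R), (forall l, U (u l)) /\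
    forall c, U c -> exists h : 'I_s -> R, forall i, c i = \sum_l h l * u l i.
Proof.
move=> noethR.
elim: r U => [|r IHr] U U0 UD UM.
  exists 0%N, (fun _ _ => 0); split=> [[]|c _] //.
  by exists (fun=> 0) => -[].
have Usum s (h : 'I_s -> R) w : (forall l, U (w l)) -> U (fun i => \sum_l h l * w l i).
  elim: s h w => [|s IHs] h w Uw.
    by rewrite (_ : (fun _ => _) = fun=> 0) //; apply: funext => i; rewrite big_ord0.
  rewrite (_ : (fun _ => _) = fun i => h ord0 * w ord0 i +
     \sum_l h (lift ord0 l) * w (lift ord0 l) i); last first.
    by apply: funext => i; rewrite big_ord_recl.
  apply: UD; first exact: UM.
  exact: (IHs (fun l => h (lift ord0 l)) (fun l => w (lift ord0 l))).
have [|t [x xE]] := noethR [set a | exists2 c, U c & c ord_max = a]%classic.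
  split; first by exists (fun=> 0).
    by move=> a b [c Uc <-] [d Ud <-]; exists (fun i => c i + d i); first exact: UD.
  by move=> a b [c Uc <-]; exists (fun i => a * c i); first exact: UM.
have w_ex l : exists2 c, U c & c ord_max = x l.
  suff : [set a | exists2 c, U c & c ord_max = a]%classic (x l) by [].
  rewrite xE /=; exists (fun j => (j == l)%:R); rewrite (bigD1 l) //= eqxx mul1r.
  by rewrite big1 ?addr0 // => j /negbTE ->; rewrite mul0r.
pose w l := s2val (cid2 (w_ex l)).
have Uw l : U (w l) := s2valP (cid2 (w_ex l)).
have wE l : w l ord_max = x l := s2valP' (cid2 (w_ex l)).
have [|||s [u [Uu uE]]] :=
  IHr (fun c' => exists c, [/\ U c, c ord_max = 0 & c' = fun j => c (lift ord_max j)]).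
- by exists (fun=> 0).
- move=> _ _ [c [Uc c0 ->]] [d [Ud d0 ->]]; exists (fun i => c i + d i).
  by rewrite c0 d0 addr0; split=> //; apply: UD.
- move=> a _ [c [Uc c0 ->]]; exists (fun i => a * c i).
  by rewrite c0 mulr0; split=> //; apply: UM.
pose v l := projT1 (cid (Uu l)).
have vP l : [/\ U (v l), v l ord_max = 0 & u l = fun j => v l (lift ord_max j)] :=
  projT2 (cid (Uu l)).
exists (t + s)%N, (fun l => match split l with inl j => w j | inr j => v j end).
split=> [l|c Uc]; first by case: split => j //; have [] := vP j.
have [h hE] : exists h : 'I_t -> R, c ord_max = \sum_l h l * x l.
  have : [set a | exists2 c, U c & c ord_max = a]%classic (c ord_max) by exists c.
  by rewrite xE => -[h hE]; exists h.
pose d i := c i + (- 1) * \sum_l h l * w l i.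
have d0 : d ord_max = 0.
  by rewrite /d hE mulN1r; apply/eqP; rewrite subr_eq0; apply/eqP/eq_bigr => l _; rewrite wE.
have [|h' h'E] := uE (fun j => d (lift ord_max j)).
  by exists d; split=> //; apply: UD => //; apply: UM; apply: Usum.
exists (fun l => match split l with inl j => h j | inr j => h' j end) => i.
rewrite big_split_ord /=.
under eq_bigr => j _ do rewrite -[lshift _ _]/(unsplit (inl j)) unsplitK.
under [X in _ + X]eq_bigr => j _ do rewrite -[rshift _ _]/(unsplit (inr j)) unsplitK.
have -> : c i = \sum_l h l * w l i + d i by rewrite /d mulN1r addrC subrK.
congr (_ + _); have [j ->|->] := unliftP ord_max i; last first.
  by rewrite d0 big1 // => l _; have [_ -> _] := vP l; rewrite mulr0.
by rewrite h'E; apply: eq_bigr => l _; have [_ _ ->] := vP l.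
Qed.

(** * From M to an extension with smaller variety *)

Section Descent.
Variables (k : fieldType) (L : falgType k) (P : resolution (regbim L)).
Variables (H : comAlgType k) (iota : {lrmorphism H -> HH P}).
Local Notation T := (tcx P).
Local Notation D := (mod_jacobson L).
Local Notation E M := (ext_along iota M D).

Lemma ext_scaleE (M N : lmodType L) (h : H) (e : ext_along iota M N) :
  h *: e = ext_act (e : ExtM P M N) (iota h).
Proof. by []. Qed.

(** Finite generation after inverting y, in a strong form: one exponent N serves all elements. *)
Definition fin_gen_upto (y : H) (V : lmodType H) : Prop :=
  exists (N r : nat) (g : 'I_r -> V), forall e, exists c : 'I_r -> H,
    y ^+ N *: e = \sum_i c i *: g i.

Lemma fin_gen_uptoW y (V : lmodType H) : fin_gen V -> fin_gen_upto y V.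
Proof.
move=> [r [g gen]]; exists 0%N, r, g => e; have [c cE] := gen e.
by exists c; rewrite expr0 scale1r.
Qed.

Definition mstarH (X Y : lmodType L) (f : {linear X -> Y}) : E Y -> E X :=
  mstar (P := P) (N := D) f.

Lemma mstarH_linear (X Y : lmodType L) (f : {linear X -> Y}) : linear (mstarH f).
Proof.
move=> a x y; rewrite [LHS]mstarD; congr (_ + _); exact: mstar_act.
Qed.

Definition mstarL (X Y : lmodType L) (f : {linear X -> Y}) : {linear E Y -> E X} :=
  linmap (mstarH_linear f).

Section Triangle.
Variables (X Y M : lmodType L) (i : {linear Y -> M}) (G : fam P X Y).
Variable rho : ExtM P X D -> ExtM P M D -> Prop.
Hypothesis tri : triangle i G rho.

Lemma rho_scale (h : H) (f : E X) (e : E M) : rho f e -> rho (h *: f) (h *: e).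
Proof. exact: (tri_act tri). Qed.

Lemma rho0 : rho 0 0.
Proof.
have h := tri_pull tri 0.
by have := tri_sub tri h h; rewrite !subrr.
Qed.

Lemma rho_add (f f' : E X) (e e' : E M) : rho f e -> rho f' e' -> rho (f + f') (e + e').
Proof.
move=> h h'; have hN := tri_sub tri rho0 h'; have := tri_sub tri h hN.
by rewrite !sub0r !opprK.
Qed.

Lemma rho_sum r (c : 'I_r -> H) (f : 'I_r -> E X) (e : 'I_r -> E M) :
  (forall j, rho (f j) (e j)) -> rho (\sum_j c j *: f j) (\sum_j c j *: e j).
Proof.
move=> h; elim/big_rec2: _ => [|j u v _ uv]; first exact: rho0.
by apply: rho_add => //; apply: rho_scale.
Qed.

Lemma fin_gen_triangle (y : H) : noetherian H -> positive (iota y) ->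
  fin_gen_upto y (E X) -> fin_gen_upto y (E Y) -> fin_gen_upto y (E M).
Proof.
move=> noethH ypos [n1 [r1 [g1 gen1]]] [n2 [r2 [g2 gen2]]].
(* Noetherianity is applied to coefficient vectors, since E(Y) itself is generated only up to a
   power of y. *)
pose U (c : 'I_r2 -> H) := exists e : E M, mstarL i e = \sum_j c j *: g2 j.
have [|||s [u [Uu uE]]] := @noetherian_submodule _ r2 U noethH.
- exists 0; rewrite big1 => [|j _]; last by rewrite scale0r.
  exact: lim0.
- move=> c d [e eE] [e' e'E]; exists (e + e'); rewrite limD eE e'E.
  by rewrite -big_split /=; apply: eq_bigr => j _; rewrite scalerDl.
- move=> a c [e eE]; exists (a *: e); rewrite limZ eE scaler_sumr.
  by apply: eq_bigr => j _; rewrite scalerA.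
pose e1 l := projT1 (cid (Uu l)).
have e1E l : mstarL i (e1 l) = \sum_j u l j *: g2 j := projT2 (cid (Uu l)).
have [n3 def] := tri_def tri ypos; have [n4 fn] := tri_fun tri ypos.
have yX n (V : lmodType L) (e : E V) : ext_act (e : ExtM P V D) (iota y ^+ n) = y ^+ n *: e.
  by rewrite ext_scaleE rmorphXn.
have e2_ex j : exists e, rho (y ^+ n3 *: g1 j) e.
  by have [e] := def (g1 j); rewrite yX; exists e.
pose e2 j : E M := projT1 (cid (e2_ex j)).
have e2E j : rho (y ^+ n3 *: g1 j) (e2 j) := projT2 (cid (e2_ex j)).
pose N1 := (n3 + n1)%N.
(* The power n2 brings the restriction of e to Y into the span of g2, n1 brings f into the span of
   g1, n3 makes [rho] defined there, and n4 kills the ambiguity of [rho]. *)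
exists (n4 + (N1 + n2))%N, (s + r1)%N, (fun l => match split l with
  inl l => e1 l | inr j => e2 j end) => e.
have [c cE] := gen2 (mstarL i e).
have [|h hE] := uE c.
  by exists (y ^+ n2 *: e); rewrite limZ.
pose e' := y ^+ n2 *: e - \sum_l h l *: e1 l.
have [f fe'] : exists f, rho f e'.
  apply: (tri_ker tri); rewrite -[mstar _ _]/(mstarL i e').
  rewrite limB limZ cE; apply/eqP; rewrite subr_eq0; apply/eqP; rewrite lim_sum.
  under [RHS]eq_bigr => l _ do rewrite limZ e1E scaler_sumr.
  rewrite exchange_big /=; apply: eq_bigr => j _; rewrite hE scaler_suml.
  by apply: eq_bigr => l _; rewrite scalerA.
have [b bE] := gen1 f.
have r1' : rho (y ^+ N1 *: (f : E X)) (y ^+ N1 *: e') by exact: rho_scale.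
have r2' : rho (y ^+ N1 *: (f : E X)) (\sum_j b j *: e2 j).
  rewrite exprD -scalerA bE scaler_sumr.
  rewrite (_ : \sum_i _ = \sum_j b j *: (y ^+ n3 *: g1 j)); first exact: rho_sum.
  by apply: eq_bigr => j _; rewrite !scalerA mulrC.
have := fn _ _; have := tri_sub tri r1' r2'; rewrite subrr => /[swap] /[apply].
rewrite yX scalerBr scalerA -exprD => /eqP; rewrite subr_eq0 => /eqP ye'.
exists (fun l => match split l with
  inl l => y ^+ (n4 + N1) * h l | inr j => y ^+ n4 * b j end).
rewrite big_split_ord /=.
under eq_bigr => j _ do rewrite -[lshift _ _]/(unsplit (inl j)) unsplitK.
under [X in _ + X]eq_bigr => j _ do rewrite -[rshift _ _]/(unsplit (inr j)) unsplitK.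
rewrite addnA exprD -scalerA -[y ^+ n2 *: e](subrK (\sum_l h l *: e1 l)) -/e'.
rewrite scalerDr ye' addrC !scaler_sumr.
by congr (_ + _); apply: eq_bigr => j _; rewrite scalerA.
Qed.

End Triangle.

Section Action.
Variables (M : lmodType L) (n : nat) (eta : H).
Hypotheses (fgM : fin_gen M) (eta_deg : hh_comp n.+1 (iota eta) = iota eta).

Let z := cc_comp n.+1 (ext_repr (iota eta)).
Let phi := Defs.lift z.

Let zE : ext_class z = iota eta.
Proof. by rewrite -eta_deg. Qed.

Lemma eta_gaug p : p != n.+1 -> forall w, cc (gaug M phi) p w = 0.
Proof.
move=> pn; apply: (tens_ext (g := \0)
  (f := taug P M \o (gm (tgm M phi) p 0 : {linear _ -> _}))) => u x.
rewrite [LHS](taug_lift _ _ (liftP _)) -/z /=.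
by rewrite (negbTE pn) scale0r.
Qed.

(** The triangle is built on the cocycle through which eta acts on M, cut down to its component of
    degree n+1. By [fam_compare] its first map is eta up to the twist, so eta annihilates the
    restrictions of E(M') to M because two consecutive maps of the triangle compose to zero. *)
Lemma descent : exists (M' : lmodType L) (i : {linear M -> M'}) (G : fam P M M),
  [/\ fin_gen M', injective i,
      exists rho : ExtM P M D -> ExtM P M' D -> Prop, triangle i G rho,
      forall f : cocycle (T M) D, eta *: (ext_class f : E M) =
        ext_class (fpull G (tw (fm_sg G) f)) &
      forall e : E M', eta *: mstarL i e = 0].
Proof.
have [M' [i [G [fgM' i_inj GE tri]]]] := triangle_exists fgM fgM eta_gaug.
have actE (f : cocycle (T M) D) : eta *: (ext_class f : E M) =
    ext_class (fpull G (tw (fm_sg G) f)).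
  rewrite ext_scaleE -zE (ext_act_class _ (liftP z)); apply/esym/fam_compare => //.
  exact/ext_class_eq.
exists M', i, G; split=> // e.
have [rho trho] := tri D; elim/ext_ind: e => e.
have -> : mstarL i (ext_class e) = ext_class (cpull (@tcxm_d _ _ P _ _ i) e).
  exact: mstarE.
rewrite actE.
have -> : tw (fm_sg G) (cpull (@tcxm_d _ _ P _ _ i) e) =
  cpull (@tcxm_d _ _ P _ _ i) (tw (fm_sg G) e) by exact: cocycleP.
exact: tri_istar trho _.
Qed.

End Action.

Lemma twK (Q : complex L) N b (f : cocycle Q N) : tw b (tw b f) = f.
Proof. by apply: cocycleP => p x; apply: sgK. Qed.

Lemma rmorph_exp (x : H) n : iota (x ^+ n) = iota x ^+ n.
Proof. exact: rmorphXn. Qed.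

Theorem descent_variety (M : lmodType L) n (eta : H) :
    noetherian H -> fin_gen M -> hh_comp n.+1 (iota eta) = iota eta ->
    (forall y, positive (iota y) -> fin_gen_upto y (E M)) ->
  exists (M' : lmodType L) (i : {linear M -> M'}), [/\ fin_gen M', injective i,
    forall y, positive (iota y) -> fin_gen_upto y (E M') &
    forall m y, maximal_left_ideal m -> positive (iota y) -> ~ m y ->
      ((Ann iota M' D `<=` m)%classic <-> (Ann iota M D `<=` m)%classic /\ m eta)].
Proof.
move=> noethH fgM eta_deg fgE.
have [M' [i [G [fgM' i_inj [rho tri] actE eta_i]]]] := descent fgM eta_deg.
exists M', i; split=> //.
  by move=> y ypos; apply: (fin_gen_triangle tri) => //; apply: fgE.
move=> m y m_max ypos my.
have [n1 def] := tri_def tri ypos; have [n2 fn] := tri_fun tri ypos.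
have kill x (e : E M') f : rho f e -> x *: (f : E M) = 0 ->
    (y ^+ n2 * x) *: e = 0.
  move=> fe xf; rewrite -scalerA [LHS]ext_scaleE rmorph_exp; apply: fn.
  by rewrite -xf; apply: rho_scale tri _ _ _ fe.
split=> [sub|[sub meta]].
  split=> [x xM|].
    (* One factor x kills the restriction of e to M, so x e comes from some f; the other kills f. *)
    have : m (y ^+ n2 * x * x).
      apply: sub => e; rewrite -scalerA.
      have [|f fe] := tri_ker tri (e := x *: e).
        by rewrite -[mstar _ _]/(mstarL i _) limZ xM.
      exact: kill fe (xM f).
    by move=> /(max_ideal_prime m_max)[/(max_ideal_prime m_max)[/(max_ideal_exp m_max)|]|].
  (* Here eta e comes from some f, and eta f is in the image of the first map, so [rho] relates 0 to
     the product of eta^2 with e. *)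
  have : m (y ^+ n2 * 1 * eta * eta).
    apply: sub => e; rewrite -!scalerA.
    have [|f fe] := tri_ker tri (e := eta *: e).
      by rewrite -[mstar _ _]/(mstarL i _) limZ eta_i.
    have fe' := rho_scale tri eta fe; rewrite [_ *: (1 *: _)]scalerA.
    apply: (kill 1 _ 0); last by rewrite scaler0.
    rewrite -(subrr (eta *: (f : E M))) -[X in rho _ X]subr0.
    apply: (tri_sub tri fe'); elim/ext_ind: f {fe fe'} => f; rewrite actE.
    exact: tri_pull tri _.
  rewrite mulr1.
  move=> /(max_ideal_prime m_max)[/(max_ideal_prime m_max)[/(max_ideal_exp m_max)|]|] //.
apply: contrapT => nsub.
have [h [hM' mh]] : exists h, Ann iota M' D h /\ ~ m h.
  apply: contrapT => no; apply: nsub => h hM'; apply: contrapT => mh.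
  by apply: no; exists h.
(* As h kills E(M'), the element h y^n1 f is related to 0, hence lies in the image of the first map,
   which is eta E(M). *)
have image (f : E M) : exists g : E M, (h * y ^+ n1) *: f = eta *: g.
  have [e fe] := def f.
  have := rho_scale tri h fe; rewrite hM' => /(tri_im tri)[g gE].
  exists (ext_class (tw (fm_sg G) g)); rewrite actE twK -gE -scalerA.
  by rewrite [y ^+ n1 *: f]ext_scaleE rmorph_exp.
have [N [r [g gen]]] := fgE y ypos.
(* The extra power y^N rewrites the preimages under eta in terms of the g_j, so that s g_j has
   coefficients in eta H, a part of m. *)
pose s := y ^+ N * (h * y ^+ n1).
have ms : ~ m s.
  move=> /(max_ideal_prime m_max)[/(max_ideal_exp m_max)//|].
  by move=> /(max_ideal_prime m_max)[//|/(max_ideal_exp m_max)].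
have [j|a [ma ag]] := nakayama m_max (g := g) ms.
  have [e eE] := image (g j); have [c cE] := gen e.
  exists (fun l => eta * c l); split=> [l|]; first exact: max_ideal_mul.
  rewrite -scalerA eE scalerA mulrC -scalerA cE scaler_sumr.
  by apply: eq_bigr => l _; rewrite scalerA.
have /(max_ideal_prime m_max)[//|/(max_ideal_exp m_max)//] : m (a * y ^+ N).
apply: sub => e; have [c cE] := gen e; rewrite -scalerA cE scaler_sumr.
by rewrite big1 // => j _; rewrite scalerA mulrC -scalerA ag scaler0.
Qed.

End Descent.

(** * Simple modules *)

Section Subspaces.
Variables (k : fieldType) (V : vectType k).

Definition subspace (A : set V) : Prop :=
  A 0 /\ forall c x y, A x -> A y -> A (c *: x + y).

Lemma subspace_vspace A : subspace A -> exists U : {vspace V}, forall x, (x \in U) <-> A x.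
Proof.
move=> [A0 Alin].
pose Q n := `[< exists U : {vspace V}, (forall x, x \in U -> A x) /\ \dim U = n >].
have Qex : exists n, Q n.
  exists 0%N; apply/asboolP; exists 0%VS; rewrite dimv0; split=> // x.
  by rewrite memv0 => /eqP ->.
have Qle n : Q n -> (n <= \dim {:V})%N.
  by move=> /asboolP[U [_ <-]]; apply/dimvS/subvf.
case: (ex_maxnP Qex Qle) => n /asboolP[U [UA Un]] nmax; exists U => x; split=> [|Ax].
  exact: UA.
apply: contrapT => xU.
have UxA y : y \in (<[x]> + U)%VS -> A y.
  by move=> /memv_addP[u /vlineP[c ->] [v vU ->]]; apply: Alin => //; apply: UA.
have : (\dim (<[x]> + U) <= n)%N by apply: nmax; apply/asboolP; exists (<[x]> + U)%VS.
rewrite -Un => le.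
have /eqP UE : U == (<[x]> + U)%VS by rewrite eqEdim addvSr le.
by apply: xU; rewrite UE; apply: (subvP (addvSl _ _)); apply: memv_line.
Qed.

(** Total on sets, with value 0 off subspaces; it only serves to choose extremal members of families
    of subspaces. *)
Definition sdim (A : set V) : nat :=
  if pselect (subspace A) is left h then \dim (projT1 (cid (subspace_vspace h))) else 0%N.

Lemma sdim_lt (A B : set V) : subspace A -> subspace B -> (A `<=` B)%classic -> B <> A ->
  (sdim A < sdim B)%N.
Proof.
rewrite /sdim => hA hB AB ne; case: pselect => // hA'; case: pselect => // hB'.
case: cid => U UE; case: cid => W WE /=.
have UW : (U <= W)%VS by apply/subvP => x /UE/AB/WE.
rewrite ltn_neqAle dimvS // andbT; apply/negP => /eqP e.
have /eqP UWE : U == W by rewrite eqEdim UW e leqnn.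
apply: ne; apply/seteqP; split=> x; first by move/WE; rewrite -UWE => /UE.
by move/UE; rewrite UWE => /WE.
Qed.

Lemma sdim_le A : (sdim A <= \dim {:V})%N.
Proof. by rewrite /sdim; case: pselect => // h; apply/dimvS/subvf. Qed.

Lemma subspace_max (Q : set V -> Prop) : (forall A, Q A -> subspace A) -> (exists A, Q A) ->
  exists A, Q A /\ forall B, Q B -> (A `<=` B)%classic -> B = A.
Proof.
move=> Qs [A0 QA0]; pose q n := `[< exists A, Q A /\ sdim A = n >].
have qex : exists n, q n by exists (sdim A0); apply/asboolP; exists A0.
have qle n : q n -> (n <= \dim {:V})%N by move=> /asboolP[A [_ <-]]; apply: sdim_le.
case: (ex_maxnP qex qle) => n /asboolP[A [QA An]] nmax; exists A; split=> // B QB AB.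
apply: contrapT => ne; have := sdim_lt (Qs _ QA) (Qs _ QB) AB ne.
by rewrite An ltnNge nmax //; apply/asboolP; exists B.
Qed.

Lemma subspace_min (Q : set V -> Prop) : (forall A, Q A -> subspace A) -> (exists A, Q A) ->
  exists A, Q A /\ forall B, Q B -> (B `<=` A)%classic -> B = A.
Proof.
move=> Qs [A0 QA0]; pose q n := `[< exists A, Q A /\ sdim A = n >].
have qex : exists n, q n by exists (sdim A0); apply/asboolP; exists A0.
case: (ex_minnP qex) => n /asboolP[A [QA An]] nmin; exists A; split=> // B QB BA.
apply: contrapT => ne; have := sdim_lt (Qs _ QB) (Qs _ QA) BA (fun e => ne (esym e)).
by rewrite An ltnNge nmin //; apply/asboolP; exists B.
Qed.

End Subspaces.

(** * Left ideals and simple quotients *)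

Section LeftIdeals.
Variables (k : fieldType) (L : falgType k).
Implicit Types (A B m : set L).

Lemma left_ideal_subspace A : left_ideal A -> subspace A.
Proof.
move=> [A0 AD AM]; split=> // c x y Ax Ay; apply: AD => //.
by rewrite -[x]mul1r scalerAl; apply: AM.
Qed.

Lemma left_ideal_sub A x y : left_ideal A -> A x -> A y -> A (x - y).
Proof. by move=> [_ AD AM] Ax Ay; apply: AD => //; rewrite -mulN1r; apply: AM. Qed.

Lemma max_left_ideal_comax m x : maximal_left_ideal m -> ~ m x ->
  exists a b, m b /\ 1 = a * x + b.
Proof.
move=> [hm m1 mmax] mx; have [m0 mD mM] := hm.
pose J : set L := [set z | exists a b, m b /\ z = a * x + b]%classic.
have hJ : left_ideal J.
  split.
  - by exists 0, 0; rewrite mul0r addr0.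
  - move=> _ _ [a [b [mb ->]]] [a' [b' [mb' ->]]]; exists (a + a'), (b + b').
    by split; [apply: mD | rewrite mulrDl addrACA].
  - move=> c _ [a [b [mb ->]]]; exists (c * a), (c * b).
    by split; [apply: mM | rewrite mulrDr mulrA].
apply: contrapT => nJ1; apply: mx; rewrite -(mmax J) //.
  by exists 1, 0; rewrite mul1r addr0.
by move=> z mz; exists 0, z; rewrite mul0r add0r.
Qed.

Lemma max_left_ideal_exists A : left_ideal A -> ~ A 1 ->
  exists m, maximal_left_ideal m /\ (A `<=` m)%classic.
Proof.
move=> hA A1.
have [||m [[hm [Am m1]] mmax]] := @subspace_max _ L
    (fun B => left_ideal B /\ (A `<=` B)%classic /\ ~ B 1).
- by move=> B [/left_ideal_subspace].
- by exists A; split=> //; split.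
exists m; split=> //; split=> // J hJ mJ J1; apply: mmax => //; split=> //.
by split=> // x /Am/mJ.
Qed.

(* In a module of finite length every nonzero vector has a multiple generating a
   simple submodule; here the vector is given by its annihilator A. *)
Lemma simple_multiple A : left_ideal A -> ~ A 1 ->
  exists a, ~ A a /\ maximal_left_ideal [set x | A (x * a)]%classic.
Proof.
move=> hA A1; have [A0 AD AM] := hA.
have [||B [[hB [a Ba Aa]] Bmin]] := @subspace_min _ L
    (fun B => left_ideal B /\ exists2 a, B a & ~ A a).
- by move=> B [/left_ideal_subspace].
- by exists setT; split; [split | exists 1].
exists a; split=> //; split.
- split=> [|x y|c x] /=; rewrite ?mul0r ?mulrDl -?mulrA //; first exact: AD.
  exact: AM.
- by rewrite /= mul1r.
move=> J hJ AJ J1; apply/seteqP; split=> // x Jx /=.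
have [_ JD JM] := hJ; have [B0 BD BM] := hB.
apply: contrapT => Axa.
(* The left ideal generated by x a lies in B and is not contained in A, so by minimality it is all
   of B and contains a. *)
have eB : [set y | exists c, y = c * (x * a)]%classic = B.
  apply: Bmin; last by move=> _ [c ->]; exact/BM/BM.
  split; last by exists (x * a) => //; exists 1; rewrite mul1r.
  split; first by exists 0; rewrite mul0r.
    by move=> _ _ [c ->] [d ->]; exists (c + d); rewrite mulrDl.
  by move=> b _ [c ->]; exists (b * c); rewrite mulrA.
have [c cE] : [set y | exists c, y = c * (x * a)]%classic a by rewrite eB.
apply: J1; rewrite -[1](subrK (c * x)); apply: JD; last exact: JM.
by apply: AJ; rewrite /= mulrBl mul1r -mulrA -cE subrr.
Qed.

Lemma left_ideal_submod A : left_ideal A ->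
  submod_closed ((fun x => `[< A x >]) : {pred L^o}).
Proof.
move=> [A0 AD AM]; split=> [|a x y]; first exact/asboolP.
by move=> /asboolP Ax /asboolP Ay; apply/asboolP; apply: AD => //; apply: AM.
Qed.

Definition lquot A (hA : left_ideal A) : lmodType L := quotmod (left_ideal_submod hA).
Definition lq A (hA : left_ideal A) : {linear L^o -> lquot hA} := qmap (left_ideal_submod hA).

Lemma lq_eq0 A (hA : left_ideal A) x : (lq hA x = 0) <-> A x.
Proof. by rewrite qmap_eq0; split=> [/asboolP|h] //; apply/asboolP. Qed.

Lemma lq_surj A (hA : left_ideal A) y : exists x, lq hA x = y.
Proof. exact: qmap_surj. Qed.

Lemma lq_mul A (hA : left_ideal A) a x : lq hA (a * x) = a *: lq hA x.
Proof. exact: (limZ (lq hA) a x). Qed.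

Lemma regular_fin_gen (R : pzRingType) : fin_gen (R^o).
Proof.
by exists 1%N, (fun=> 1) => v; exists (fun=> v); rewrite big_ord1 [_ *: _]mulr1.
Qed.

Lemma lquot_fin_gen A (hA : left_ideal A) : fin_gen (lquot hA).
Proof. apply: (fin_gen_image (p := lq hA)); [exact: lq_surj | exact: regular_fin_gen]. Qed.

Lemma lquot_simple m (hm : left_ideal m) (s t : lquot hm) : maximal_left_ideal m ->
  s != 0 -> exists a, t = a *: s.
Proof.
move=> mmax'; have [x <-] := lq_surj s; have [y <-] := lq_surj t => xs.
have [m0 mD mM] := hm.
have [|a [b [mb e]]] := max_left_ideal_comax mmax' (x := x).
  by move=> mx; move/eqP: xs; apply; apply/lq_eq0.
exists (y * a); rewrite -lq_mul -[in LHS](mulr1 y) e mulrDr mulrA limD.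
by rewrite (proj2 (lq_eq0 hm (y * b))) ?addr0 //; apply: mM.
Qed.

Lemma nonzero_to_simple (M : lmodType L) : fin_gen M -> (exists x : M, x != 0) ->
  exists (m : set L) (hm : left_ideal m) (f : {linear M -> lquot hm}),
    maximal_left_ideal m /\ exists x, f x != 0.
Proof.
case=> n; elim: n => [|n IHn] [g gen] [x x0].
  by have [c cE] := gen x; move: x0; rewrite cE big_ord0 eqxx.
pose g' j := g (widen_ord (leqnSn n) j).
pose A : set L := [set a | exists c : 'I_n -> L, a *: g ord_max = \sum_j c j *: g' j]%classic.
have hA : left_ideal A.
  split.
  - by exists (fun=> 0); rewrite scale0r big1 // => j _; rewrite scale0r.
  - move=> a b [c cE] [d dE]; exists (fun j => c j + d j).
    by rewrite scalerDl cE dE -big_split; apply: eq_bigr => j _; rewrite scalerDl.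
  - move=> a b [c cE]; exists (fun j => a * c j).
    by rewrite -scalerA cE scaler_sumr; apply: eq_bigr => j _; rewrite scalerA.
have [[c cE]|A1] := pselect (A 1).
  apply: IHn; last by exists x.
  exists g' => v; have [b ->] := gen v.
  exists (fun j => b (widen_ord (leqnSn n) j) + b ord_max * c j).
  rewrite big_ord_recr /= -[g ord_max]scale1r cE scaler_sumr -big_split.
  by apply: eq_bigr => j _; rewrite scalerDl scalerA.
have [m [mmax Am]] := max_left_ideal_exists hA A1.
have [hm m1 _] := mmax.
pose b v := projT1 (cid (gen v)).
have bE v : v = \sum_i b v i *: g i := projT2 (cid (gen v)).
have key v (c : 'I_n.+1 -> L) : v = \sum_i c i *: g i ->
    lq hm (b v ord_max) = lq hm (c ord_max).
  move=> cE; apply/eqP; rewrite -subr_eq0 -limB; apply/eqP/lq_eq0/Am.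
  exists (fun j => c (widen_ord (leqnSn n) j) - b v (widen_ord (leqnSn n) j)).
  have alg (V : zmodType) (p q u w : V) : p + q = u + w -> w - q = p - u.
    by move=> e; apply: (addrI u); rewrite addrA -e addrK addrCA subrr addr0.
  rewrite (eq_bigr _ (fun j _ => scalerBl _ _ _)) sumrB scalerBl; apply: alg.
  by have := bE v; rewrite {1}cE !big_ord_recr.
have f_lin : linear (fun v => lq hm (b v ord_max)).
  move=> a u v; rewrite (key _ (fun i => a * b u i + b v i)) ?limD ?lq_mul //.
  rewrite {1}(bE u) {1}(bE v) scaler_sumr -big_split.
  by apply: eq_bigr => i _; rewrite scalerDl scalerA.
exists m, hm, (linmap f_lin); split=> //; exists (g ord_max).
apply/eqP; rewrite -[linmap _ _]/(lq hm (b (g ord_max) ord_max)).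
rewrite (key _ (fun i => (i == ord_max)%:R)).
  by rewrite eqxx => /lq_eq0.
rewrite (bigD1 ord_max) //= eqxx scale1r big1 ?addr0 // => i /negbTE ->.
by rewrite scale0r.
Qed.

(** For C minimal with C + m = L, the intersection of C and m lies in the radical. Writing 1 = c + b
    with c in C and b in m, right multiplication by c induces a section of the projection of L/rad L
    onto L/m. *)
Lemma lquot_retract m (hm : left_ideal m) : maximal_left_ideal m ->
  exists (p : {linear mod_jacobson L -> lquot hm}) (i : {linear lquot hm -> mod_jacobson L}),
    forall s, p (i s) = s.
Proof.
move=> mmax; have [_ m1 mm] := mmax; have [m0 mD mM] := hm.
have [||C [[hC [c [b [Cc mb cb]]]] Cmin]] := @subspace_min _ L
    (fun C => left_ideal C /\ exists c b, [/\ C c, m b & 1 = c + b]).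
- by move=> C [/left_ideal_subspace].
- by exists setT; split; [split | exists 1, 0; rewrite addr0].
have [C0 CD CM] := hC.
(* If x were outside n, minimality of C would put the intersection of C and n inside m; with 1 = a x
   + d and d in n, both terms of c = c a x + c d would then lie in m. *)
have Cm x : C x -> m x -> forall n, maximal_left_ideal n -> n x.
  move=> Cx mx n nmax; apply: contrapT => nx; have [[n0 nD nM] _ _] := nmax.
  have Cn y : C y -> n y -> m y.
    pose J : set L := [set z | exists y b, [/\ C y, n y, m b & z = y + b]]%classic.
    have hJ : left_ideal J.
      split.
      - by exists 0, 0; rewrite addr0.
      - move=> _ _ [u [v [Cu nu mv ->]]] [u' [v' [Cu' nu' mv' ->]]].
        by exists (u + u'), (v + v'); rewrite addrACA; split; [apply: CD|apply: nD|apply: mD|].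
      - move=> a _ [u [v [Cu nu mv ->]]]; exists (a * u), (a * v).
        by rewrite mulrDr; split; [apply: CM|apply: nM|apply: mM|].
    move=> Cy ny; rewrite -(mm J) //; first by exists y, 0; rewrite addr0.
      by move=> z mz; exists 0, z; rewrite add0r.
    move=> [u [v [Cu nu mv uv]]]; apply: nx.
    suff e : [set z | C z /\ n z]%classic = C by move: Cx; rewrite -e => -[].
    apply: Cmin => [|z []//]; split; last by exists u, v.
    split=> [//|z t [Cz nz] [Ct nt]|e z [Cz nz]].
      by split; [apply: CD | apply: nD].
    by split; [apply: CM | apply: nM].
  have [a [d [nd ad]]] := max_left_ideal_comax nmax nx.
  apply: m1; rewrite cb; apply: (mD) => //.
  rewrite -[c]mulr1 ad mulrDr; apply: (mD); first by rewrite mulrA; apply: mM.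
  apply: Cn; last exact: nM.
  have -> : c * d = c - c * a * x by rewrite -{2}[c]mulr1 ad mulrDr mulrA addrC addKr.
  by apply: left_ideal_sub => //; rewrite -mulrA; apply/CM/CM.
have [x xjac|p pE] := @quot_lift _ _ _ (jacobson_submod L) _ (lq hm).
  by apply/lq_eq0; move/asboolP: xjac; apply.
have f_lin : linear (fun x : L^o => qmap (jacobson_submod L) (x * c)).
  by move=> a x y; rewrite -limP; congr (qmap _ _); rewrite mulrDl -mulrA.
have [x /asboolP mx|i iE] := @quot_lift _ _ _ (left_ideal_submod hm) _ (linmap f_lin).
  apply/qmap_eq0/asboolP; apply: Cm; first exact: CM.
  have -> : x * c = x - x * b by rewrite -{2}[x]mulr1 cb mulrDr addrK.
  by apply: left_ideal_sub => //; apply: mM.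
exists p, i => s; have [x <-] := lq_surj s.
rewrite [i _]iE [LHS]pE -{2}[x]mulr1 cb mulrDr limD.
by rewrite (proj2 (lq_eq0 hm (x * b))) ?addr0 //; apply: mM.
Qed.

End LeftIdeals.

(** * Nilpotency of the annihilator of Ext(L/rad, L/rad) *)

Lemma algebraic_elt (k : fieldType) (L : falgType k) (x : L) :
  exists2 p : {poly k}, p != 0 & horner_alg x p = 0.
Proof.
pose n := (\dim {:L}).+1.
pose X : n.-tuple L := [tuple x ^+ i | i < n].
have nfree : ~ free X.
  move=> /eqP fr; have := dimvS (subvf <<X>>%VS).
  by rewrite fr size_tuple ltnn.
have [c [c0 [i ci]]] : exists c : 'I_n -> k, \sum_i c i *: X`_i = 0 /\ exists i, c i != 0.
  apply: contrapT => no; apply: nfree; apply/freeP => c c0 i; apply/eqP/negPn/negP => ci.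
  by apply: no; exists c; split=> //; exists i.
exists (\poly_(i < n) c (inord i)).
  apply/eqP => p0; move/eqP: ci; apply.
  by rewrite -[LHS]/(c i) -[i]inord_val -(coef0 _ i) -p0 coef_poly ltn_ord.
rewrite poly_def rmorph_sum -[RHS]c0; apply: eq_bigr => i' _.
rewrite -mul_polyC rmorphM /= horner_algC rmorphXn /= horner_algX inord_val.
by rewrite -scalerAl mul1r nth_mktuple.
Qed.

(** * Schur's lemma and density *)

Section Schur.
Variables (k : closedFieldType) (L : falgType k).

(** On L/m, g is right multiplication by some x, a root of a polynomial that splits over k. If g
    were no scalar, every g - c would be injective, and the vanishing product of the x - c could not
    kill the class of 1. *)
Lemma schur (m : set L) (hm : left_ideal m) (g : {linear lquot hm -> lquot hm}) :
  maximal_left_ideal m -> exists c : k, forall s, g s = c%:A *: s.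
Proof.
move=> mmax; have [_ m1 _] := mmax.
apply: contrapT => no.
have inj (c : k) s : s != 0 -> g s - c%:A *: s != 0.
  move=> s0; apply/eqP => /eqP; rewrite subr_eq0 => /eqP gs; apply: no; exists c => t.
  have [a ->] := lquot_simple t mmax s0; rewrite limZ gs !scalerA; congr (_ *: _).
  by rewrite -scalerAr -scalerAl mulr1 mul1r.
have [x xE] := lq_surj (g (lq hm 1)).
have gE a : g (lq hm a) = lq hm (a * x) by rewrite -[in LHS](mulr1 a) !lq_mul limZ xE.
have [p p0 px] := algebraic_elt x.
have [r rE] := closed_field_poly_normal p.
have prod0 : \prod_(c <- r) (x - c%:A) = 0.
  move: px; rewrite rE -mul_polyC rmorphM /= horner_algC rmorph_prod /=.
  move=> /eqP; rewrite -scalerAl mul1r scaler_eq0 lead_coef_eq0 (negbTE p0) /= => /eqP.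
  move=> <-; apply: eq_bigr => c _.
  by rewrite rmorphB /= horner_algX horner_algC.
have : forall a, lq hm a != 0 -> lq hm (a * \prod_(c <- r) (x - c%:A)) != 0.
  elim: r {rE prod0} => [|c r IHr] a a0; first by rewrite big_nil mulr1.
  rewrite big_cons mulrA; apply: IHr; rewrite mulrBr limB -gE.
  have -> : a * c%:A = c%:A * a by rewrite -scalerAr -scalerAl mulr1 mul1r.
  by rewrite lq_mul; apply: inj.
move=> /(_ 1); rewrite prod0 mulr0 lim0 eqxx => h.
by apply: m1; apply/(lq_eq0 hm); apply/eqP/negPn/negP => /h.
Qed.

(** A density theorem. If the last map is nonzero on the common kernel of the others, simplicity
    lets its value be adjusted alone. Otherwise it is a sum of the others composed with
    endomorphisms of L/m, which are scalars, against independence. *)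
Lemma joint_surjective (m : set L) (hm : left_ideal m) (B : lmodType L) :
    maximal_left_ideal m -> forall r (t : 'I_r -> {linear B -> lquot hm}),
    (forall c : 'I_r -> k, (forall x, \sum_j (c j)%:A *: t j x = 0) -> forall j, c j = 0) ->
  forall s : 'I_r -> lquot hm, exists x, forall j, t j x = s j.
Proof.
move=> mmax; elim=> [|r IHr] t ind s; first by exists 0 => -[].
pose t' j := t (widen_ord (leqnSn r) j).
have {}IHr : forall s : 'I_r -> lquot hm, exists x, forall j, t' j x = s j.
  apply: IHr => c c0 j.
  pose c' i := if unlift ord_max i is Some j then c j else 0.
  have wl l : widen_ord (leqnSn r) l = lift ord_max l.
    by apply: val_inj; rewrite /= /bump leqNgt ltn_ord.
  have <- : c' (lift ord_max j) = c j by rewrite /c' liftK.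
  apply: ind => x; rewrite big_ord_recr /= {2}/c' unlift_none scale0r scale0r addr0.
  by rewrite -[RHS](c0 x); apply: eq_bigr => l _; rewrite /t' wl /c' liftK.
have [[x [x0 tx]]|none] := pselect (exists x, (forall j, t' j x = 0) /\ t ord_max x != 0).
  have [y yE] := IHr (fun j => s (widen_ord (leqnSn r) j)).
  have [a aE] := lquot_simple (s ord_max - t ord_max y) mmax tx.
  exists (y + a *: x) => j; rewrite limD limZ.
  have [->|e] := eqVneq j ord_max; first by rewrite -aE addrC subrK.
  have jr : (j < r)%N.
    rewrite ltn_neqAle -ltnS ltn_ord andbT; apply: contra e => /eqP e.
    exact/eqP/val_inj.
  have -> : j = widen_ord (leqnSn r) (Ordinal jr) by apply: val_inj.
  by rewrite -[t _ x]/(t' _ x) x0 scaler0 addr0 -yE.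
have vanish x : (forall j, t' j x = 0) -> t ord_max x = 0.
  by move=> x0; apply: contrapT => /eqP tx; apply: none; exists x.
have ex (j : 'I_r) (s' : lquot hm) :
    exists x, forall l, t' l x = if l == j then s' else 0 by exact: IHr.
pose e j s' := projT1 (cid (ex j s')).
have eE j s' l : t' l (e j s') = if l == j then s' else 0 := projT2 (cid (ex j s')) l.
have key x y : (forall l, t' l x = t' l y) -> t ord_max x = t ord_max y.
  move=> xy; apply/eqP; rewrite -subr_eq0 -limB; apply/eqP/vanish => l.
  by rewrite limB xy subrr.
have g_lin j : linear (fun s' => t ord_max (e j s')).
  move=> a u v; rewrite -limP; apply: key => l; rewrite limP !eE.
  by case: eqP => // _; rewrite scaler0 addr0.
have c_ex j := schur (linmap (g_lin j)) mmax.
pose c j := projT1 (cid (c_ex j)).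
have cE j s' : t ord_max (e j s') = (c j)%:A *: s' := projT2 (cid (c_ex j)) s'.
pose c' i := if unlift ord_max i is Some j then c j else - 1.
have : c' ord_max = 0.
  apply: ind => x; rewrite big_ord_recr /= {2}/c' unlift_none.
  rewrite scaleN1r scaleN1r; apply/eqP; rewrite subr_eq0; apply/eqP.
  have wl l : widen_ord (leqnSn r) l = lift ord_max l.
    by apply: val_inj; rewrite /= /bump leqNgt ltn_ord.
  rewrite (key x (\sum_j e j (t' j x))).
    rewrite lim_sum; apply: eq_bigr => j _.
    by rewrite cE /c' wl liftK /t' wl.
  move=> l; rewrite lim_sum (bigD1 l) //= eE eqxx big1 ?addr0 // => j jl.
  by rewrite eE eq_sym (negbTE jl).
by rewrite /c' unlift_none => /eqP; rewrite oppr_eq0 oner_eq0.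
Qed.

End Schur.

Section Nilpotency.
Variables (k : closedFieldType) (L : falgType k) (P : resolution (regbim L)).
Local Notation T := (tcx P).

Definition two_sided (I : set L) : Prop := left_ideal I /\ forall x a, I x -> I (x * a).

Lemma left_ideal_fin_gen (A : set L) (hA : left_ideal A) :
  fin_gen (submod (left_ideal_submod hA)).
Proof.
have [U UE] := subspace_vspace (left_ideal_subspace hA).
have b_in (i : 'I_(\dim U)) : (vbasis U)`_i \in ((fun x => `[< A x >]) : {pred L^o}).
  apply/asboolP/UE/vbasis_mem/mem_nth; by rewrite size_tuple.
exists (\dim U), (fun i => @Submod _ _ _ (left_ideal_submod hA) _ (b_in i)) => v.
have /asboolP/UE vU := sub_injP v.
exists (fun i => (coord (vbasis U) i (sub_inj _ v : L))%:A).
apply: sub_inj_inj; rewrite lim_sum [LHS](coord_vbasis vU).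
apply: eq_bigr => i _; rewrite limZ; symmetry.
exact: (mulr_algl (coord (vbasis U) i (sub_inj _ v : L)) ((vbasis U)`_i : L)).
Qed.

Section Step.
Variables (I : set L) (hI : left_ideal I).
Hypothesis I_right : forall x a, I x -> I (x * a).
Let B : lmodType L := submod (left_ideal_submod hI).
Let inj : {linear B -> L^o} := sub_inj (left_ideal_submod hI).

Lemma sub_rmul a : exists r : {linear B -> B}, forall x, inj (r x) = (inj x : L) * a.
Proof.
have lin : linear (fun x : B => (inj x : L) * a : L^o).
  by move=> c x y; rewrite limP mulrDl; congr (_ + _); symmetry; apply: mulrA.
have [x|r rE] := @sub_lift _ _ _ (left_ideal_submod hI) _ (linmap lin).
  by apply/asboolP/I_right/asboolP/(sub_injP x).
by exists r.
Qed.

Definition rmul a : {linear B -> B} := projT1 (cid (sub_rmul a)).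
Lemma rmulE a x : inj (rmul a x) = (inj x : L) * a.
Proof. exact: (projT2 (cid (sub_rmul a))). Qed.

Lemma rmulA a b x : rmul a (rmul b x) = rmul (b * a) x.
Proof. by apply: sub_inj_inj; rewrite -/inj !rmulE mulrA. Qed.
Lemma rmulD a b x : rmul (a + b) x = rmul a x + rmul b x.
Proof. by apply: sub_inj_inj; rewrite -/inj limD !rmulE mulrDr. Qed.
Lemma rmul1 x : rmul 1 x = x.
Proof. by apply: sub_inj_inj; rewrite -/inj rmulE mulr1. Qed.
Lemma rmulZ (c : k) a x : rmul (c *: a) x = c%:A *: rmul a x.
Proof.
apply: sub_inj_inj; rewrite -/inj limZ !rmulE -scalerAr.
symmetry; exact: (mulr_algl c ((inj x : L) * a)).
Qed.

Lemma rmul_sum (J : Type) (s : seq J) (c : J -> k) (a : J -> L) x :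
  rmul (\sum_(j <- s) c j *: a j) x = \sum_(j <- s) (c j)%:A *: rmul (a j) x.
Proof.
elim: s => [|j s IHs]; last by rewrite !big_cons rmulD IHs rmulZ.
by rewrite !big_nil -[0 : L](scale0r (0 : L)) rmulZ scale0r scale0r.
Qed.

(* I maps onto Hom_k(L/m', L/m), for suitable m and m', by a map of bimodules
   with kernel J. *)
Lemma ideal_quotient : (exists x, I x /\ x != 0) ->
  exists (m m' : set L) (hm : left_ideal m) (hm' : left_ideal m')
    (t : {linear B -> lquot hm}),
    [/\ maximal_left_ideal m, maximal_left_ideal m', exists x, t x != 0,
        forall a, m' a <-> (forall x, t (rmul a x) = 0) &
        forall g : lquot hm' -> lquot hm, {morph g : u v / u + v} ->
          (forall (c : k) u, g (c%:A *: u) = c%:A *: g u) ->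
          exists x, forall a, t (rmul a x) = g (lq hm' a)].
Proof.
move=> [x0 [Ix0 x0n]].
have [|m [hm [t1 [mmax [y1 t1y]]]]] := nonzero_to_simple (left_ideal_fin_gen hI).
  have [b bE] : exists b : B, inj b = x0 by apply: sub_inj_surj; apply/asboolP.
  exists b; apply: contra x0n => /eqP b0; by rewrite -bE b0 lim0.
pose A1 : set L := [set a | forall x, t1 (rmul a x) = 0]%classic.
have hA1 : left_ideal A1.
  split=> [x|a b ha hb x|a b hb x] /=.
  - by rewrite -[0 : L](scale0r (0 : L)) rmulZ scale0r scale0r lim0.
  - by rewrite rmulD limD ha hb addr0.
  - by rewrite -rmulA hb.
(* Composing t1 with right multiplication by a makes its annihilator for the right action a maximal
   left ideal m'. *)
have [|a [A1a mmax']] := simple_multiple hA1.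
  by move=> /(_ y1); rewrite rmul1 => /eqP; apply/negP.
pose m' : set L := [set x | A1 (x * a)]%classic.
have [hm' m'1 _] : maximal_left_ideal m' := mmax'.
pose t : {linear B -> lquot hm} := (t1 \o rmul a)%FUN.
have tE b x : t (rmul b x) = t1 (rmul (b * a) x) by rewrite -rmulA.
have m'E b : m' b <-> (forall x, t (rmul b x) = 0).
  by split=> h x; [rewrite tE; apply: h | rewrite -tE; apply: h].
exists m, m', hm, hm', t; split=> //.
  apply: contrapT => no; apply: m'1; apply/m'E => x; rewrite rmul1.
  by apply: contrapT => tx; apply: no; exists x; apply/eqP.
move=> g gD gZ.
have [n [e [c [ec ind]]]] := field_dual_basis (kmod_fin_gen (lquot_fin_gen hm')).
pose mu j := projT1 (cid (lq_surj (e j : lquot hm'))).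
have muE j : lq hm' (mu j) = e j := projT2 (cid (lq_surj (e j : lquot hm'))).
(* A relation between the maps sending x to t(x mu_j) would put a combination of the mu_j into m',
   but their classes are a basis of L/m'. *)
have [b b0 j|x xE] := joint_surjective mmax (t := fun j => t \o rmul (mu j))%FUN _
  (fun j => g (e j)).
  apply: ind; rewrite (_ : \sum_i _ = lq hm' (\sum_j b j *: mu j)).
    apply/lq_eq0/m'E => x; rewrite -[RHS](b0 x).
    by rewrite rmul_sum lim_sum; apply: eq_bigr => l _; rewrite limZ.
  rewrite lim_sum; apply: eq_bigr => l _.
  by rewrite -mulr_algl lq_mul muE.
exists x => b.
pose b' := \sum_j (c j (lq hm' b) : k) *: mu j.
have bb' : m' (b - b').
  apply/(lq_eq0 hm'); rewrite limB lim_sum [X in X - _](ec (lq hm' b)).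
  apply/eqP; rewrite subr_eq0; apply/eqP/eq_bigr => j _.
  by rewrite kscaleE -[X in _ = lq _ X]mulr_algl lq_mul muE.
rewrite -(subrK b' b) rmulD limD (proj1 (m'E _) bb') add0r.
rewrite /b' rmul_sum lim_sum subrK [in RHS](ec (lq hm' b)).
have -> := add_morph_sum gD; apply: eq_bigr => j _.
by rewrite limZ gZ; congr (_ *: _); apply: xE.
Qed.

End Step.
End Nilpotency.

(** * Bimodule cocycles with values in Hom_k(L/m', L/m) *)

Section Hat.
Variables (k : closedFieldType) (L : falgType k) (P : resolution (regbim L)).
Local Notation T := (tcx P).
Variables (I : set L) (hI : left_ideal I) (I_right : forall x a, I x -> I (x * a)).
Local Notation B := (submod (left_ideal_submod hI)).
Local Notation inj := (sub_inj (left_ideal_submod hI)).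
Local Notation rmul := (rmul hI I_right).
Variables (m m' : set L) (hm : left_ideal m) (hm' : left_ideal m').
Variable t : {linear B -> lquot hm}.
Hypothesis m'E : forall a, m' a <-> (forall x, t (rmul a x) = 0).
Hypothesis t_surj : forall g : lquot hm' -> lquot hm, {morph g : u v / u + v} ->
  (forall (c : k) u, g (c%:A *: u) = c%:A *: g u) ->
  exists x, forall a, t (rmul a x) = g (lq hm' a).

(** The bimodule map from I to Hom_k(L/m', L/m), uncurried; [m'E] makes it independent of the
    representative of u. *)
Definition pairing (y : B) (u : lquot hm') : lquot hm :=
  t (rmul (projT1 (cid (lq_surj u))) y).

Lemma pairingE y a : pairing y (lq hm' a) = t (rmul a y).
Proof.
rewrite /pairing; case: cid => b bE; rewrite [projT1 _]/= -[b](subrK a) rmulD limD.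
rewrite (proj1 (m'E (b - a))) ?add0r //; apply/(lq_eq0 hm').
by rewrite limB bE subrr.
Qed.

Lemma pairingDl y z u : pairing (y + z) u = pairing y u + pairing z u.
Proof. by rewrite /pairing !limD. Qed.
Lemma pairingDr y u v : pairing y (u + v) = pairing y u + pairing y v.
Proof.
have [a <-] := lq_surj u; have [b <-] := lq_surj v.
by rewrite -limD !pairingE rmulD limD.
Qed.
Lemma pairingZ a y u : pairing (a *: y) u = a *: pairing y u.
Proof. by rewrite /pairing !limZ. Qed.
Lemma pairing_rmul b y u : pairing (rmul b y) u = pairing y (b *: u).
Proof. by have [a <-] := lq_surj u; rewrite -lq_mul !pairingE rmulA. Qed.

Lemma to_sub_ex (v : L) : exists x : B, I v -> inj x = v.
Proof.
have [Iv|nv] := pselect (I v); last by exists 0.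
have [|x xv] := @sub_inj_surj _ _ _ (left_ideal_submod hI) v; first exact/asboolP.
by exists x.
Qed.

Definition to_sub v : B := projT1 (cid (to_sub_ex v)).
Lemma to_subK v : I v -> inj (to_sub v) = v.
Proof. exact: (projT2 (cid (to_sub_ex v))). Qed.

Lemma to_sub_in (x : B) : I (inj x).
Proof. exact/asboolP/(sub_injP x). Qed.

Section HatMap.
Variables (U : lmodType (env L)) (F : {linear U -> regbim L}).
Hypothesis FI : forall p, I (F p).

(** Tensor-hom adjunction: F, followed by the map from I to Hom_k(L/m', L/m), corresponds to a map
    of left modules from U (x) L/m' to L/m. *)
Definition hat_fun (w : tens U (lquot hm')) : lquot hm :=
  tlift (fun p u => pairing (to_sub (F p)) u) w.

Lemma hat_bal : balanced (@ract _ L U) (fun a (u : lquot hm') => a *: u)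
  (fun p u => pairing (to_sub (F p)) u).
Proof.
split=> [p q u|p u v|p a u]; last 1 first.
- rewrite -pairing_rmul; congr pairing; apply: sub_inj_inj.
  by rewrite rmulE !to_subK // ract_linear [LHS]bimactE mul1r.
- rewrite -pairingDl; congr pairing; apply: sub_inj_inj.
  by rewrite (limD inj) !to_subK // limD.
- exact: pairingDr.
Qed.

Lemma hat_linear : linear hat_fun.
Proof.
move=> a v w; rewrite /hat_fun tliftD; last exact: hat_bal.
congr (_ + _); move: v; apply: tensor_ext => [x x'|x x'|p u].
- by rewrite scalerDr tliftD //; apply: hat_bal.
- by rewrite tliftD ?scalerDr //; apply: hat_bal.
rewrite [a *: _]tscaleE !tlift_pure; try exact: hat_bal.
rewrite -pairingZ; congr pairing; apply: sub_inj_inj.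
by rewrite (limZ inj) !to_subK // lact_linear [LHS]bimactE mulr1.
Qed.

Definition hat : {linear tens U (lquot hm') -> lquot hm} := linmap hat_linear.

Lemma hatE p u : hat (pure p u) = pairing (to_sub (F p)) u.
Proof. by rewrite /= /linmap_fun /hat_fun tlift_pure //; apply: hat_bal. Qed.

End HatMap.

(** G is adjoint to a bimodule map from U to Hom_k(L/m', L/m). As U is projective and I maps onto
    this bimodule, it lifts to I; [t_surj] gives the values at a dual basis. *)
Lemma hat_lift (U : lmodType (env L)) (G : {linear tens U (lquot hm') -> lquot hm}) :
    projective U -> fin_gen U ->
  exists F : {linear U -> regbim L}, (forall p, I (F p)) /\
    forall p u, pairing (to_sub (F p)) u = G (pure p u).
Proof.
move=> projU fgU; have [n [e [c ec]]] := projective_dual_basis projU fgU.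
have x_ex i : exists x : B, forall a, t (rmul a x) = G (pure (e i) (lq hm' a)).
  apply: (t_surj (g := fun u => G (pure (e i) u))) => [u v|c' u].
    by rewrite pureDr limD.
  rewrite -limZ pure_tscale -pureA /ract /lact; congr (G (pure (_ *: _) _)).
  by rewrite etensZ.
pose x i := projT1 (cid (x_ex i)).
have xE i a : t (rmul a (x i)) = G (pure (e i) (lq hm' a)) := projT2 (cid (x_ex i)) a.
have F_lin : linear (fun p => \sum_i (c i p : env L) *: (inj (x i) : regbim L)).
  move=> a p q; rewrite scaler_sumr -big_split; apply: eq_bigr => i _ /=.
  by rewrite linearP scalerDl scalerA.
have actI w y : I y -> I (w *: (y : regbim L)).
  have [I0 ID IM] := hI => Iy; elim/tensor_ind: w => [|a b|v w Iv Iw].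
  - by rewrite scale0r.
  - by rewrite [_ *: _]bimactE; apply/I_right/IM.
  - by rewrite scalerDl; apply: ID.
have FI p : I (linmap F_lin p).
  have [I0 ID _] := hI; rewrite /= /linmap_fun; elim/big_ind: _ => // i _.
  exact/actI/to_sub_in.
exists (linmap F_lin); split=> // p u; have [a <-] := lq_surj u.
have key w y i : I y -> (forall a, t (rmul a (to_sub y)) = G (pure (e i) (lq hm' a))) ->
    t (rmul a (to_sub (w *: (y : regbim L)))) = G (pure (w *: e i) (lq hm' a)).
  move=> Iy yE; have [I0 ID IM] := hI; elim/tensor_ind: w => [|b d|v w IHv IHw].
  - rewrite !scale0r pure0l lim0 -[RHS](lim0 t); congr (t _); apply: sub_inj_inj.
    by rewrite rmulE to_subK // mul0r lim0.
  - rewrite [_ *: (y : regbim L)]bimactE -[tpure _ _ b d]/(etens b d) etens_act.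
    rewrite -pure_tscale pureA -lq_mul limZ -yE -limZ; congr (t _); apply: sub_inj_inj.
    rewrite limZ !rmulE !to_subK //; last exact/I_right/IM.
    by rewrite -!mulrA.
  - rewrite !scalerDl pureDl limD -IHv -IHw -limD; congr (t _); apply: sub_inj_inj.
    rewrite limD !rmulE !to_subK ?mulrDl //; try exact: actI.
    by apply: ID; apply: actI.
rewrite pairingE {2}(ec p) pure_sum_left lim_sum.
have -> : rmul a (to_sub (linmap F_lin p)) =
    \sum_i rmul a (to_sub ((c i p : env L) *: (inj (x i) : regbim L))).
  apply: sub_inj_inj; rewrite lim_sum rmulE to_subK // mulr_suml.
  apply: eq_bigr => i _; rewrite rmulE to_subK //; exact/actI/to_sub_in.
rewrite lim_sum; apply: eq_bigr => i _; apply: key; first exact: to_sub_in.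
move=> b; rewrite -xE; congr (t (rmul _ _)); apply: sub_inj_inj.
by rewrite to_subK //; apply: to_sub_in.
Qed.

Lemma pairing_zero u : pairing (to_sub 0) u = 0.
Proof.
have [I0 _ _] := hI.
have -> : to_sub 0 = 0 by apply: sub_inj_inj; rewrite to_subK ?lim0.
by rewrite -(scale0r 0) pairingZ scale0r.
Qed.

Definition hat_cocycle (f : cocycle P (regbim L)) (fI : forall n p, I (cc f n p)) :
  cocycle (T (lquot hm')) (lquot hm).
Proof.
exists (fun n w => hat (fI n : forall p, I ((cc f n : {linear _ -> _}) p)) w).
- by move=> n; apply: linearP.
- have [b hb] := cc_fin f; exists b => n bn.
  apply: (tens_ext (g := \0) (f := hat (fI n : forall p, I ((cc f n : {linear _ -> _}) p)))).
  move=> p u; transitivity (pairing (to_sub (cc f n p)) u); first exact: hatE.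
  by rewrite hb ?pairing_zero.
- move=> n; apply: (tens_ext (g := \0)
    (f := hat (fI n : forall p, I ((cc f n : {linear _ -> _}) p)) \o tmap _ (cxd P n))).
  move=> p u; transitivity (pairing (to_sub (cc f n (cxd P n p))) u).
    rewrite -[LHS]/(hat (fI n : forall p, I ((cc f n : {linear _ -> _}) p))
      (tmap _ (cxd P n) (pure p u))) tmapE.
    exact: hatE.
  by rewrite cc_d pairing_zero.
Defined.

Lemma hat_cocycleE f fI n p u :
  cc (@hat_cocycle f fI) n (pure p u) = pairing (to_sub (cc f n p)) u.
Proof.
exact: (hatE (fI n : forall p, I ((cc f n : {linear _ -> _}) p))).
Qed.

(** The adjoint of f is a cocycle for Ext(L/m', L/m), so its product with x is bounded by some g.
    Lifting g to a map G into I and subtracting [G \o d] from the product of f with the chain map of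
    x leaves the class unchanged and moves the values into the kernel of the map from I to
    Hom_k(L/m', L/m). *)
Lemma hat_step (x : HH P) (f : cocycle P (regbim L)) : (forall n p, I (cc f n p)) ->
    (forall e : ExtM P (lquot hm') (lquot hm), ext_act e x = 0) ->
  exists f1 : cocycle P (regbim L),
    (forall n p, I (cc f1 n p) /\ forall a, t (rmul a (to_sub (cc f1 n p))) = 0) /\
    (ext_class f : HH P) * x = ext_class f1.
Proof.
move=> fI kill; have [I0 ID IM] := hI.
elim/ext_ind: x kill => z kill; pose phi := Defs.lift z.
have := kill (ext_class (hat_cocycle fI)).
rewrite (ext_act_class _ (liftP z)) => /ext_class_eq0/coboundary_fin[h0 [g [[b hb] gE]]].
have G_ex n := hat_lift (g n) (@res_proj _ _ P n) (@res_fg _ _ P n).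
(* From degree b on, where g vanishes, zero is also a lift, and it keeps f1 finitely supported. *)
pose G n : {linear P n -> regbim L} := if (n < b)%N then projT1 (cid (G_ex n)) else \0%R.
have GI n p : I (G n p).
  by rewrite /G; case: ifP => // _; case: cid => F [FI FE] /=.
have GE n p u : pairing (to_sub (G n p)) u = g n (pure p u).
  rewrite /G; case: ltnP => [_|bn]; first by case: cid => F [FI FE] /=.
  by rewrite hb //; apply: pairing_zero.
pose c := cact f phi.
have cI n p : I (cc c n p) by rewrite cactE; elim/big_ind: _ => // i _.
pose f1_fun n : {linear P n -> regbim L} := match n with
  0 => cc c 0 | n'.+1 => ((cc c n'.+1 : {linear _ -> _}) \- (G n' \o cxd P n'))%R end.
have f1S n p : f1_fun n.+1 p = cc c n.+1 p - G n (cxd P n p) by [].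
have f1_lin n : linear (f1_fun n) by exact: linearP.
have f1_fin : exists b, forall n, (b <= n)%N -> forall p, f1_fun n p = 0.
  have [d hd] := cc_fin c; exists (maxn b d).+1 => -[|n] //.
  rewrite ltnS geq_max => /andP[bn dn] p.
  by rewrite f1S hd ?leqW // /G ltnNge bn /= subr0.
have f1_d n p : f1_fun n (cxd P n p) = 0.
  by case: n p => [|n] p; [exact: cc_d | rewrite f1S cc_d cxdd lim0 subr0].
have f1I n p : I (f1_fun n p).
  by case: n p => [|n] p; [exact: cI | rewrite f1S; apply: left_ideal_sub].
exists (Cocycle f1_lin f1_fin f1_d); split=> [n p|].
  split=> [|a]; first exact: f1I.
  rewrite -pairingE -[cc _ _ _]/(f1_fun n p).
  have cE q v : pairing (to_sub (cc c n q)) v =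
      cc (cact (hat_cocycle fI) (tgm _ phi)) n (pure q v).
    transitivity (\sum_(i < n.+1) pairing (to_sub (cc f i (gm phi n i q))) v); last first.
      rewrite cactE; apply: eq_bigr => i _.
      by rewrite [gm (tgm _ _) _ _ _]tmapE hat_cocycleE.
    have -> : to_sub (cc c n q) =
        \sum_(i < n.+1) to_sub (cc f i (gm phi n i q)).
      apply: sub_inj_inj; rewrite lim_sum to_subK // [LHS]cactE.
      by apply: eq_bigr => i _; rewrite to_subK.
    by apply: (big_morph (pairing^~ v)) => [y y'|];
      [apply: pairingDl | rewrite -(scale0r 0) pairingZ scale0r].
  case: n p cE => [|n] p cE; first by rewrite [f1_fun 0 p]/(cc c 0 p) cE h0.
  rewrite f1S.
  have -> : to_sub (cc c n.+1 p - G n (cxd P n p)) =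
      to_sub (cc c n.+1 p) + (-1) *: to_sub (G n (cxd P n p)).
    apply: sub_inj_inj; rewrite scaleN1r limB !to_subK //.
    by apply: left_ideal_sub.
  rewrite pairingDl pairingZ scaleN1r cE gE GE.
  by apply/eqP; rewrite subr_eq0; apply/eqP; congr (g n _); rewrite [LHS]tmapE.
rewrite [_ * _](yoneda_class f (liftP z)) -/phi -/c; apply/ext_class_eq; split=> [p|].
  by rewrite cc_add cc_opp subrr.
exists G => n p; rewrite cc_add cc_opp -[X in _ - X]/(f1_fun n.+1 p) f1S.
by rewrite opprB addrC subrK.
Qed.

End Hat.

Section PostCompose.
Variables (R : pzRingType) (Q : complex R) (N N' : lmodType R) (h : {linear N -> N'}).

Definition cpost (f : cocycle Q N) : cocycle Q N'.
Proof.
exists (fun n x => h (cc f n x)).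
- by move=> n a x y; rewrite cc_lin limP.
- by have [b hb] := cc_fin f; exists b => n bn x; rewrite hb ?lim0.
- by move=> n x; rewrite cc_d lim0.
Defined.

Lemma cpost_coboundary f : is_coboundary f -> is_coboundary (cpost f).
Proof.
case=> f0 [g gE]; split=> [x|]; first by rewrite /= f0 lim0.
by exists (fun n => h \o g n)%FUN => n x; rewrite /= gE.
Qed.

End PostCompose.

Section AnnNilpotent.
Variables (k : closedFieldType) (L : falgType k) (P : resolution (regbim L)).
Local Notation T := (tcx P).
Local Notation D := (mod_jacobson L).

(** Ext(X', Y') is a summand of Ext(X, Y) compatibly with the action: p and j carry a cocycle over,
    i and q bring it back. *)
Lemma retract_kill (x : HH P) (X Y X' Y' : lmodType L)
    (p : {linear X -> X'}) (i : {linear X' -> X})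
    (q : {linear Y -> Y'}) (j : {linear Y' -> Y}) :
    (forall u, p (i u) = u) -> (forall u, q (j u) = u) ->
    (forall e : ExtM P X Y, ext_act e x = 0) ->
  forall e : ExtM P X' Y', ext_act e x = 0.
Proof.
move=> pi qj kill; elim/ext_ind=> f; elim/ext_ind: x kill => z kill.
pose f' : cocycle (T X) Y := cpost j (cpull (@tcxm_d _ _ P _ _ p) f).
have := kill (ext_class f'); rewrite !(ext_act_class _ (liftP z)).
move=> /ext_class_eq0/(cpost_coboundary q)/(proj2 (cpull_compat _ (@tcxm_d _ _ P _ _ i))) h.
apply/ext_class_eq0; congr is_coboundary: h; apply: cocycleP => n w.
rewrite cpullE -[LHS]/(q (cc (cact f' (tgm X (Defs.lift z))) n (tcxm P i n w))).
rewrite !cactE lim_sum; apply: eq_bigr => m _.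
rewrite -[cc f' _ _]/(j (cc f m (tcxm P p m _))) qj -tcxm_tgm; congr (cc f m _).
exact: tmapr_inverse.
Qed.

Lemma ann_nilpotent (x : HH P) : (forall e : ExtM P D D, ext_act e x = 0) ->
  exists N, x ^+ N = 0.
Proof.
move=> kill.
have kill_simple (m m' : set L) (hm : left_ideal m) (hm' : left_ideal m') :
    maximal_left_ideal m -> maximal_left_ideal m' ->
    forall e : ExtM P (lquot hm') (lquot hm), ext_act e x = 0.
  move=> mmax mmax'; have [p [i pi]] := lquot_retract hm' mmax'.
  by have [q [j qj]] := lquot_retract hm mmax; apply: retract_kill pi qj kill.
(* The exponent must not depend on f, since one step replaces f by a cocycle with values in a
   smaller ideal. A minimal bad ideal takes the place of a filtration. *)
pose good (I : set L) := exists N, forall f : cocycle P (regbim L),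
  (forall n p, I (cc f n p)) -> (ext_class f : HH P) * x ^+ N = 0.
suff [N NE] : good setT.
  by exists N; rewrite -[LHS]mul1r -[1]/(ext_class (ext_one P) : HH P) NE.
apply: contrapT => bad.
have [||I [[[hI I_right] badI] Imin]] := @subspace_min _ L
    (fun I => two_sided I /\ ~ good I).
- by move=> I [[/left_ideal_subspace]].
- by exists setT; split.
apply: badI; have [I0 ID IM] := hI.
have [nz|z] := pselect (exists y, I y /\ y != 0); last first.
  exists 0%N => f fI; rewrite expr0 mulr1.
  apply/ext_class_eq0; have -> : f = 0; last exact/ext_class_eq0/ext_class0.
  apply: cocycleP => n p; rewrite cc_zero; apply: contrapT => /eqP fp.
  by apply: z; exists (cc f n p); split.
have [m [m' [hm [hm' [t [mmax mmax' [y ty] m'E t_surj]]]]]] :=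
  ideal_quotient hI I_right nz.
pose inj := sub_inj (left_ideal_submod hI).
have sub_inE v : I (inj v) by exact/asboolP/(sub_injP v).
pose J : set L := [set v | I v /\
  forall a, t (rmul hI I_right a (to_sub hI v)) = 0]%classic.
have J_eq v w : inj w = v -> (forall a, t (rmul hI I_right a w) = 0) -> J v.
  move=> <- tw; split=> // a; rewrite -[RHS](tw a); congr (t (rmul _ _ _ _)).
  by apply: sub_inj_inj; rewrite to_subK.
have hJ : left_ideal J.
  split.
  - by apply: (J_eq _ 0) => [|a]; rewrite !lim0.
  - move=> u v [Iu tu] [Iv tv]; apply: (J_eq _ (to_sub hI u + to_sub hI v)) => [|a].
      by rewrite limD !to_subK.
    by rewrite !limD tu tv addr0.
  - move=> a v [Iv tv]; apply: (J_eq _ (a *: to_sub hI v)) => [|b].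
      by rewrite limZ to_subK.
    by rewrite !limZ tv scaler0.
have J_right v a : J v -> J (v * a).
  move=> [Iv tv]; apply: (J_eq _ (rmul hI I_right a (to_sub hI v))) => [|b].
    by rewrite rmulE to_subK.
  by rewrite rmulA.
(* J is strictly smaller than I because t does not vanish on y. *)
have [N NE] : good J.
  apply: contrapT => badJ.
  have JI : J = I by apply: Imin => [|v []].
  have [_ /(_ 1)] : J (inj y) by rewrite JI.
  rewrite rmul1 => ty0; move/eqP: ty; apply; rewrite -[RHS]ty0; congr (t _).
  by apply: sub_inj_inj; rewrite to_subK.
exists N.+1 => f fI.
have [f1 [f1J f1E]] := hat_step m'E t_surj fI (kill_simple _ _ _ _ mmax mmax').
by rewrite exprS mulrA f1E NE.
Qed.

End AnnNilpotent.

(** * Central elements *)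

Section Corner.
Variables (k : fieldType) (L : falgType k) (e : L).
Hypotheses (e_central : forall x, e * x = x * e) (e_idem : e * e = e) (e_neq0 : e != 0).

Lemma corner_submod : submod_closed ([pred x | e * x == x] : {pred L}).
Proof.
split=> [|a x y]; rewrite !inE ?mulr0 // => /eqP ex /eqP ey.
by rewrite mulrDr -scalerAr ex ey.
Qed.

(** The algebra e L with unit e. The hypotheses are mentioned in the body because the ring structure
    attached to this type depends on them. *)
Definition corner : Type :=
  let _ := (e_central, e_idem, e_neq0) in submod corner_submod.
HB.instance Definition _ := GRing.Lmodule.copy corner (submod corner_submod).

Lemma corner_in x : e * x \in ([pred x | e * x == x] : {pred L}).
Proof. by rewrite inE mulrA e_idem. Qed.

Definition to_corner x : corner := @Submod _ _ _ corner_submod (e * x) (corner_in x).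
Definition of_corner (x : corner) : L := sub_val x.

Lemma of_cornerK x : e * of_corner x = of_corner x.
Proof. by case: x => x xe; apply/eqP. Qed.
Lemma of_corner_inj : injective of_corner.
Proof. exact: (@sub_inj_inj _ _ _ corner_submod). Qed.
Lemma of_cornerD x y : of_corner (x + y) = of_corner x + of_corner y.
Proof. exact: (limD (sub_inj corner_submod)). Qed.
Lemma of_cornerZ a x : of_corner (a *: x) = a *: of_corner x.
Proof. exact: (limZ (sub_inj corner_submod)). Qed.
Lemma to_cornerK x : of_corner (to_corner x) = e * x.
Proof. by []. Qed.
Definition corner_mul x y := to_corner (of_corner x * of_corner y).
Lemma corner_mulE x y : of_corner (corner_mul x y) = of_corner x * of_corner y.
Proof. by rewrite to_cornerK mulrA of_cornerK. Qed.
Lemma corner_mulA : associative corner_mul.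
Proof. by move=> x y z; apply: of_corner_inj; rewrite !corner_mulE mulrA. Qed.
Lemma corner_mul1 : left_id (to_corner 1) corner_mul.
Proof. by move=> x; apply: of_corner_inj; rewrite corner_mulE to_cornerK mulr1 of_cornerK. Qed.
Lemma corner_mulx1 : right_id (to_corner 1) corner_mul.
Proof.
move=> x; apply: of_corner_inj.
by rewrite corner_mulE to_cornerK mulr1 -e_central of_cornerK.
Qed.
Lemma corner_mulDl : left_distributive corner_mul +%R.
Proof.
move=> x y z; apply: of_corner_inj.
by rewrite of_cornerD !corner_mulE of_cornerD mulrDl.
Qed.
Lemma corner_mulDr : right_distributive corner_mul +%R.
Proof.
move=> x y z; apply: of_corner_inj.
by rewrite of_cornerD !corner_mulE of_cornerD mulrDr.
Qed.
Lemma corner_one_neq0 : to_corner 1 != 0.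
Proof.
apply/eqP => /(congr1 of_corner); rewrite to_cornerK mulr1.
by rewrite [of_corner 0](lim0 (sub_inj corner_submod)); apply/eqP.
Qed.
HB.instance Definition _ := GRing.Zmodule_isNzRing.Build corner
  corner_mulA corner_mul1 corner_mulx1 corner_mulDl corner_mulDr corner_one_neq0.
Lemma of_cornerM x y : of_corner (x * y) = of_corner x * of_corner y.
Proof. exact: corner_mulE. Qed.
Lemma corner_scaleAl (c : k) (x y : corner) : c *: (x * y) = (c *: x) * y.
Proof.
by apply: of_corner_inj; rewrite of_cornerZ !of_cornerM of_cornerZ scalerAl.
Qed.
HB.instance Definition _ := GRing.Lmodule_isLalgebra.Build k corner corner_scaleAl.
Lemma corner_scaleAr (c : k) (x y : corner) : c *: (x * y) = x * (c *: y).
Proof.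
by apply: of_corner_inj; rewrite of_cornerZ !of_cornerM of_cornerZ scalerAr.
Qed.
HB.instance Definition _ := GRing.Lalgebra_isAlgebra.Build k corner corner_scaleAr.

Lemma to_corner_linear : linear to_corner.
Proof.
move=> a x y; apply: of_corner_inj.
by rewrite of_cornerD of_cornerZ !to_cornerK mulrDr scalerAr.
Qed.

Lemma to_corner_mul : monoid_morphism to_corner.
Proof.
split=> // x y; apply: of_corner_inj; rewrite of_cornerM !to_cornerK.
by rewrite !mulrA -(e_central (e * x)) !mulrA e_idem.
Qed.

End Corner.

Section CentralElements.
Variables (k : fieldType) (L : falgType k).
Hypothesis L_indec : indecomposable L.

Section Decomposition.
Variable e : L.
Hypotheses (e_central : forall x, e * x = x * e) (e_idem : e * e = e)
  (e_neq0 : e != 0) (e_neq1 : 1 - e != 0).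

Lemma compl_central x : (1 - e) * x = x * (1 - e).
Proof. by rewrite mulrBl mulrBr e_central mul1r mulr1. Qed.
Lemma compl_idem : (1 - e) * (1 - e) = 1 - e.
Proof. by rewrite mulrBl mul1r mulrBr mulr1 e_idem subrr subr0. Qed.

Let A : algType k := corner e_central e_idem e_neq0.
Let B : algType k := corner compl_central compl_idem e_neq1.

Definition decomp (x : L) : (A * B)%type := (to_corner _ _ _ x, to_corner _ _ _ x).

Lemma decomp_linear : linear decomp.
Proof. by move=> a x y; rewrite /decomp !to_corner_linear. Qed.
HB.instance Definition _ := GRing.isLinear.Build k L (A * B)%type *:%R decomp decomp_linear.

Lemma decomp_mul : monoid_morphism decomp.
Proof.
split=> [|x y]; first by [].
rewrite /decomp (snd (to_corner_mul e_central e_idem e_neq0)).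
by rewrite (snd (to_corner_mul compl_central compl_idem e_neq1)).
Qed.
HB.instance Definition _ := GRing.isMonoidMorphism.Build L (A * B)%type decomp decomp_mul.

Lemma decomp_bij : bijective decomp.
Proof.
exists (fun u => of_corner u.1 + of_corner u.2) => [x|[a b]].
  by rewrite !to_cornerK -mulrDl addrC subrK mul1r.
have ea : (1 - e) * of_corner a = 0.
  by rewrite -[of_corner a]of_cornerK mulrA mulrBl mul1r e_idem subrr mul0r.
have eb : e * of_corner b = 0.
  by rewrite -[of_corner b]of_cornerK mulrA mulrBr mulr1 e_idem subrr mul0r.
congr (_, _); apply: of_corner_inj; rewrite to_cornerK mulrDr.
  by rewrite of_cornerK eb addr0.
by rewrite of_cornerK ea add0r.
Qed.

Lemma no_decomposition : False.
Proof. exact: (L_indec (f := decomp) decomp_bij). Qed.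

End Decomposition.

(* Fitting's lemma for the multiplication by a central element. *)
Lemma central_nilpotent_or_unit (z : L) : (forall x, z * x = x * z) ->
  (exists n, z ^+ n = 0) \/ (exists w, z * w = 1).
Proof.
move=> zc.
have zXc n x : z ^+ n * x = x * z ^+ n by symmetry; apply: commrX; symmetry; apply: zc.
have [n [b nb]] : exists n b, z ^+ n.+1 = z ^+ n.+1 * (z * b).
  have [||A [[n ->] Amin]] := @subspace_min _ L
      (fun A => exists n, A = [set x | exists b, x = z ^+ n * b]%classic).
  - move=> _ [n ->]; split; first by exists 0; rewrite mulr0.
    by move=> c _ _ [x ->] [y ->]; exists (c *: x + y); rewrite mulrDr scalerAr.
  - by exists setT, 0%N; apply/seteqP; split=> // x _; exists x; rewrite mul1r.
  have e : [set x | exists b, x = z ^+ n.+1 * b]%classic =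
      [set x | exists b, x = z ^+ n * b]%classic.
    by apply: Amin; [exists n.+1 | move=> _ [b ->]; exists (z * b); rewrite exprSr mulrA].
  have [b bE] : [set x | exists b, x = z ^+ n.+1 * b]%classic (z ^+ n).
    by rewrite e; exists 1; rewrite mulr1.
  by exists n, b; rewrite {1}exprS {1}bE mulrA -zXc -mulrA.
(* The image of z^(n+1) is stable, and e is the idempotent generating it. *)
pose a := b ^+ n.+1; pose e := z ^+ n.+1 * a.
have ze : z ^+ n.+1 * e = z ^+ n.+1.
  have zb j : z ^+ n.+1 = z ^+ n.+1 * (z * b) ^+ j.
    by elim: j => [|j IHj]; rewrite ?mulr1 // [(z * b) ^+ _]exprS mulrA -nb.
  by rewrite /e /a -exprMn_comm -?zb //; apply: zc.
have e_idem : e * e = e by rewrite {1}/e zXc -mulrA ze -zXc.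
have [e0|e0] := eqVneq e 0; first by left; exists n.+1; rewrite -ze e0 mulr0.
have [e1|e1] := eqVneq (1 - e) 0.
  right; exists (z ^+ n * a); rewrite mulrA -exprS -/e.
  by apply/eqP; rewrite eq_sym -subr_eq0 e1.
(* Although b is arbitrary, e is central: both e x and x e equal e x e. *)
have ec x : e * x = x * e.
  have ey y : e * y = a * y * z ^+ n.+1 by rewrite -zXc mulrA.
  have ye y : y * e = z ^+ n.+1 * (y * a) by rewrite /e !mulrA zXc.
  transitivity (e * x * e); first by rewrite (ey x) -!mulrA ze.
  by rewrite -mulrA (ye x) mulrA -zXc ze.
case: (no_decomposition ec e_idem e0 e1).
Qed.

End CentralElements.

(** * Central elements of L as classes of degree 0 *)

Section CentralClasses.
Variables (k : fieldType) (L : falgType k) (P : resolution (regbim L)).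

Section Class.
Variable c : L.
Hypothesis c_central : forall x, c * x = x * c.

Lemma etens_central_elt (x : env L) : etens c 1 * x = x * etens c 1.
Proof.
move: x; apply: tensor_ext => [x y|x y|a b]; rewrite ?(mulrDr, mulrDl) //.
by rewrite [tpure _ _ a b]/(etens a b) !etensM mul1r mulr1 c_central.
Qed.

Definition central_gmap : gmap P.
Proof.
exists (fun p m x => etens c 1 *: gm (gm1 P) p m x).
- by move=> p m a x y; rewrite linearP scalerDr !scalerA etens_central_elt.
- by move=> p m pm x; rewrite gm_low // scaler0.
- have [b hb] := gm_fin (gm1 P); exists b => p m h x.
  by rewrite hb // scaler0.
- by move=> p m x; rewrite gm_d linearZ.
Defined.

Definition central_cocycle : cocycle P (regbim L).
Proof.
exists (fun n x => res_aug P (gm central_gmap n 0 x)).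
- by move=> n a x y; rewrite !linearP.
- by have [b hb] := gm_fin central_gmap; exists b => n bn x; rewrite hb ?lim0.
- by move=> n x; rewrite gm_d res_aug_d.
Defined.

Lemma central_lift : is_lift central_cocycle central_gmap.
Proof. by []. Qed.

Lemma central_cocycle0 p : cc central_cocycle 0 p = c * (res_aug P p : L).
Proof.
transitivity (res_aug P (etens c 1 *: p)).
  by rewrite -[LHS]/(res_aug P (etens c 1 *: gm1_fun 0 p)) gm1E.
by rewrite linearZ [LHS]bimactE mulr1.
Qed.

Lemma central_cocycleS n p : n != 0%N -> cc central_cocycle n p = 0.
Proof.
move=> n0; transitivity (res_aug P (etens c 1 *: (0 : P 0))).
  rewrite -[LHS]/(res_aug P (etens c 1 *: gm1_fun 0 p)) gm1_neq //.
  exact/eqP.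
by rewrite scaler0 lim0.
Qed.

Definition central_class : HH P := ext_class central_cocycle.

Lemma central_class_deg0 : hh_comp 0 central_class = central_class.
Proof.
rewrite [LHS]ext_compE; congr ext_class; apply: cocycleP => n x /=.
by case: eqP => // /eqP n0; rewrite -[RHS]/(cc central_cocycle n x) central_cocycleS.
Qed.

End Class.

Lemma central_class_ext c c' (cc1 : forall x, c * x = x * c)
    (cc2 : forall x, c' * x = x * c') :
  c = c' -> central_class cc1 = central_class cc2.
Proof.
move=> e; congr ext_class; apply: cocycleP => -[|n] p.
  by rewrite !central_cocycle0 e.
by rewrite !central_cocycleS.
Qed.

Lemma central_class_mul c c' (cc1 : forall x, c * x = x * c) (cc2 : forall x, c' * x = x * c')
    (cc3 : forall x, (c * c') * x = x * (c * c')) :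
  central_class cc1 * central_class cc2 = central_class cc3.
Proof.
rewrite [LHS](yoneda_class _ (central_lift cc2)); congr ext_class.
apply: cocycleP => n p; rewrite cactE.
transitivity (etens c' 1 *: (cc (central_cocycle cc1) n p : regbim L)).
  rewrite -{2}[central_cocycle cc1]cact1 cactE scaler_sumr; apply: eq_bigr => m _.
  by rewrite [gm (central_gmap cc2) n m p]/= -linearZ.
rewrite [LHS]bimactE mulr1; case: n p => [|n] p; last by rewrite !central_cocycleS ?mulr0.
by rewrite !central_cocycle0 mulrA cc2.
Qed.

Lemma central_class1 (cc1 : forall x, 1 * x = x * 1) : central_class cc1 = 1.
Proof.
congr ext_class; apply: cocycleP => -[|n] p.
  by rewrite central_cocycle0 mul1r /= gm1E.
by rewrite central_cocycleS // /= gm1_neq // lim0.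
Qed.

(** A cocycle of degree 0 kills boundaries, so its value at p depends only on the augmentation of p,
    which p shares with a left and a right multiple of u. Hence the value is the augmentation of p
    times z u on either side, and z u is central. *)
Lemma deg0_central (z : cocycle P (regbim L)) (u : P 0) : res_aug P u = 1 ->
  exists c : forall x, (cc z 0 u : L) * x = x * (cc z 0 u : L),
    cc_comp 0 z = central_cocycle c.
Proof.
move=> u1.
have zl p : cc z 0 p = (res_aug P p : L) * cc z 0 u.
  have [|v vE] := @res_exact0 _ _ P (p - lact (res_aug P p) u).
    by rewrite limB lact_linear u1 [lact _ _]bimactE !mulr1 subrr.
  apply/eqP; rewrite -subr_eq0; apply/eqP.
  transitivity (cc z 0 (p - lact (res_aug P p) u)); last by rewrite -vE cc_d.
  rewrite ccoB; congr (_ - _); symmetry.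
  transitivity (lact (res_aug P p) (cc z 0 u)); first exact: (lact_linear (cc z 0)).
  by rewrite [LHS]bimactE mulr1.
have zr p : cc z 0 p = (cc z 0 u : L) * res_aug P p.
  have [|v vE] := @res_exact0 _ _ P (p - ract u (res_aug P p)).
    by rewrite limB ract_linear u1 [ract _ _]bimactE !mul1r subrr.
  apply/eqP; rewrite -subr_eq0; apply/eqP.
  transitivity (cc z 0 (p - ract u (res_aug P p))); last by rewrite -vE cc_d.
  rewrite ccoB; congr (_ - _); symmetry.
  transitivity (ract (cc z 0 u) (res_aug P p)); first exact: (ract_linear (cc z 0)).
  by rewrite [LHS]bimactE mul1r.
have c x : (cc z 0 u : L) * x = x * (cc z 0 u : L).
  by have [p <-] := res_aug_surj P (x : regbim L); rewrite -zl -zr.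
exists c; apply: cocycleP => n p /=.
case: eqP => [n0|/eqP n0]; last first.
  by rewrite -[RHS]/(cc (central_cocycle c) n p) central_cocycleS.
by subst n; rewrite -[RHS]/(cc (central_cocycle c) 0 p) central_cocycle0.
Qed.

End CentralClasses.

Section Local.
Variables (k : fieldType) (L : falgType k) (P : resolution (regbim L)).
Variables (H : comAlgType k) (iota : {lrmorphism H -> HH P}).
Hypotheses (L_indec : indecomposable L) (graded : graded_subalgebra iota)
  (HH0 : contains_HH0 iota).
Local Notation D := (mod_jacobson L).

Lemma central_power (x : H) (c : L) (cc1 : forall y, c * y = y * c) :
  iota x = central_class P cc1 -> forall n (ccn : forall y, c ^+ n * y = y * c ^+ n),
  iota (x ^+ n) = central_class P ccn.
Proof.
move=> xc; elim=> [|n IHn] ccn; first by rewrite rmorph1 central_class1.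
have cn y : c ^+ n * y = y * c ^+ n by symmetry; apply: commrX; symmetry; apply: cc1.
have cSn y : c * c ^+ n * y = y * (c * c ^+ n) by rewrite -exprS.
have -> : iota (x ^+ n.+1) = iota x * iota (x ^+ n) by rewrite exprS; apply: rmorphM.
rewrite xc (IHn cn) (central_class_mul P cc1 cn cSn).
by apply: central_class_ext; rewrite -exprS.
Qed.

(* H^0 is the center of L, which is local. *)
Lemma deg0_nilpotent_or_unit (x : H) (z : cocycle P (regbim L)) (u : P 0) :
    res_aug P u = 1 -> iota x = ext_class (cc_comp 0 z) ->
  (exists n, x ^+ n = 0) \/
  exists c : L, (cc z 0 u : L) * c = 1 /\ exists y, x * y = 1.
Proof.
move=> u1; have [c zE] := deg0_central z u1; rewrite zE => xE.
have [[n cn]|[d cd]] := central_nilpotent_or_unit L_indec c.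
  left; exists n; apply: (proj1 graded).
  have ccn y : (cc z 0 u : L) ^+ n * y = y * (cc z 0 u : L) ^+ n.
    by rewrite cn mul0r mulr0.
  rewrite (central_power xE ccn) rmorph0; apply/ext_class_eq0.
  split=> [p|]; first by rewrite central_cocycle0 cn mul0r.
  by exists (fun _ => \0%R) => m p; rewrite central_cocycleS.
right; exists d; split=> //.
have dc y : d * y = y * d.
  rewrite -[LHS]mulr1 -cd -!mulrA (mulrA y) -(c y).
  by rewrite !mulrA -(c d) cd mul1r.
have [y yE] := HH0 (central_class_deg0 P dc); exists y.
apply: (proj1 graded).
have -> : iota (x * y) = iota x * iota y by exact: rmorphM.
rewrite xE yE rmorph1.
have c3 w : (cc z 0 u : L) * d * w = w * ((cc z 0 u : L) * d) by rewrite cd mul1r mulr1.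
rewrite [LHS](central_class_mul P c dc c3).
have c1 w : 1 * w = w * 1 :> L by rewrite mul1r mulr1.
by rewrite (central_class_ext P c3 c1 cd) central_class1.
Qed.

Lemma nonzero_to_top (M : lmodType L) : fin_gen M -> (exists x : M, x != 0) ->
  exists (f : {linear M -> D}) x, f x != 0.
Proof.
move=> fgM nz; have [m [hm [f [mmax [x fx]]]]] := nonzero_to_simple fgM nz.
have [p [i pi]] := lquot_retract hm mmax.
exists (i \o f)%FUN, x; apply: contra fx => /eqP ifx.
by rewrite -(pi (f x)) [i _]ifx lim0.
Qed.

(** Up to an element of m, h is its degree 0 component. If that is nilpotent it lies in m. If not,
    it is given by a central unit of L, and h acts by this unit on the nonzero maps from M to D in
    degree 0 of E(M), so it annihilates nothing there. *)
Lemma ann_graded_maximal (M : lmodType L) (m : set H) : fin_gen M -> (exists x : M, x != 0) ->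
    maximal_left_ideal m -> (forall y, positive (iota y) -> m y) ->
  (Ann iota M D `<=` m)%classic.
Proof.
move=> fgM nz m_max m_pos h h_ann.
have [u u1] := res_unit P; pose z := ext_repr (iota h).
have [h0 h0E] := proj2 graded 0%N h.
have h0E' : iota h0 = ext_class (cc_comp 0 z) by rewrite h0E.
have hpos : positive (iota (h - h0)).
  rewrite /positive; have -> : iota (h - h0) = iota h - iota h0 by exact: rmorphB.
  rewrite h0E' -(ext_reprK (iota h)) -/z.
  rewrite -[ext_class z - _]/(ext_class z + - ext_class _).
  rewrite -(add_morphN (@ext_classD _ _ _)) -ext_classD [LHS]ext_compE.
  apply/ext_class_eq0; split=> [p|]; first by rewrite /= subrr.
  by exists (fun _ => \0%R).
rewrite -[h](subrK h0); have [[m0 mD mM] m1 _] := m_max.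
apply: mD; first exact: m_pos.
have [[n hn]|[c [zc _]]] := deg0_nilpotent_or_unit u1 h0E'.
  by apply: (max_ideal_exp m_max (n := n)); rewrite hn.
have [f [x fx]] := nonzero_to_top fgM nz.
pose e : cocycle (tcx P M) D := cpost f (faug (fid P M)).
have := h_ann (ext_class e).
rewrite ext_scaleE -(ext_reprK (iota h)) (ext_act_class _ (liftP _)) => /ext_class_eq0[e0 _].
move/eqP: fx; case.
rewrite -[x]scale1r -zc -scalerA -(e0 (pure u (c *: x))) cactE big_ord1.
rewrite -[cc e 0 _]/(f (taug P M (gm1_fun (Q := tcx P M) 0 _))) gm1E; congr (f _).
by rewrite (taug_lift _ _ (liftP _)).
Qed.

End Local.

(** * The realization theorem *)

Section Realization.
Variables (k : closedFieldType) (L : falgType k) (P : resolution (regbim L)).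
Variables (H : comAlgType k) (iota : {lrmorphism H -> HH P}).
Hypotheses (L_indec : indecomposable L) (graded : graded_subalgebra iota)
  (H_noeth : noetherian H) (HH0 : contains_HH0 iota).
Local Notation D := (mod_jacobson L).
Hypothesis D_fin : fin_gen (ext_along iota D D).

Lemma hh_comp_comp i j (x : HH P) :
  hh_comp i (hh_comp j x) = if i == j then hh_comp j x else 0.
Proof.
rewrite -(ext_reprK x) [hh_comp j _]ext_compE [LHS]ext_compE.
case: eqP => [->|ij]; first by congr ext_class; apply: cocycleP => n p /=; case: eqP.
rewrite -[0]ext_class0; congr ext_class; apply: cocycleP => n p /=.
by case: (n =P i) => // ni; case: (n =P j) => // nj; case: ij; rewrite -ni.
Qed.

Lemma top_neq0 : exists x : D, x != 0.
Proof.
have hz : left_ideal [set x : L | x = 0]%classic.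
  split=> [|x y -> ->|a x ->] /=; rewrite ?addr0 ?mulr0 //.
have [|m [mmax _]] := max_left_ideal_exists hz; first by apply/eqP/oner_neq0.
exists (qmap (jacobson_submod L) 1); apply/eqP => /qmap_eq0/asboolP h.
by have [_ m1 _] := mmax; apply: m1; apply: h.
Qed.

Lemma top_fin_gen : fin_gen D.
Proof.
apply: (fin_gen_image (p := qmap (jacobson_submod L))); last exact: regular_fin_gen.
exact: qmap_surj.
Qed.

Lemma ann_top (m : set H) : maximal_left_ideal m -> (Ann iota D D `<=` m)%classic.
Proof.
move=> m_max h h_ann; have [N hN] : exists N, iota h ^+ N = 0.
  exact: (ann_nilpotent h_ann).
apply: (max_ideal_exp m_max (n := N)).
have -> : h ^+ N = 0.
  by apply: (proj1 graded); rewrite rmorph_exp hN rmorph0.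
by have [[]] := m_max.
Qed.

(** Both extra properties of M serve the induction. If some y in H^+ is outside m, generation up to
    powers of y allows [descent_variety]; if m contains H^+, then it contains eta, and both
    annihilators because the modules are nonzero. *)
Lemma variety_intersection (s : seq H) :
    (forall eta, eta \in s -> exists n, hh_comp n.+1 (iota eta) = iota eta) ->
  exists M : lmodType L, [/\ fin_gen M, exists x : M, x != 0,
    forall y, positive (iota y) -> fin_gen_upto y (ext_along iota M D) &
    forall m, maximal_left_ideal m ->
      ((Ann iota M D `<=` m)%classic <-> (forall eta, eta \in s -> m eta))].
Proof.
elim: s => [_|eta s IHs deg].
  exists D; split; [exact: top_fin_gen | exact: top_neq0 | | ].
    by move=> y _; apply: fin_gen_uptoW.
  by move=> m m_max; split=> // _; apply: ann_top.
have [e es|M [fgM nzM fgE varM]] := IHs.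
  by apply: deg; rewrite inE es orbT.
have [n eta_deg] := deg eta (mem_head _ _).
have [M' [i [fgM' i_inj fgE' step]]] := descent_variety H_noeth fgM eta_deg fgE.
have nzM' : exists x : M', x != 0.
  have [x x0] := nzM; exists (i x); apply: contra x0 => /eqP ix.
  by apply/eqP/i_inj; rewrite ix lim0.
exists M'; split=> // m m_max.
have split_s : (forall e, e \in eta :: s -> m e) <-> (forall e, e \in s -> m e) /\ m eta.
  split=> [h|[h meta] e].
    by split=> [e es|]; apply: h; rewrite inE ?es ?orbT ?eqxx.
  by rewrite inE => /predU1P[->|/h].
rewrite split_s -(varM m m_max).
have [[y [ypos my]]|all_pos] := pselect (exists y, positive (iota y) /\ ~ m y).
  exact: step my.
have m_pos y : positive (iota y) -> m y.
  by move=> ypos; apply: contrapT => my; apply: all_pos; exists y.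
split=> _; last exact: (ann_graded_maximal L_indec graded HH0).
split; first exact: (ann_graded_maximal L_indec graded HH0).
by apply: m_pos; rewrite /positive -eta_deg hh_comp_comp.
Qed.

Lemma zero_module : exists M : lmodType L, fin_gen M /\ forall x : M, x = 0.
Proof.
have hT : left_ideal (setT : set L) by [].
exists (lquot hT); split; first exact: lquot_fin_gen.
by move=> x; have [y <-] := lq_surj x; apply/lq_eq0.
Qed.

Lemma variety_realization (a : set H) : homogeneous_ideal iota a ->
  exists M : lmodType L, fin_gen M /\ variety iota M = variety_ideal a.
Proof.
move=> [a_ideal a_hom]; have [a0 aD aM] := a_ideal.
(* The unit ideal has empty variety, and 1 annihilates the Ext groups of the zero module. *)
have [a1|na1] := pselect (a 1).
  have [M [fgM M0]] := zero_module; exists M; split=> //.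
  apply/seteqP; split=> m [m_max sub]; have [_ m1 _] := m_max; case: m1; last exact: sub.
  apply: sub => e; rewrite scale1r; elim/ext_ind: e => f.
  have -> : f = 0; last exact: ext_class0.
  apply: cocycleP => n; apply: (tens_ext (g := \0) (f := (cc f n : {linear _ -> _}))) => p x.
  rewrite (M0 x) pure0r; exact: cco0.
have [r [g gE]] := H_noeth a_ideal.
have ag i : a (g i).
  rewrite gE /=; exists (fun j => (j == i)%:R); rewrite (bigD1 i) //= eqxx mul1r.
  by rewrite big1 ?addr0 // => j /negbTE ->; rewrite mul0r.
pose b i := projT1 (cid (ext_comp_sum (iota (g i)))).
have bE i : iota (g i) = \sum_(n < b i) hh_comp n (iota (g i)) :=
  projT2 (cid (ext_comp_sum (iota (g i)))).
pose y i n := projT1 (cid (proj2 graded n (g i))).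
have yE i n : iota (y i n) = hh_comp n (iota (g i)) := projT2 (cid (proj2 graded n (g i))).
have ay i n : a (y i n) by apply: (a_hom n (g i)).
have gy i : g i = \sum_(n < b i) y i n.
  apply: (proj1 graded); rewrite bE [RHS]rmorph_sum; apply: eq_bigr => n _.
  exact/esym/yE.
(* Only positive degrees are listed. The common bound may add components beyond [b i], which are in
   a all the same. *)
pose s := [seq y i n.+1 | i <- enum 'I_r, n <- seq.iota 0 (\max_i b i)].
have [eta /allpairsP[[i n] [_ _ ->]]|M [fgM _ _ varM]] := @variety_intersection s.
  by exists n; rewrite yE hh_comp_comp eqxx.
exists M; split=> //; apply/seteqP; split=> m [m_max sub]; split=> //; last first.
  by apply/(varM m m_max) => eta /allpairsP[[i n] [_ _ ->]]; apply: sub.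
have [[m0 mD mM] m1 _] := m_max.
have s_m := proj1 (varM m m_max) sub.
suff mg i : m (g i).
  move=> x; rewrite gE => -[c ->]; apply: max_ideal_sum => // i.
  exact: mM.
rewrite gy; apply: max_ideal_sum => // -[[|n] n_lt] /=; last first.
  apply: s_m; apply/allpairsP; exists (i, n); split; rewrite ?mem_enum //.
  rewrite mem_iota /= add0n (leq_trans (ltnW n_lt)) //.
  exact: leq_bigmax.
have [u u1] := res_unit P.
(* The degree 0 component is nilpotent and so in m, or a unit, which would make a the unit ideal. *)
have [[N yN]|[_ [_ [w yw]]]] := deg0_nilpotent_or_unit L_indec graded HH0 u1 (yE i 0%N).
  by apply: (max_ideal_exp m_max (n := N)); rewrite yN.
by case: na1; rewrite -yw mulrC; apply: aM.
Qed.

End Realization.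

Theorem theorem3p4 (k : closedFieldType) (L : falgType k)
  (P : resolution (regbim L))
  (H : comAlgType k) (iota : {lrmorphism H -> HH P}) :
  indecomposable L ->
  graded_subalgebra iota ->
  noetherian H ->
  contains_HH0 iota ->
  fin_gen (ext_along iota (mod_jacobson L) (mod_jacobson L)) ->
  forall a : set H, homogeneous_ideal iota a ->
  exists M : lmodType L, fin_gen M /\ variety iota M = variety_ideal a.
Proof.
by move=> L_indec graded H_noeth HH0 D_fin a; apply: variety_realization.
Qed.
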